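(* Let $(\Lambda,q)$ be a special constrained Willmore surface of type $d$. Let $\mu\in S^1$ (the unit circle in $\mathbb{C}$) and let $\phi^\mu_q:(\underline{\mathbb{R}}^{n+1,1},\mathrm{d}^\mu_q)\to(\underline{\mathbb{R}}^{n+1,1},\mathrm{d})$ be an isometry of bundles preserving connections. Suppose that $p(\lambda)$ is a polynomial conserved quantity of type $d$ of $(\Lambda,q)$ with $p(\mu)$ non-zero. Then $\phi^\mu_q\,p(\mu\lambda)$ is a polynomial conserved quantity of type $d$ of the spectral deformation $(\phi^\mu_q\Lambda,\mathrm{Ad}_{\phi^\mu_q}(q_\mu))$, of parameter $\mu$, of $\Lambda$, where $q_\mu:=\mu^2q^{1,0}+\mu^{-2}q^{0,1}$.
   Context: Ambient setting. Let $n\ge 3$ and let $\mathbb{R}^{n+1,1}$ be Lorentzian space of dimension $n+2$, with inner product $(\,,\,)$, extended complex bilinearly to $\mathbb{C}^{n+2}=(\mathbb{R}^{n+1,1})^{\mathbb{C}}$. Identify $\wedge^2\mathbb{R}^{n+1,1}$ with $o(\mathbb{R}^{n+1,1})$ by $(u\wedge v)(w)=(u,w)v-(v,w)u$. Let $\mathcal{L}$ be the light-cone (nonzero null vectors) and $\mathbb{P}(\mathcal{L})$ its projectivisation, the conformal $n$-sphere. Let $\Lambda:\Sigma\to\mathbb{P}(\mathcal{L})$ be an immersion of an oriented surface (a ''surface''), viewed as a null line subbundle of the trivial bundle $\Sigma\times\mathbb{R}^{n+1,1}$; trivial bundles are underlined. $\Sigma$ carries the conformal structure induced by $\Lambda$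 (the class of $g_\sigma(X,Y)=(\mathrm{d}\sigma(X),\mathrm{d}\sigma(Y))$, $\sigma$ a never-zero section of $\Lambda$) and the corresponding complex structure. Bundles and their complexifications are not distinguished notationally. Set $\Lambda^{1,0}=\Lambda\oplus\mathrm{d}\sigma(T^{1,0}\Sigma)$, $\Lambda^{0,1}=\Lambda\oplus\mathrm{d}\sigma(T^{0,1}\Sigma)$, $\Lambda^{(1)}=\Lambda^{1,0}+\Lambda^{0,1}$. The central sphere congruence is the rank $4$ subbundle $S=\Lambda^{(1)}\oplus\langle\triangle\sigma\rangle$, of signature $(3,1)$, with $\triangle$ the Laplacian of $g_\sigma$. Write $\mathrm{d}=\mathcal{D}+\mathcal{N}$ for the trivial flat connection, where $\mathcal{D}$ is the sum of the connections induced by $\mathrm{d}$ on $S$ and $S^\perp$. Superscripts $1,0$ and $0,1$ denote type components. Constrained Willmore surfaces. $(\Lambda,q)$ is a constrained Willmore surface (and $q$ a multiplier) if $q\in\Omega^1(\Lambda\wedge\Lambda^{(1)})$ is a real form with $\mathrm{d}^{\mathcal{D}}q=0$ and $\mathrm{d}^{\mathcal{D}}{*\mathcal{N}}=2[q\wedge *\mathcal{N}]$ (where $[\omega_1\wedge\omega_2](X,Y)=[\omega_1(X),\omega_2(Y)]-[\omega_1(Y),\omega_2(X)]$). Set, for $\lambda\in\mathbb{C}\setminus\{0\}$, $$\mathrm{d}^\lambda_q=\mathcal{D}+\lambda\mathcal{N}^{1,0}+\lambda^{-1}\mathcal{N}^{0,1}+(\lambda^2-1)q^{1,0}+(\lambda^{-2}-1)q^{0,1}.$$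 It is known that $(\Lambda,q)$ is constrained Willmore if and only if $\mathrm{d}^\lambda_q$ is flat for all $\lambda\in\mathbb{C}\setminus\{0\}$. For $\mu\in S^1$, $\mathrm{d}^\mu_q$ is a real flat metric connection, so, on simply connected open sets, there is an isometry of bundles $\phi^\mu_q$ intertwining $\mathrm{d}^\mu_q$ and $\mathrm{d}$ (i.e. $\mathrm{d}\circ\phi^\mu_q=\phi^\mu_q\circ\mathrm{d}^\mu_q$), unique up to a constant element of $O(\mathbb{R}^{n+1,1})$. The surface $\phi^\mu_q\Lambda$, with multiplier $\mathrm{Ad}_{\phi^\mu_q}(q_\mu)=\phi^\mu_q q_\mu(\phi^\mu_q)^{-1}$, is known to be a constrained Willmore surface, the spectral deformation of $\Lambda$ of parameter $\mu$. Polynomial conserved quantities. For $d\in\mathbb{N}_0$, a polynomial conserved quantity of type $d$ of a constrained Willmore surface $(\Lambda,q)$ is a Laurent polynomial $p(\lambda)=\sum_{k=-d}^d p_k\lambda^k$ with $p_k\in\Gamma(\underline{\mathbb{C}}^{n+2})$ such that $p_{-k}=\overline{p_k}$ for all $k$; $p_d\in\Gamma(S^\perp)$; $p_k\in\Gamma(S^\perp)$ if $k,d$ have the same parity and $p_k\in\Gamma(S)$ otherwise; $p(1)\neq0$; and $\mathrm{d}^\lambda_q p(\lambda)=0$ for all $\lambda\in\mathbb{C}\setminus\{0\}$. $(\Lambda,q)$ is a special constrained Willmore surface of type $d$ if it admits a polynomial conserved quantity of type $d$. The theory is local: restriction to a suitable non-empty open subset of $\Sigma$ is understood throughout. *)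

(* Defs.v *)
From HB Require Import structures.
From mathcomp Require Import all_boot all_order all_algebra.
From mathcomp Require Import all_classical all_reals all_analysis.
From mathcomp Require Import complex.

Set Implicit Arguments.
Unset Strict Implicit.
Unset Printing Implicit Defensive.

Import Order.TTheory GRing.Theory Num.Theory.
Import numFieldNormedType.Exports.

Local Open Scope classical_set_scope.
Local Open Scope ring_scope.
Local Open Scope complex_scope.

(* The surface is (an oriented coordinate chart of) an oriented surface: an
   open set U of R^2, points being row vectors.  The coordinates are arbitrary;
   the complex structure is the one induced by the map to the conformal sphere
   and is computed from the induced metric, see [Jmx].  A form on U is given by
   its values on the two coordinate vector fields, so a 1-form is a family
   indexed by 'I_2, and a 2-form is its value on (d_0, d_1). *)

Section Lorentz.
Variables (K : fieldType) (n : nat).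

(* signature (n+1, 1); the last coordinate is timelike *)
Definition eta : 'M[K]_n.+2 :=
  diag_mx (\row_(j < n.+2) (if j == ord_max then - 1 else 1)).

Definition lor (u v : 'cV[K]_n.+2) : K := (u^T *m eta *m v) 0 0.

(* the endomorphism w |-> (u, w) v - (v, w) u *)
Definition wedge (u v : 'cV[K]_n.+2) : 'M[K]_n.+2 :=
  v *m u^T *m eta - u *m v^T *m eta.

Definition wedgev (V W : {vspace 'cV[K]_n.+2}) : {vspace 'M[K]_n.+2} :=
  <<[seq wedge u v | u <- vbasis V, v <- vbasis W]>>%VS.

Definition lorthogonal (V : {vspace 'cV[K]_n.+2}) (w : 'cV[K]_n.+2) : Prop :=
  forall u, u \in V -> lor w u = 0.

(* The orthogonal projection onto V; it exists and is unique exactly when the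
   inner product is nondegenerate on V, and is 0 by convention otherwise. *)
Definition orth_proj (V : {vspace 'cV[K]_n.+2}) : 'M[K]_n.+2 :=
  xget 0 [set A : 'M[K]_n.+2 |
    forall w, A *m w \in V /\ lorthogonal V (w - A *m w)].

End Lorentz.

Section Calculus.
Variable R : realType.
Local Notation C := R[i].
Local Notation P := 'rV[R]_2.

Definition dcoord (i : 'I_2) : P := delta_mx 0 i.

Definition pd (V : normedModType R) (i : 'I_2) (f : P -> V) : P -> V :=
  fun x => 'D_(dcoord i) f x.

(* C^infinity on U: every iterated partial derivative is differentiable *)
Definition smooth (V : normedModType R) (U : set P) (f : P -> V) : Prop :=
  forall (s : seq 'I_2) (x : P), U x -> differentiable (foldr (@pd V) f s) x.

Definition cplx a b (A : 'M[R]_(a, b)) : 'M[C]_(a, b) :=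
  map_mx (fun r => r%:C) A.
Definition re_mx a b (A : 'M[C]_(a, b)) : 'M[R]_(a, b) :=
  map_mx (@complex.Re R) A.
Definition im_mx a b (A : 'M[C]_(a, b)) : 'M[R]_(a, b) :=
  map_mx (@complex.Im R) A.
Definition conj_mx a b (A : 'M[C]_(a, b)) : 'M[C]_(a, b) :=
  map_mx (@conjc R) A.

(* C-valued fields are differentiated through their real and imaginary parts,
   since R[i] is not a normed R-module in the library *)
Definition cpd a b (i : 'I_2) (F : P -> 'M[C]_(a.+1, b.+1)) (x : P) :
    'M[C]_(a.+1, b.+1) :=
  cplx (pd i (fun y => re_mx (F y)) x) +
  'i%C *: cplx (pd i (fun y => im_mx (F y)) x).

Definition csmooth a b (U : set P) (F : P -> 'M[C]_(a.+1, b.+1)) : Prop :=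
  smooth U (fun y => re_mx (F y)) /\ smooth U (fun y => im_mx (F y)).

End Calculus.

Section Surface.
Variables (R : realType) (n : nat).
Local Notation C := R[i].
Local Notation P := 'rV[R]_2.
Local Notation rvec := 'cV[R]_n.+2.
Local Notation cvec := 'cV[C]_n.+2.
Local Notation cend := 'M[C]_n.+2.

(* s is a smooth never-zero section of L near x *)
Definition is_lift (L : P -> {vspace rvec}) (x : P) (s : P -> rvec) : Prop :=
  exists V : set P, [/\ open V, V x, smooth V s &
    forall y, V y -> s y != 0 /\ L y = <[s y]>%VS].

(* L is a null line subbundle over U, and the map x |-> L x to the projective
   light-cone is an immersion: v |-> ds(v) mod L is injective. *)
Definition is_surface (U : set P) (L : P -> {vspace rvec}) : Prop :=
  [/\ open U,
      forall x v, U x -> v \in L x -> lor v v = 0 &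
      forall x, U x -> exists2 s, is_lift L x s &
        free [:: s x; pd 0 s x; pd 1 s x]].

(* A choice of section of L near x.  The complex structure and the bundles
   defined from it do not depend on this choice. *)
Definition local_lift (L : P -> {vspace rvec}) (x : P) : P -> rvec :=
  xget (fun=> 0) [set s | is_lift L x s].

Definition metric (s : P -> rvec) (x : P) : 'M[R]_2 :=
  \matrix_(i, j) lor (pd i s x) (pd j s x).

(* Rotation by +90 degrees for the metric (E F; F G): the j-th column holds the
   coordinates of J d_j, that is
     J d_0 = (- F d_0 + E d_1) / sqrt (E G - F^2),
     J d_1 = (- G d_0 + F d_1) / sqrt (E G - F^2). *)
Definition Jmx (g : 'M[R]_2) : 'M[R]_2 :=
  (Num.sqrt (\det g))^-1 *:
    \matrix_(i, j) (if i == 0 then - g 1 j else g 0 j).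

Definition cstruct (L : P -> {vspace rvec}) (x : P) : 'M[R]_2 :=
  Jmx (metric (local_lift L x) x).

Definition laplacian (s : P -> rvec) (x : P) : rvec :=
  let vol y := Num.sqrt (\det (metric s y)) in
  (vol x)^-1 *: \sum_(i < 2)
    pd i (fun y => \sum_(j < 2)
           (vol y * invmx (metric s y) i j) *: pd j s y) x.

Definition mform a b := 'I_2 -> P -> 'M[C]_(a.+1, b.+1).

Section Types.
Variable L : P -> {vspace rvec}.

Definition compJ a b (w : mform a b) : mform a b := fun j x =>
  \sum_(i < 2) (cstruct L x i j)%:C *: w i x.

Definition type10 a b (w : mform a b) : mform a b := fun j x =>
  2^-1 *: (w j x - 'i%C *: compJ w j x).
Definition type01 a b (w : mform a b) : mform a b := fun j x =>
  2^-1 *: (w j x + 'i%C *: compJ w j x).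
Definition hodge a b (w : mform a b) : mform a b := fun j x => - compJ w j x.

Definition dlift (x : P) : mform n.+1 0 :=
  fun j y => cplx (pd j (local_lift L x) y).

(* ds(T^{1,0}) is spanned by the values of the (1,0)-part of ds *)
Definition Lambda10 (x : P) : {vspace cvec} :=
  <<[:: cplx (local_lift L x x);
        type10 (dlift x) 0%R x; type10 (dlift x) 1%R x]>>%VS.
Definition Lambda01 (x : P) : {vspace cvec} :=
  <<[:: cplx (local_lift L x x);
        type01 (dlift x) 0%R x; type01 (dlift x) 1%R x]>>%VS.
Definition Lambda0 (x : P) : {vspace cvec} := <[cplx (local_lift L x x)]>%VS.
Definition Lambda1 (x : P) : {vspace cvec} := (Lambda10 x + Lambda01 x)%VS.

(* the (complexified) central sphere congruence *)
Definition csc (x : P) : {vspace cvec} :=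
  (Lambda1 x + <[cplx (laplacian (local_lift L x) x)]>)%VS.

Definition projS (x : P) : cend := orth_proj (csc x).
Definition projT (x : P) : cend := 1%:M - projS x.

(* The direct sum of the connections induced by d on S and its orthogonal; on a
   matrix-valued field it acts column by column. *)
Definition calD b (i : 'I_2) (F : P -> 'M[C]_(n.+2, b.+1)) (x : P) :
    'M[C]_(n.+2, b.+1) :=
  projS x *m cpd i (fun y => projS y *m F y) x +
  projT x *m cpd i (fun y => projT y *m F y) x.

(* d - D, evaluated on the constant frame *)
Definition calN : mform n.+1 n.+1 := fun i x =>
  cpd i (fun=> 1%:M : cend) x - calD i (fun=> 1%:M : cend) x.

(* (D_i A) v = D_i (A v) - A (D_i v), evaluated on the constant frame *)
Definition DEnd (i : 'I_2) (A : P -> cend) (x : P) : cend :=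
  calD i A x - A x *m calD i (fun=> 1%:M : cend) x.

Definition dD (w : mform n.+1 n.+1) (x : P) : cend :=
  DEnd 0 (w 1) x - DEnd 1 (w 0) x.

Definition brac (A B : cend) : cend := A *m B - B *m A.
Definition brac_wedge (w1 w2 : mform n.+1 n.+1) (x : P) : cend :=
  brac (w1 0 x) (w2 1 x) - brac (w1 1 x) (w2 0 x).

End Types.

Definition constrained_willmore (U : set P) (L : P -> {vspace rvec})
    (q : mform n.+1 n.+1) : Prop :=
  [/\ is_surface U L,
      forall i, csmooth U (q i),
      forall i x, U x -> conj_mx (q i x) = q i x /\
        q i x \in wedgev (Lambda0 L x) (Lambda1 L x),
      forall x, U x -> dD L q x = 0 &
      forall x, U x ->
        dD L (hodge L (calN L)) x = 2 *: brac_wedge q (hodge L (calN L)) x].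

Definition dlambda (L : P -> {vspace rvec}) (q : mform n.+1 n.+1) (lambda : C)
    (i : 'I_2) (v : P -> cvec) (x : P) : cvec :=
  calD L i v x +
  (lambda *: type10 L (calN L) i x + lambda^-1 *: type01 L (calN L) i x +
   (lambda ^+ 2 - 1) *: type10 L q i x +
   (lambda ^- 2 - 1) *: type01 L q i x) *m v x.

Definition nonzero_section (U : set P) (v : P -> cvec) : Prop :=
  exists2 x, U x & v x != 0.

(* A Laurent polynomial with values in the sections is given as a function of
   lambda (its value at lambda = 0 is irrelevant). *)
Definition conserved_quantity (U : set P) (L : P -> {vspace rvec})
    (q : mform n.+1 n.+1) (d : nat) (p : C -> P -> cvec) : Prop :=
  constrained_willmore U L q /\
  exists c : int -> P -> cvec,
    (forall k : int, (`|k| <= d)%N -> csmooth U (c k)) /\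
    (forall lambda x, lambda != 0 -> U x ->
       p lambda x = \sum_(j < d.*2.+1)
         (lambda ^ (j%:Z - d%:Z)) *: c (j%:Z - d%:Z) x) /\
    (forall (k : int) x, (`|k| <= d)%N -> U x -> c (- k) x = conj_mx (c k x)) /\
    (forall x, U x -> lorthogonal (csc L x) (c d%:Z x)) /\
    (forall (k : int) x, (`|k| <= d)%N -> U x ->
       if odd `|k|%N == odd d then lorthogonal (csc L x) (c k x)
       else c k x \in csc L x) /\
    nonzero_section U (p 1) /\
    (forall lambda i x, lambda != 0 -> U x ->
       dlambda L q lambda i (p lambda) x = 0).

Definition special_constrained_willmore (U : set P) (L : P -> {vspace rvec})
    (q : mform n.+1 n.+1) (d : nat) : Prop :=
  constrained_willmore U L q /\ exists p, conserved_quantity U L q d p.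

(* phi is an isometry of the trivial real bundle over U with
   d o phi = phi o d^mu_q *)
Definition intertwining_isometry (U : set P) (L : P -> {vspace rvec})
    (q : mform n.+1 n.+1) (mu : C) (phi : P -> 'M[R]_n.+2) : Prop :=
  [/\ smooth U phi,
      forall x u v, U x -> lor (phi x *m u) (phi x *m v) = lor u v &
      forall (v : P -> cvec), csmooth U v -> forall i x, U x ->
        cpd i (fun y => cplx (phi y) *m v y) x =
        cplx (phi x) *m dlambda L q mu i v x].

Definition qmu (L : P -> {vspace rvec}) (q : mform n.+1 n.+1) (mu : C) :
    mform n.+1 n.+1 := fun i x =>
  mu ^+ 2 *: type10 L q i x + mu ^- 2 *: type01 L q i x.

Definition gauge_surface (phi : P -> 'M[R]_n.+2) (L : P -> {vspace rvec}) :
    P -> {vspace rvec} := fun x =>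
  (linfun (mulmx (phi x) : rvec -> rvec) @: L x)%VS.

Definition Ad (phi : P -> 'M[R]_n.+2) (w : mform n.+1 n.+1) :
    mform n.+1 n.+1 := fun i x =>
  cplx (phi x) *m w i x *m invmx (cplx (phi x)).

End Surface.

(* Main.v *)
From HB Require Import structures.
Require Import Defs.
From mathcomp Require Import all_boot all_order all_algebra.
From mathcomp Require Import all_classical all_reals all_analysis.
From mathcomp Require Import complex ring lra zify.

Set Implicit Arguments.
Unset Strict Implicit.
Unset Printing Implicit Defensive.

Import Order.TTheory GRing.Theory Num.Theory.
Import numFieldNormedType.Exports.

Local Open Scope classical_set_scope.
Local Open Scope ring_scope.
Local Open Scope complex_scope.

(* Let P be the orthogonal projection onto the central sphere congruence S and
   Rf = 2 P - 1 the reflection in S.  Then N = dP Rf and D = d - N.  Write the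
   combination mu N^{1,0} + mu^-1 N^{0,1} as N_mu = a N + b *N, where
   a = (mu + mu^-1) / 2 and b = i (mu - mu^-1) / 2 satisfy a^2 + b^2 = 1; then
   q_mu = (a^2 - b^2) q + 2 a b *q.  The intertwining property says that phi
   satisfies phi^-1 dphi = - N + N_mu + (q_mu - q), and Schwarz' theorem for phi
   makes this form flat.  The part of the flatness equation that commutes with
   Rf is d^D (q_mu - q) = 0, because of the Codazzi equation d^D N = 0, of
   [N_mu /\ N_mu] = [N /\ N] and of the fact that forms with values in
   Lambda /\ Lambda^(1) commute.  Geometrically, S is spanned by s, d_0 s, d_1 s
   and the trace of the Hessian of s, for any lift s of Lambda.  Since
   phi^-1 dphi kills s and its contraction with ds lies in Lambda, phi maps S
   isomorphically onto the central sphere congruence of phi Lambda.  Gauging by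
   phi therefore turns D + q_mu - q into the connection D', and N_mu into the
   form N', of phi Lambda; so all the equations for phi Lambda reduce to those
   for Lambda, and d^lambda of phi Lambda is phi d^{mu lambda}_q phi^-1. *)

(** * Smooth functions on the plane *)

(** The lift behind the complex structure and S is chosen anew at every point, and separately for
    Lambda and phi Lambda, so nothing can be differentiated through it. Hence every bundle is first
    rewritten with one lift on a neighbourhood; two lifts differ by a smooth nonvanishing factor.
    The trace of the Hessian lies in S exactly when the metric trace of N(ds) vanishes, and the
    symmetry of N_i d_j s does the same for the dual of N; this is why no multiple of N or of its
    dual disturbs the gauged frame. Constrained Willmore means two differential equations, and both
    have to be proved for phi Lambda without flatness of d^lambda for all lambda. The closedness of
    the dual of q is not among the data: phi, given at the single value mu, supplies through Schwarz
    just the combination of d^D q and of its dual that is required. The Willmore equation then rests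
    on angles: N is rotated by an angle, q by twice that angle, and the bracket of q_mu with the
    dual of N_mu sees only the difference. *)

Lemma near_eq_differentiable (R : realType) (V W : normedModType R)
    (f g : V -> W) (x : V) :
  (\forall y \near x, f y = g y) -> differentiable f x -> differentiable g x.
Proof.
move=> fg df; have fgx : f x = g x by exact: nbhs_singleton fg.
apply/diffP => /=.
(* It is enough that some continuous linear map satisfies the first order expansion of g; the
   differential of f is offered. *)
apply: (@getPex _ (fun (dg : {linear V -> W}) => continuous dg /\
  forall y, g y = g (lim (nbhs x)) + dg (y - lim (nbhs x))
                  +o_(y \near x) (y - lim (nbhs x)))).
exists ('d f x); split; first exact: diff_continuous.
rewrite lim_id // => y.
have /diffP[_ /=] := df; rewrite lim_id // => h.
have {}h : f = cst (f x) + 'd f x \o center x +o_x (center x).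
  by rewrite funeqE.
move: y; suff /funeqP : g = cst (g x) + 'd f x \o center x +o_x (center x) by [].
apply/eqaddoP => e e0.
move/eqaddoP : h => /(_ e e0); rewrite !near_simpl => h.
near=> z.
have : `|(f - (cst (f x) + 'd f x \o center x)) z| <= e * `|center x z|.
  by near: z.
suff -> : (f - (cst (f x) + 'd f x \o center x)) z =
          (g - (cst (g x) + 'd f x \o center x)) z by [].
have fgz : f z = g z by near: z.
by rewrite !fctE fgz fgx.
Unshelve. all: by end_near. Qed.

Section CalculusReal.
Variable R : realType.
Local Notation P := 'rV[R]_2.

Lemma differentiable_mxP m n (F : P -> 'M[R]_(m.+1, n.+1)) x :
  differentiable F x <-> forall i j, differentiable (fun y => F y i j) x.
Proof.
split=> [dF i j|dF].
  exact: (@differentiable_comp _ _ _ _ F (fun N : 'M[R]_(m.+1, n.+1) => N i j) x dF (differentiable_coord _ _ _)).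
have -> : F = \sum_(i < m.+1) \sum_(j < n.+1) (fun y => F y i j *: delta_mx i j).
  apply/funext => y; rewrite fct_sumE [LHS]matrix_sum_delta.
  by apply: eq_bigr => i _; rewrite fct_sumE.
apply: differentiable_sum => i; apply: differentiable_sum => j.
exact: differentiableZl.
Qed.

Lemma pd_coord m n (F : P -> 'M[R]_(m.+1, n.+1)) i x k l :
  differentiable F x -> pd i F x k l = pd i (fun y => F y k l) x.
Proof.
move=> dF; rewrite /pd derive_mx; last exact: diff_derivable.
by rewrite mxE.
Qed.

End CalculusReal.

(** * Symmetry of mixed second derivatives *)

Section Schwarz.
Variables (R : realType) (V : normedModType R).
Implicit Types (f : V -> R) (u v x y : V).

Lemma is_derive_line f u y (t : R) : derivable f (t *: u + y) u ->
  is_derive t 1 (fun s => f (s *: u + y)) ('D_u f (t *: u + y)).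
Proof.
have E : (fun h : R => h^-1 *: (f ((h *: 1 + t) *: u + y) - f (t *: u + y)))
  = (fun h => h^-1 *: (f (h *: u + (t *: u + y)) - f (t *: u + y))).
  by apply/funext => h; rewrite /= scalerDl addrA -[h *: 1]/(h * 1) mulr1.
move=> df; split; first by rewrite /derivable /= E.
by rewrite /derive /= E.
Qed.

(** This expression is symmetric in u and v, which is the source of Schwarz' theorem. *)
Let second_diff f u v x (h : R) :=
  f (h *: u + (h *: v + x)) - f (h *: v + x) - f (h *: u + x) + f x.

(** The mean value theorem in the direction u, followed by the first order expansion of ['D_u f] at
    x at two nearby points. Differentiability of ['D_u f] at x alone suffices; its derivatives need
    not be continuous. *)
Let second_diffP f u v x :
  (\forall y \near x, differentiable f y) -> differentiable ('D_u f) x ->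
  forall e : R, 0 < e -> \forall h \near 0^'+,
    `|second_diff f u v x h - h ^+ 2 * 'D_v ('D_u f) x| <= e * h ^+ 2.
Proof.
move=> df ddf e e0.
(* All points used lie within h M of x; the summand 1 keeps M positive when u and v vanish. *)
set M := `|u| + `|v| + 1.
have M0 : 0 < M by rewrite /M ltr_wpDl // addr_ge0.
have /nbhs_ballP[r /= r0 dfr] := df.
have /diff_locallyP[_ /eqaddoP ddf'] := ddf.
have e'0 : 0 < e / (2 * M) by rewrite divr_gt0 // mulr_gt0.
move: (ddf' _ e'0); rewrite near_simpl => /nbhs_ballP[s /= s0 {}ddf'].
near=> h.
have h0 : 0 < h by near: h; exact: nbhs_right_gt.
have hM (w1 w2 : R) : 0 <= w1 <= h -> 0 <= w2 <= h -> `|w1 *: u + w2 *: v| <= h * M.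
  move=> /andP[? ?] /andP[? ?]; rewrite (le_trans (ler_normD _ _)) // !normrZ.
  rewrite !ger0_norm // (@le_trans _ _ (h * `|u| + h * `|v|)) //.
    by rewrite lerD // ler_wpM2r.
  by rewrite /M mulrDr mulr1 mulrDr lerDl ltW.
have hr : h * M < r.
  by rewrite -ltr_pdivlMr //; near: h; apply: nbhs_right_lt; rewrite divr_gt0.
have hs : h * M < s.
  by rewrite -ltr_pdivlMr //; near: h; apply: nbhs_right_lt; rewrite divr_gt0.
have dfp w1 w2 : 0 <= w1 <= h -> 0 <= w2 <= h ->
    differentiable f (w1 *: u + (w2 *: v + x)).
  move=> hw1 hw2; apply: dfr; rewrite -ball_normE /=.
  rewrite addrA opprD addrCA subrr addr0 normrN (le_lt_trans _ hr) //.
  exact: hM.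
have hh : 0 <= h <= h by rewrite lexx ltW.
have h00 : 0 <= (0 : R) <= h by rewrite lexx ltW.
(* The second difference is g(h) - g(0), hence h times a value of [dg] at an intermediate point. *)
pose g t := f (t *: u + (h *: v + x)) - f (t *: u + x).
pose dg t := 'D_u f (t *: u + (h *: v + x)) - 'D_u f (t *: u + x).
have gd t : 0 <= t <= h -> is_derive t 1 g (dg t).
  move=> ht; apply: is_deriveB; apply: is_derive_line; apply: diff_derivable.
    exact: dfp.
  by have := dfp t 0 ht h00; rewrite scale0r add0r.
have [||c hc gE] := @MVT R g dg 0 h h0.
- by move=> t; rewrite in_itv /= => /andP[? ?]; apply: gd; rewrite !ltW.
- apply: derivable_within_continuous => t; rewrite in_itv /= => ht.
  by have [] := gd _ ht.
have {}hc : 0 <= c <= h by move: hc; rewrite in_itv /= => /andP[? ?]; rewrite !ltW.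
have -> : second_diff f u v x h = dg c * h.
  by rewrite -[X in _ * X]subr0 -gE /g /second_diff !scale0r !add0r; ring.
have Dv : 'D_v ('D_u f) x = 'd ('D_u f) x v by rewrite deriveE.
have est w : `|w| <= h * M ->
   `|'D_u f (w + x) - ('D_u f x + 'd ('D_u f) x w)| <= e / 2 * h.
  move=> hw.
  have := ddf' w; rewrite -ball_normE /= sub0r normrN.
  move=> /(_ (le_lt_trans hw hs)); rewrite !fctE /= => /le_trans; apply.
  apply: (@le_trans _ _ (e / (2 * M) * (h * M))).
    by rewrite ler_wpM2l // ltW.
  by rewrite le_eqVlt; apply/orP; left; apply/eqP; field; rewrite gt_eqF.
have est1 := est _ (hM _ _ hc hh).
have := est _ (hM _ _ hc h00); rewrite scale0r addr0 => est2.
rewrite Dv expr2 (_ : _ - _ =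
  (('D_u f (c *: u + h *: v + x) - ('D_u f x + 'd ('D_u f) x (c *: u + h *: v)))
  - ('D_u f (c *: u + x) - ('D_u f x + 'd ('D_u f) x (c *: u)))) * h); last first.
  have -> : 'd ('D_u f) x (c *: u + h *: v) =
      'd ('D_u f) x (c *: u) + h * 'd ('D_u f) x v
    by rewrite linearD; congr (_ + _); exact: linearZ.
  rewrite /dg !addrA; ring.
rewrite normrM (gtr0_norm h0) mulrA ler_wpM2r ?(ltW h0) //.
rewrite (le_trans (ler_normB _ _)) // (le_trans (lerD est1 est2)) //.
by rewrite -mulrDl -splitr.
Unshelve. all: by end_near. Qed.

(** Both mixed derivatives approximate the same second difference divided by h^2, so they are
    compared at one common small h. *)
Lemma derive_comm f u v x :
  (\forall y \near x, differentiable f y) ->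
  differentiable ('D_u f) x -> differentiable ('D_v f) x ->
  'D_v ('D_u f) x = 'D_u ('D_v f) x.
Proof.
move=> df du dv; apply/eqP; rewrite -subr_eq0 -normr_eq0 eq_le normr_ge0 andbT.
apply/ler_addgt0Pr => e e0; rewrite add0r.
have e2 : 0 < e / 2 by rewrite divr_gt0.
have A := @second_diffP f u v x df du _ e2.
have B := @second_diffP f v u x df dv _ e2.
have [h [[{}A {}B] h0]] := @filter_ex _ (0 : R)^'+ _ _
  (filterI (filterI A B) (nbhs_right_gt (0 : R))).
have S : second_diff f u v x h = second_diff f v u x h.
  by rewrite /second_diff [h *: u + (h *: v + x)]addrCA; ring.
rewrite S in A.
have h2 : 0 < h ^+ 2 by rewrite exprn_gt0.
rewrite -(ler_pM2l h2) -[X in X * `|_|](gtr0_norm h2) -normrM mulrBr.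
have sub3 (a b c : R) : a - b = (c - b) - (c - a) by ring.
rewrite (sub3 _ _ (second_diff f v u x h)).
rewrite (le_trans (ler_normB _ _)) // (le_trans (lerD B A)) //.
by rewrite -mulrDl -splitr mulrC.
Qed.

End Schwarz.

(** * Closure of smooth functions under algebra, reciprocals and square roots *)

Section Smooth.
Variables (R : realType) (U : set 'rV[R]_2).
Hypothesis Uo : open U.
Local Notation P := 'rV[R]_2.

Lemma eq_near (T : Type) (f g : P -> T) x :
  (forall y, U y -> f y = g y) -> U x -> \forall y \near x, f y = g y.
Proof. by move=> fg Ux; near do apply: fg; exact: Uo.
Unshelve. all: by end_near. Qed.

Lemma eq_pd (V : normedModType R) i (f g : P -> V) x :
  (forall y, U y -> f y = g y) -> U x -> pd i f x = pd i g x.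
Proof. by move=> fg Ux; apply: near_eq_derive; exact: eq_near Ux. Qed.

(** A graded form of [smooth]: all partial derivatives of order at most k are differentiable. The
    grading permits induction on k for products, reciprocals and roots. *)
Fixpoint Ck (V : normedModType R) k (f : P -> V) : Prop :=
  (forall x, U x -> differentiable f x) /\
  if k is k'.+1 then forall i, Ck k' (pd i f) else True.

Lemma Ck_diff (V : normedModType R) k (f : P -> V) x :
  U x -> Ck k f -> differentiable f x.
Proof. by case: k => [|k] Ux [h _]; exact: h. Qed.

Lemma Ck_le (V : normedModType R) k (f : P -> V) : Ck k.+1 f -> Ck k f.
Proof.
elim: k f => [|k IH] f [df hf]; first by split.
by split => // i; apply: IH.
Qed.

Lemma eq_Ck (V : normedModType R) k (f g : P -> V) :
  (forall y, U y -> f y = g y) -> Ck k f -> Ck k g.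
Proof.
elim: k f g => [|k IH] f g fg [df hf]; split => //.
- by move=> x Ux; apply: near_eq_differentiable (df x Ux); exact: eq_near Ux.
- by move=> x Ux; apply: near_eq_differentiable (df x Ux); exact: eq_near Ux.
- by move=> i; apply: IH (hf i) => y Uy; exact: eq_pd Uy.
Qed.

Lemma smoothP (V : normedModType R) (f : P -> V) :
  smooth U f <-> forall k, Ck k f.
Proof.
split=> [|hf s].
  move=> hf k; elim: k f hf => [|k IH] f hf.
    by split => // x; exact: (hf [::]).
  split=> [x|i]; first exact: (hf [::]).
  (* [foldr] applies the last letter of the word first, so a word of derivatives of [pd i f] becomes
     one of f ending in i. *)
  apply: IH => s x Ux.
  by have := hf (rcons s i) x Ux; rewrite foldr_rcons.
elim/last_ind: s f hf => [|s i IH] f hf x Ux; first exact: Ck_diff Ux (hf 0%N).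
by rewrite foldr_rcons; apply: IH Ux => k; exact: (hf k.+1).2.
Qed.

Lemma eq_smooth (V : normedModType R) (f g : P -> V) :
  (forall y, U y -> f y = g y) -> smooth U f -> smooth U g.
Proof. by move=> fg /smoothP sf; apply/smoothP => k; exact: eq_Ck fg (sf k). Qed.

Lemma smooth_pd (V : normedModType R) i (f : P -> V) :
  smooth U f -> smooth U (pd i f).
Proof. by move=> /smoothP sf; apply/smoothP => k; exact: (sf k.+1).2. Qed.

Lemma smooth_diff (V : normedModType R) (f : P -> V) x :
  smooth U f -> U x -> differentiable f x.
Proof. by move=> sf; exact: (sf [::]). Qed.

Lemma smooth_cst (V : normedModType R) (c : V) : smooth U (fun=> c).
Proof.
apply/smoothP => k; elim: k c => [|k IH] c; split => //.
move=> i; apply: (@eq_Ck _ _ (fun=> 0) _ _ (IH 0)) => y _.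
  by rewrite /pd; have /= -> := derive_cst c y (dcoord R i).
Qed.

Section Scalar.
Implicit Types f g : P -> R.

Lemma pdD i f g x : smooth U f -> smooth U g -> U x ->
  pd i (fun y => f y + g y) x = pd i f x + pd i g x.
Proof.
move=> sf sg Ux; apply: (@deriveD _ _ _ f g); apply: diff_derivable.
  exact: smooth_diff.
exact: smooth_diff.
Qed.

Lemma pdM i f g x : differentiable f x -> differentiable g x ->
  pd i (fun y => f y * g y) x = pd i f x * g x + f x * pd i g x.
Proof.
move=> df dg; rewrite /pd [LHS](@deriveM _ _ f g); try exact: diff_derivable.
by rewrite addrC -![_ *: _]/(_ * _) [g x * _]mulrC.
Qed.

Lemma CkD k f g : Ck k f -> Ck k g -> Ck k (fun y => f y + g y).
Proof.
elim: k f g => [|k IH] f g hf hg; split => //.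
- by move=> x Ux; apply: (@differentiableD _ _ _ f g); [exact: Ck_diff Ux hf|exact: Ck_diff Ux hg].
- by move=> x Ux; apply: (@differentiableD _ _ _ f g); [exact: Ck_diff Ux hf|exact: Ck_diff Ux hg].
- move=> i; apply: (eq_Ck _ (IH _ _ (hf.2 i) (hg.2 i))) => y Uy.
  by apply/esym/(@deriveD _ _ _ f g); apply: diff_derivable; [exact: Ck_diff Uy hf|exact: Ck_diff Uy hg].
Qed.

Lemma CkM k f g : Ck k f -> Ck k g -> Ck k (fun y => f y * g y).
Proof.
elim: k f g => [|k IH] f g hf hg; split => //.
- by move=> x Ux; apply: (@differentiableM _ _ f g); [exact: Ck_diff Ux hf|exact: Ck_diff Ux hg].
- by move=> x Ux; apply: (@differentiableM _ _ f g); [exact: Ck_diff Ux hf|exact: Ck_diff Ux hg].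
- move=> i; apply: (eq_Ck _ (CkD (IH _ _ (hf.2 i) (Ck_le hg))
                                 (IH _ _ (Ck_le hf) (hg.2 i)))) => y Uy.
  by rewrite pdM //; [exact: Ck_diff Uy hf|exact: Ck_diff Uy hg].
Qed.

Lemma smoothD f g : smooth U f -> smooth U g -> smooth U (fun y => f y + g y).
Proof.
by move=> /smoothP sf /smoothP sg; apply/smoothP => k; exact: CkD.
Qed.

Lemma smoothM f g : smooth U f -> smooth U g -> smooth U (fun y => f y * g y).
Proof.
by move=> /smoothP sf /smoothP sg; apply/smoothP => k; exact: CkM.
Qed.

Lemma smoothN f : smooth U f -> smooth U (fun y => - f y).
Proof.
move=> sf; apply: (@eq_smooth _ (fun y => (-1) * f y)).
  by move=> y _; rewrite mulN1r.
by apply: smoothM => //; exact: smooth_cst.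
Qed.

Lemma smoothB f g : smooth U f -> smooth U g -> smooth U (fun y => f y - g y).
Proof. by move=> sf sg; apply: smoothD => //; exact: smoothN. Qed.

Lemma smooth_sum (I : Type) (r : seq I) (Q : pred I) (F : I -> P -> R) :
  (forall i, Q i -> smooth U (F i)) ->
  smooth U (fun y => \sum_(i <- r | Q i) F i y).
Proof.
move=> sF; elim: r => [|i r IH].
  by apply: (@eq_smooth R (fun=> 0)) (smooth_cst _) => y _; rewrite big_nil.
have [Qi|nQi] := boolP (Q i).
  apply: (eq_smooth _ (smoothD (sF i Qi) IH)) => y _.
  by rewrite big_cons Qi.
by apply: (eq_smooth _ IH) => y _; rewrite big_cons (negbTE nQi).
Qed.

Lemma smooth_prod (I : Type) (r : seq I) (F : I -> P -> R) :
  (forall i, smooth U (F i)) ->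
  smooth U (fun y => \prod_(i <- r) F i y).
Proof.
move=> sF; elim: r => [|i r IH].
  by apply: (@eq_smooth R (fun=> 1)) (smooth_cst _) => y _; rewrite big_nil.
by apply: (eq_smooth _ (smoothM (sF i) IH)) => y _; rewrite big_cons.
Qed.

(** The derivative of 1/f is - f' (1/f)^2, which involves 1/f only at the lower level. *)
Lemma smoothV f : (forall x, U x -> f x != 0) -> smooth U f ->
  smooth U (fun y => (f y)^-1).
Proof.
move=> f0 /smoothP sf; apply/smoothP; elim=> [|k IH]; split => //.
- by move=> x Ux; apply: (@differentiableV _ _ f) (f0 x Ux); exact: Ck_diff Ux (sf 0%N).
- by move=> x Ux; apply: (@differentiableV _ _ f) (f0 x Ux); exact: Ck_diff Ux (sf 0%N).
- move=> i; have [_ /(_ i) hi] := sf k.+1.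
  have C1 : Ck k (fun=> -1 : R) by have /smoothP := @smooth_cst R (-1).
  apply: (eq_Ck _ (CkM (CkM C1 hi) (CkM IH IH))) => y Uy.
  rewrite /pd [RHS](@deriveV _ _ f) ?f0 //; last first.
    by apply: diff_derivable; exact: Ck_diff Uy (sf 0%N).
  by rewrite mulN1r -[_ *: _]/(_ * _) expr2 invfM mulNr mulrC mulNr.
Qed.

Lemma smooth_sqrt f : (forall x, U x -> 0 < f x) -> smooth U f ->
  smooth U (fun y => Num.sqrt (f y)).
Proof.
move=> f0 sf0; have /smoothP sf := sf0.
have ds x : U x -> differentiable (fun y => Num.sqrt (f y)) x.
  move=> Ux; apply: (@differentiable_comp _ _ _ _ f Num.sqrt).
    exact: smooth_diff Ux.
  by apply/derivable1_diffP; have [] := is_derive1_sqrt (f0 _ Ux).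
apply/smoothP; elim=> [|k IH]; split => //.
move=> i; have [_ /(_ i) hi] := sf k.+1.
have /smoothP C2 := @smooth_cst R 2^-1.
(* [smoothV] asks for a root smooth at all levels, which is what is being proved; the reciprocal is
   controlled up to level k by its own induction. *)
have Vk : Ck k (fun y => (Num.sqrt (f y))^-1).
  elim: k IH {hi} => [|k IH'] hk; split => //.
  - by move=> x Ux; apply: (@differentiableV _ _ (fun y => Num.sqrt (f y))); [exact: ds|rewrite gt_eqF // sqrtr_gt0 f0].
  - by move=> x Ux; apply: (@differentiableV _ _ (fun y => Num.sqrt (f y))); [exact: ds|rewrite gt_eqF // sqrtr_gt0 f0].
  - have Vk := IH' (Ck_le hk).
    have /smoothP C1 := @smooth_cst R (-1).
    move=> j; apply: (eq_Ck _ (CkM (CkM (C1 k) (hk.2 j)) (CkM Vk Vk))) => y Uy.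
    rewrite /pd [RHS](@deriveV _ _ (fun y => Num.sqrt (f y))).
    + by rewrite mulN1r -[_ *: _]/(_ * _) expr2 invfM mulNr mulrC mulNr.
    + by rewrite gt_eqF // sqrtr_gt0 f0.
    + exact/diff_derivable/ds.
apply: (eq_Ck _ (CkM (C2 k) (CkM hi Vk))) => y Uy.
have dd := ds y Uy.
have h : (fun z => Num.sqrt (f z) * Num.sqrt (f z)) = (fun z => Num.sqrt (f z) ^+ 2).
  by [].
have s0 : Num.sqrt (f y) != 0 by rewrite gt_eqF // sqrtr_gt0 f0.
(* The derivative of the root is obtained by differentiating its square. *)
have : pd i f y = 2 * (pd i (fun z => Num.sqrt (f z)) y * Num.sqrt (f y)).
  rewrite -(@eq_pd _ i (fun z => Num.sqrt (f z) * Num.sqrt (f z)) f) //; last first.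
    by move=> z Uz; rewrite -expr2 sqr_sqrtr // ltW // f0.
  by rewrite pdM //; ring.
by move=> ->; field.
Qed.

Lemma pd_comm i j f x : smooth U f -> U x -> pd i (pd j f) x = pd j (pd i f) x.
Proof.
move=> sf Ux; apply: derive_comm.
- by near do apply: (smooth_diff sf); exact: Uo.
- exact: (smooth_diff (smooth_pd j sf)).
- exact: (smooth_diff (smooth_pd i sf)).
Unshelve. all: by end_near. Qed.

End Scalar.

Lemma smooth_coordP m n (F : P -> 'M[R]_(m.+1, n.+1)) :
  smooth U F <-> forall k l, smooth U (fun y => F y k l).
Proof.
have H r : Ck r F <-> forall k l, Ck r (fun y => F y k l).
  elim: r F => [|r IH] F.
    split=> [[dF _] k l|dF]; split=> // x Ux.
      by apply: (differentiable_mxP F x).1; exact: dF.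
    by apply/differentiable_mxP => k l; case: (dF k l) => + _; apply.
  split=> [[dF sF] k l|dF]; split.
  - by move=> x Ux; apply: (differentiable_mxP F x).1; exact: dF.
  - move=> i; apply: (eq_Ck _ ((IH _).1 (sF i) k l)) => y Uy.
    by rewrite pd_coord //; exact: dF.
  - by move=> x Ux; apply/differentiable_mxP => k l; case: (dF k l) => + _; apply.
  - move=> i; apply/IH => k l; apply: (eq_Ck _ ((dF k l).2 i)) => y Uy.
    rewrite pd_coord //; apply/differentiable_mxP => k' l'.
    by case: (dF k' l') => + _; apply.
split=> [/smoothP sF k l|sF]; apply/smoothP => r; first exact: (H r).1.
by apply/H => k l; have /smoothP := sF k l.
Qed.

End Smooth.

(** * Differentiation of complex matrix-valued functions *)

Section ComplexCalculus.
Variables (R : realType) (U : set 'rV[R]_2).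
Hypothesis Uo : open U.
Local Notation C := R[i].
Local Notation P := 'rV[R]_2.
Local Notation Re := (@complex.Re R).
Local Notation Im := (@complex.Im R).

Lemma complexP (z w : C) : Re z = Re w -> Im z = Im w -> z = w.
Proof. by case: z => a b; case: w => c d /= -> ->. Qed.

Lemma ReD (z w : C) : Re (z + w) = Re z + Re w.
Proof. by case: z => a b; case: w. Qed.
Lemma ImD (z w : C) : Im (z + w) = Im z + Im w.
Proof. by case: z => a b; case: w. Qed.
Lemma ReM (z w : C) : Re (z * w) = Re z * Re w - Im z * Im w.
Proof. by case: z => a b; case: w. Qed.
Lemma ImM (z w : C) : Im (z * w) = Re z * Im w + Im z * Re w.
Proof. by case: z => a b; case: w. Qed.

(** With [cfun_pd], the scalar counterpart of [csmooth] and [cpd]; matrix rules are reduced to it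
    entry by entry. *)
Definition cfun_smooth (f : P -> C) :=
  smooth U (fun y => Re (f y)) /\ smooth U (fun y => Im (f y)).

Definition cfun_pd i (f : P -> C) x : C :=
  (pd i (fun y => Re (f y)) x)%:C + 'i%C * (pd i (fun y => Im (f y)) x)%:C.

Lemma eq_cfun_smooth (f g : P -> C) :
  (forall y, U y -> f y = g y) -> cfun_smooth f -> cfun_smooth g.
Proof.
move=> fg [sr si]; split; [apply: eq_smooth sr|apply: eq_smooth si] => //.
  by move=> y Uy; rewrite fg.
by move=> y Uy; rewrite fg.
Qed.

Lemma Re_cfun_pd i (f : P -> C) x :
  Re (cfun_pd i f x) = pd i (fun y => Re (f y)) x.
Proof. by rewrite /cfun_pd ReD ReM /=; ring. Qed.
Lemma Im_cfun_pd i (f : P -> C) x :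
  Im (cfun_pd i f x) = pd i (fun y => Im (f y)) x.
Proof. by rewrite /cfun_pd ImD ImM /=; ring. Qed.

Lemma cfun_smooth_pd i f : cfun_smooth f -> cfun_smooth (cfun_pd i f).
Proof.
move=> [sr si]; split.
  by apply: eq_smooth (smooth_pd i sr) => // y _; rewrite Re_cfun_pd.
by apply: eq_smooth (smooth_pd i si) => // y _; rewrite Im_cfun_pd.
Qed.

Lemma cfun_smooth_cst c : cfun_smooth (fun=> c).
Proof. by split; exact: smooth_cst. Qed.

Lemma cfun_smoothD f g : cfun_smooth f -> cfun_smooth g ->
  cfun_smooth (fun y => f y + g y).
Proof.
move=> [fr fi] [gr gi]; split.
  by apply: eq_smooth (smoothD _ fr gr) => // y _; rewrite ReD.
by apply: eq_smooth (smoothD _ fi gi) => // y _; rewrite ImD.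
Qed.

Lemma cfun_smoothM f g : cfun_smooth f -> cfun_smooth g ->
  cfun_smooth (fun y => f y * g y).
Proof.
move=> [fr fi] [gr gi]; split.
  apply: eq_smooth (smoothB _ (smoothM _ fr gr) (smoothM _ fi gi)) => // y _.
  by rewrite ReM.
apply: eq_smooth (smoothD _ (smoothM _ fr gi) (smoothM _ fi gr)) => // y _.
by rewrite ImM.
Qed.

Lemma cfun_smooth_real (f : P -> R) :
  smooth U f -> cfun_smooth (fun y => (f y)%:C).
Proof. by move=> sf; split => //=; exact: smooth_cst. Qed.

Lemma cfun_smooth_sum (I : Type) (r : seq I) (F : I -> P -> C) :
  (forall i, cfun_smooth (F i)) ->
  cfun_smooth (fun y => \sum_(i <- r) F i y).
Proof.
move=> sF; elim: r => [|i r IH].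
  by apply: eq_cfun_smooth (cfun_smooth_cst 0) => y _; rewrite big_nil.
apply: eq_cfun_smooth (cfun_smoothD (sF i) IH) => y _.
by rewrite big_cons.
Qed.

Lemma eq_cfun_pd i (f g : P -> C) x :
  (forall y, U y -> f y = g y) -> U x -> cfun_pd i f x = cfun_pd i g x.
Proof.
move=> fg Ux; rewrite /cfun_pd; congr (_%:C + 'i%C * _%:C).
  by apply: (eq_pd Uo) => // y Uy; rewrite fg.
by apply: (eq_pd Uo) => // y Uy; rewrite fg.
Qed.

Lemma cfun_pdD i f g x : cfun_smooth f -> cfun_smooth g -> U x ->
  cfun_pd i (fun y => f y + g y) x = cfun_pd i f x + cfun_pd i g x.
Proof.
move=> [fr fi] [gr gi] Ux; apply: complexP.
  rewrite ReD !Re_cfun_pd.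
  by under [X in pd _ X]eq_fun do rewrite ReD; rewrite (pdD i fr gr).
rewrite ImD !Im_cfun_pd.
by under [X in pd _ X]eq_fun do rewrite ImD; rewrite (pdD i fi gi).
Qed.

Lemma cfun_pdM i f g x : cfun_smooth f -> cfun_smooth g -> U x ->
  cfun_pd i (fun y => f y * g y) x = cfun_pd i f x * g x + f x * cfun_pd i g x.
Proof.
move=> [fr fi] [gr gi] Ux.
have H (h k : P -> R) : smooth U h -> smooth U k ->
  pd i (fun y => h y * k y) x = pd i h x * k x + h x * pd i k x.
  by move=> sh sk; rewrite pdM //; [exact: (smooth_diff sh)|exact: (smooth_diff sk)].
apply: complexP.
  rewrite Re_cfun_pd [in RHS]ReD !ReM !Re_cfun_pd !Im_cfun_pd.
  under [X in pd _ X]eq_fun do rewrite ReM -mulNr.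
  have fiN : smooth U (fun y => - Im (f y)) by exact: smoothN.
  rewrite (pdD i (smoothM Uo fr gr) (smoothM Uo fiN gi) Ux) !H //.
  rewrite (_ : pd i (fun y => - Im (f y)) x = - pd i (fun y => Im (f y)) x).
    by ring.
  apply: (@deriveN _ _ _ (fun y => Im (f y))).
  by apply: diff_derivable; exact: (smooth_diff fi).
rewrite Im_cfun_pd [in RHS]ImD !ImM !Re_cfun_pd !Im_cfun_pd.
under [X in pd _ X]eq_fun do rewrite ImM.
by rewrite (pdD i (smoothM Uo fr gi) (smoothM Uo fi gr) Ux) !H //; ring.
Qed.

Lemma cfun_pd_cst i c x : cfun_pd i (fun=> c) x = 0.
Proof.
by apply: complexP; rewrite ?Re_cfun_pd ?Im_cfun_pd /pd; exact: derive_cst.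
Qed.

Lemma cfun_pd_sum (I : Type) (r : seq I) (F : I -> P -> C) i x :
  (forall k, cfun_smooth (F k)) -> U x ->
  cfun_pd i (fun y => \sum_(k <- r) F k y) x = \sum_(k <- r) cfun_pd i (F k) x.
Proof.
move=> sF Ux; elim: r => [|k r IH].
  rewrite big_nil -[RHS](cfun_pd_cst i 0 x); apply: eq_cfun_pd => // y _.
  by rewrite big_nil.
rewrite big_cons -IH -cfun_pdD //; last exact: cfun_smooth_sum.
by apply: eq_cfun_pd => // y _; rewrite big_cons.
Qed.

Lemma cfun_pd_comm i j f x : cfun_smooth f -> U x ->
  cfun_pd i (cfun_pd j f) x = cfun_pd j (cfun_pd i f) x.
Proof.
move=> [fr fi] Ux.
have ReE k : (fun y => Re (cfun_pd k f y)) = pd k (fun y => Re (f y)).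
  by apply/funext => y; exact: Re_cfun_pd.
have ImE k : (fun y => Im (cfun_pd k f y)) = pd k (fun y => Im (f y)).
  by apply/funext => y; exact: Im_cfun_pd.
have E k l : cfun_pd k (cfun_pd l f) x =
    (pd k (pd l (fun y => Re (f y))) x)%:C +
    'i%C * (pd k (pd l (fun y => Im (f y))) x)%:C by rewrite -(ReE l) -(ImE l).
by rewrite E (pd_comm Uo i j fr Ux) (pd_comm Uo i j fi Ux) -E.
Qed.

Lemma csmoothP a b (F : P -> 'M[C]_(a.+1, b.+1)) :
  csmooth U F <-> forall k l, cfun_smooth (fun y => F y k l).
Proof.
rewrite /csmooth !(smooth_coordP Uo).
split=> [[hr hi] k l|h]; split.
- by apply: eq_smooth (hr k l) => // y _; rewrite mxE.
- by apply: eq_smooth (hi k l) => // y _; rewrite mxE.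
- by move=> k l; apply: eq_smooth (h k l).1 => // y _; rewrite mxE.
- by move=> k l; apply: eq_smooth (h k l).2 => // y _; rewrite mxE.
Qed.

Lemma cpdE a b i (F : P -> 'M[C]_(a.+1, b.+1)) x k l : csmooth U F -> U x ->
  cpd i F x k l = cfun_pd i (fun y => F y k l) x.
Proof.
move=> [sr si] Ux; rewrite !mxE !pd_coord; last 2 first.
- exact: (smooth_diff si).
- exact: (smooth_diff sr).
congr (_%:C + 'i%C * _%:C).
  by apply: (eq_pd Uo) => // y _; rewrite mxE.
by apply: (eq_pd Uo) => // y _; rewrite mxE.
Qed.

Lemma eq_cpd a b i (F G : P -> 'M[C]_(a.+1, b.+1)) x :
  (forall y, U y -> F y = G y) -> U x -> cpd i F x = cpd i G x.
Proof.
move=> FG Ux.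
have E1 : pd i (fun y => re_mx (F y)) x = pd i (fun y => re_mx (G y)) x.
  by apply: (eq_pd Uo) => // y Uy; rewrite FG.
have E2 : pd i (fun y => im_mx (F y)) x = pd i (fun y => im_mx (G y)) x.
  by apply: (eq_pd Uo) => // y Uy; rewrite FG.
by rewrite /cpd E1 E2.
Qed.

Lemma cpd_cst a b i (A : 'M[C]_(a.+1, b.+1)) x : cpd i (fun=> A) x = 0.
Proof.
have E (B : 'M[R]_(a.+1, b.+1)) : pd i (fun=> B) x = 0 by exact: derive_cst.
by rewrite /cpd !E /cplx !map_mx0 scaler0 addr0.
Qed.

Lemma cpd_cplx a b i (F : P -> 'M[R]_(a.+1, b.+1)) x :
  cpd i (fun y => cplx (F y)) x = cplx (pd i F x).
Proof.
rewrite /cpd.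
have -> : (fun y => re_mx (cplx (F y))) = F.
  by apply/funext => y; apply/matrixP => k l; rewrite !mxE.
have -> : (fun y => im_mx (cplx (F y))) = (fun=> 0).
  by apply/funext => y; apply/matrixP => k l; rewrite !mxE.
have -> : pd i (fun=> 0 : 'M[R]_(a.+1, b.+1)) x = 0 by exact: derive_cst.
by rewrite /cplx map_mx0 scaler0 addr0.
Qed.

(* Unifying two partial derivatives by unfolding them does not terminate in
   reasonable time. *)
#[local] Opaque cfun_pd cpd pd.

Section Mx.
Variables a b : nat.
Implicit Types F G : P -> 'M[C]_(a.+1, b.+1).

Lemma eq_csmooth F G : (forall y, U y -> F y = G y) -> csmooth U F -> csmooth U G.
Proof.
move=> FG /csmoothP sF; apply/csmoothP => k l.
by apply: eq_cfun_smooth (sF k l) => y Uy; rewrite FG.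
Qed.

Lemma csmooth_cst (A : 'M[C]_(a.+1, b.+1)) : csmooth U (fun=> A).
Proof. by apply/csmoothP => k l; exact: cfun_smooth_cst. Qed.

Lemma csmoothD F G : csmooth U F -> csmooth U G -> csmooth U (fun y => F y + G y).
Proof.
move=> /csmoothP sF /csmoothP sG; apply/csmoothP => k l.
by apply: eq_cfun_smooth (cfun_smoothD (sF k l) (sG k l)) => y _; rewrite mxE.
Qed.

Lemma cpdD i F G x : csmooth U F -> csmooth U G -> U x ->
  cpd i (fun y => F y + G y) x = cpd i F x + cpd i G x.
Proof.
move=> sF sG Ux; apply/matrixP => k l.
have /csmoothP sF' := sF; have /csmoothP sG' := sG.
transitivity (cfun_pd i (fun y => F y k l + G y k l) x).
  rewrite cpdE //; last exact: csmoothD.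
  by apply: eq_cfun_pd => // y _; rewrite mxE.
by rewrite cfun_pdD // [in RHS]mxE -!cpdE.
Qed.

Lemma csmooth_cpd i F : csmooth U F -> csmooth U (cpd i F).
Proof.
move=> sF; have /csmoothP sF' := sF; apply/csmoothP => k l.
by apply: eq_cfun_smooth (cfun_smooth_pd i (sF' k l)) => y Uy; rewrite cpdE.
Qed.

Lemma cpd_comm i j F x : csmooth U F -> U x ->
  cpd i (cpd j F) x = cpd j (cpd i F) x.
Proof.
move=> sF Ux; apply/matrixP => k l; have /csmoothP sF' := sF.
have H i' j' : cpd i' (cpd j' F) x k l =
    cfun_pd i' (cfun_pd j' (fun y => F y k l)) x.
  apply: etrans (cpdE i' k l (csmooth_cpd j' sF) Ux) _.
  by apply: eq_cfun_pd => // y Uy; exact: cpdE.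
apply: etrans (H i j) _; apply: etrans _ (esym (H j i)).
exact: cfun_pd_comm.
Qed.

Lemma csmoothZ (f : P -> C) F : cfun_smooth f -> csmooth U F ->
  csmooth U (fun y => f y *: F y).
Proof.
move=> sf /csmoothP sF; apply/csmoothP => k l.
by apply: eq_cfun_smooth (cfun_smoothM sf (sF k l)) => y _; rewrite mxE.
Qed.

Lemma cpdZ i (f : P -> C) F x : cfun_smooth f -> csmooth U F -> U x ->
  cpd i (fun y => f y *: F y) x = cfun_pd i f x *: F x + f x *: cpd i F x.
Proof.
move=> sf sF Ux; apply/matrixP => k l; have /csmoothP sF' := sF.
apply: etrans (cpdE i k l (csmoothZ sf sF) Ux) _.
transitivity (cfun_pd i (fun y => f y * F y k l) x).
  by apply: eq_cfun_pd => // y _; rewrite mxE.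
rewrite cfun_pdM // [RHS]mxE [X in _ = X + _]mxE [X in _ = _ + X]mxE.
by congr (_ + _ * _); exact/esym/cpdE.
Qed.

Lemma csmooth_scale (c : C) F : csmooth U F -> csmooth U (fun y => c *: F y).
Proof. by apply: csmoothZ; exact: cfun_smooth_cst. Qed.

Lemma cpd_scale i (c : C) F x : csmooth U F -> U x ->
  cpd i (fun y => c *: F y) x = c *: cpd i F x.
Proof.
move=> sF Ux; rewrite (@cpdZ i (fun=> c)) //; last exact: cfun_smooth_cst.
by rewrite cfun_pd_cst scale0r add0r.
Qed.

Lemma csmoothN F : csmooth U F -> csmooth U (fun y => - F y).
Proof.
move=> sF; apply: eq_csmooth (csmooth_scale (-1) sF) => y _; exact: scaleN1r.
Qed.

Lemma csmoothB F G : csmooth U F -> csmooth U G -> csmooth U (fun y => F y - G y).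
Proof. by move=> sF sG; apply: csmoothD => //; exact: csmoothN. Qed.

Lemma cpdN i F x : csmooth U F -> U x -> cpd i (fun y => - F y) x = - cpd i F x.
Proof.
move=> sF Ux; transitivity (cpd i (fun y => (-1) *: F y) x).
  by apply: eq_cpd => // y _; rewrite scaleN1r.
by apply: etrans (cpd_scale i (-1) sF Ux) _; exact: scaleN1r.
Qed.

Lemma cpdB i F G x : csmooth U F -> csmooth U G -> U x ->
  cpd i (fun y => F y - G y) x = cpd i F x - cpd i G x.
Proof. by move=> sF sG Ux; rewrite cpdD ?cpdN //; exact: csmoothN. Qed.

Lemma csmooth_cplx (F : P -> 'M[R]_(a.+1, b.+1)) :
  smooth U F -> csmooth U (fun y => cplx (F y)).
Proof.
move=> /(smooth_coordP Uo) sF; apply/csmoothP => k l.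
by apply: eq_cfun_smooth (cfun_smooth_real (sF k l)) => y _; rewrite mxE.
Qed.

End Mx.

Lemma csmoothM a b c (F : P -> 'M[C]_(a.+1, b.+1)) (G : P -> 'M[C]_(b.+1, c.+1)) :
  csmooth U F -> csmooth U G -> csmooth U (fun y => F y *m G y).
Proof.
move=> /csmoothP sF /csmoothP sG; apply/csmoothP => k l.
have := cfun_smooth_sum (index_enum 'I_b.+1)
  (fun j => cfun_smoothM (sF k j) (sG j l)).
by apply: eq_cfun_smooth => y _; rewrite mxE.
Qed.

Lemma cpdM a b c i (F : P -> 'M[C]_(a.+1, b.+1)) (G : P -> 'M[C]_(b.+1, c.+1)) x :
  csmooth U F -> csmooth U G -> U x ->
  cpd i (fun y => F y *m G y) x = cpd i F x *m G x + F x *m cpd i G x.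
Proof.
move=> sF sG Ux; apply/matrixP => k l.
have /csmoothP sF' := sF; have /csmoothP sG' := sG.
apply: etrans (cpdE i k l (csmoothM sF sG) Ux) _.
transitivity (cfun_pd i (fun y => \sum_j F y k j * G y j l) x).
  by apply: eq_cfun_pd => // y _; rewrite mxE.
rewrite cfun_pd_sum //; last by move=> j; exact: cfun_smoothM.
rewrite [RHS]mxE [X in _ = X + _]mxE [X in _ = _ + X]mxE -big_split /=.
apply: eq_bigr => j _.
by rewrite cfun_pdM // -(cpdE i k j sF Ux) -(cpdE i j l sG Ux).
Qed.

End ComplexCalculus.

Section MxRing.
Variables (K : comRingType) (a b : nat).
Implicit Types A B : 'M[K]_(a, b).
Lemma addmxE A B i j : (A + B) i j = A i j + B i j. Proof. exact: mxE. Qed.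
Lemma oppmxE A i j : (- A) i j = - A i j. Proof. exact: mxE. Qed.
Lemma scalemxE k A i j : (k *: A) i j = k * A i j. Proof. exact: mxE. Qed.
Lemma zeromxE i j : (0 : 'M[K]_(a, b)) i j = 0. Proof. exact: mxE. Qed.
End MxRing.

(** [mx_expand] writes both sides as linear combinations of noncommutative monomials; [mx_ring] then
    lets [ring] treat the entries of each monomial as atoms. *)
Ltac mx_expand :=
  rewrite ?(mulmxDl, mulmxDr, mulNmx, mulmxN, mulmx1, mul1mx, mulmx0, mul0mx,
     mulmxA, scalerDr, scalerN) -?(scalemxAl, scalemxAr).
Ltac mx_ring :=
  do 6? mx_expand; apply/matrixP => ? ?;
  rewrite ?(addmxE, oppmxE, scalemxE, zeromxE); ring.

(** * The connections D and N of one surface *)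

Section IdempotentDerivative.
Variables (K : numFieldType) (m : nat).
Implicit Types A B C P Q : 'M[K]_m.

(** For identities modulo relations: the difference of the two sides is displayed as a combination
    of vanishing matrices. *)
Lemma sub_eq0 A B C : A - B = C -> C = 0 -> A = B.
Proof. by move=> <- /eqP; rewrite subr_eq0 => /eqP. Qed.

(** Q plays the part of dP, and the second hypothesis is the derivative of P P = P. Such a Q
    exchanges image and kernel of P, hence anticommutes with the reflection. *)
Lemma idem_deriv_odd P Q : P *m P = P -> Q *m P + P *m Q = Q ->
  [/\ Q *m (2 *: P - 1%:M) = Q - 2 *: (P *m Q),
     (2 *: P - 1%:M) *m Q = - (Q *m (2 *: P - 1%:M)) &
     (2 *: P - 1%:M) *m (2 *: P - 1%:M) = 1%:M].
Proof.
move=> PP PQ.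
have PP0 : P *m P - P = 0 by rewrite PP subrr.
have PQ0 : Q *m P + P *m Q - Q = 0 by rewrite PQ subrr.
split.
- apply: (@sub_eq0 _ _ (2 *: (Q *m P + P *m Q - Q))); last by rewrite PQ0 scaler0.
  by mx_ring.
- apply: (@sub_eq0 _ _ (2 *: (Q *m P + P *m Q - Q))); last by rewrite PQ0 scaler0.
  by mx_ring.
- apply: (@sub_eq0 _ _ (4 *: (P *m P - P))); last by rewrite PP0 scaler0.
  by mx_ring.
Qed.

End IdempotentDerivative.

Section ReflectionAlgebra.
Variables (K : numFieldType) (m : nat).
Implicit Types A B N P Q W : 'M[K]_m.

(** The left side is [calD] by the product rule, with Q and F' standing for the derivatives of P and
    F. *)
Lemma proj_connection b P Q (F F' : 'M[K]_(m, b)) :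
  P *m P = P -> Q *m P + P *m Q = Q ->
  P *m (Q *m F + P *m F') + (1%:M - P) *m (- Q *m F + (1%:M - P) *m F') =
  F' - Q *m (2 *: P - 1%:M) *m F.
Proof.
move=> PP PQ.
have PP0 : P *m P - P = 0 by rewrite PP subrr.
have PQ0 : Q *m P + P *m Q - Q = 0 by rewrite PQ subrr.
apply/eqP; rewrite -subr_eq0; apply/eqP.
transitivity (2 *: ((Q *m P + P *m Q - Q) *m F) + 2 *: ((P *m P - P) *m F')).
  by mx_ring.
by rewrite PP0 PQ0 !mul0mx !scaler0 addr0.
Qed.

Lemma mulmx_odd2 (A B Rf : 'M[K]_m) :
  Rf *m B = - (B *m Rf) -> Rf *m Rf = 1%:M ->
  A *m Rf *m (B *m Rf) = - (A *m B).
Proof.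
move=> RB RR; rewrite -!mulmxA (mulmxA Rf B) RB mulNmx -mulmxA RR mulmx1.
by rewrite mulmxN.
Qed.

Lemma odd_mul_refl (Q Rf : 'M[K]_m) :
  Rf *m Q = - (Q *m Rf) -> Rf *m (Q *m Rf) = - (Q *m Rf *m Rf).
Proof. by move=> h; rewrite mulmxA h mulNmx. Qed.

(** Here [Qi] and [Qij] are first and second derivatives of the projection. The second derivatives
    cancel by symmetry, and the factor 2 from dRf = 2 dP matches the two copies of the commutator of
    N_0 and N_1. *)
Lemma codazzi_alg (Rf N0 N1 N01 N10 Q0 Q1 Q01 Q10 : 'M[K]_m) :
  N01 = Q01 *m Rf + Q1 *m (2 *: Q0) -> N10 = Q10 *m Rf + Q0 *m (2 *: Q1) ->
  Q10 = Q01 -> N0 *m N1 = - (Q0 *m Q1) -> N1 *m N0 = - (Q1 *m Q0) ->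
  (N01 - N0 *m N1 + N1 *m N0) - (N10 - N1 *m N0 + N0 *m N1) = 0.
Proof. by move=> -> -> -> -> ->; mx_ring. Qed.

(** The reflection is parallel for D, since R' = 2 N Rf equals the commutator of N and Rf. So D
    preserves the even (e = 1) and the odd (e = -1) endomorphisms. *)
Lemma odd_deriv_brac (N W W' Rf R' : 'M[K]_m) (e : K) :
  Rf *m Rf = 1%:M -> R' = 2 *: (N *m Rf) -> Rf *m N = - (N *m Rf) ->
  Rf *m W *m Rf = e *: W ->
  R' *m W *m Rf + Rf *m W' *m Rf + Rf *m W *m R' = e *: W' ->
  Rf *m (W' - N *m W + W *m N) *m Rf = e *: (W' - N *m W + W *m N).
Proof.
move=> RR dR RN RW.
have -> : R' *m W *m Rf = (2 * e) *: (N *m W).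
  by rewrite dR -scalemxAl -scalemxAl -!mulmxA (mulmxA Rf W Rf) RW
     -scalemxAr scalerA.
have dR2 : R' = - (2 *: (Rf *m N)) by rewrite dR RN scalerN opprK.
have -> : Rf *m W *m R' = - ((2 * e) *: (W *m N)).
  by rewrite dR2 mulmxN -scalemxAr mulmxA RW -scalemxAl scalerA.
have E1 : Rf *m (N *m W) *m Rf = - (e *: (N *m W)).
  by rewrite mulmxA RN !mulNmx -!mulmxA (mulmxA Rf W Rf) RW
     -scalemxAr.
have E2 : Rf *m (W *m N) *m Rf = - (e *: (W *m N)).
  have NR : N *m Rf = - (Rf *m N) by rewrite RN opprK.
  by rewrite -!mulmxA NR !mulmxN !mulmxA RW -scalemxAl.
move=> H; rewrite mulmxDr mulmxBr mulmxDl mulmxBl E1 E2.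
have {H} -> : Rf *m W' *m Rf = e *: W' - (2 * e) *: (N *m W) + (2 * e) *: (W *m N).
  by rewrite -H; mx_ring.
by mx_ring.
Qed.

End ReflectionAlgebra.

Section OneSurface.
Variables (R : realType) (n : nat) (U : set 'rV[R]_2).
Local Notation C := R[i].
Local Notation P := 'rV[R]_2.
Local Notation cend := 'M[C]_n.+2.
Variable L : P -> {vspace 'cV[R]_n.+2}.
Hypothesis Uo : open U.
Hypothesis Ps : csmooth U (projS L).
Hypothesis PP : forall x, U x -> projS L x *m projS L x = projS L x.
Local Notation N := (calN L).

Definition reflS (x : P) : cend := 2 *: projS L x - 1%:M.

Let dPP i x : U x ->
  cpd i (projS L) x *m projS L x + projS L x *m cpd i (projS L) x =
  cpd i (projS L) x.
Proof.
by move=> Ux; apply: etrans (esym (cpdM Uo i Ps Ps Ux)) _; exact: (eq_cpd Uo).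
Qed.

Lemma csmooth_projT : csmooth U (projT L).
Proof. by apply: (csmoothB Uo) => //; exact: csmooth_cst. Qed.

Lemma csmooth_reflS : csmooth U reflS.
Proof.
by apply: (csmoothB Uo); [apply: (csmooth_scale Uo)|exact: csmooth_cst].
Qed.

Lemma cpd_reflS i x : U x -> cpd i reflS x = 2 *: cpd i (projS L) x.
Proof.
move=> Ux; have s1 := csmooth_cst Uo (1%:M : cend).
apply: etrans (cpdB Uo i (csmooth_scale Uo 2 Ps) s1 Ux) _.
rewrite (cpd_cst i 1%:M) subr0; exact: (cpd_scale Uo).
Qed.

Lemma cpd_projT i x : U x -> cpd i (projT L) x = - cpd i (projS L) x.
Proof.
move=> Ux; have s1 := csmooth_cst Uo (1%:M : cend).
apply: etrans (cpdB Uo i s1 Ps Ux) _.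
by rewrite (cpd_cst i 1%:M) sub0r.
Qed.

Lemma calD_raw b i (F : P -> 'M[C]_(n.+2, b.+1)) x : csmooth U F -> U x ->
  calD L i F x = cpd i F x
    - (cpd i (projS L) x *m reflS x) *m F x.
Proof.
move=> sF Ux; rewrite /calD (cpdM Uo i Ps sF Ux) (cpdM Uo i csmooth_projT sF Ux).
rewrite cpd_projT // /projT /reflS.
exact: proj_connection (PP Ux) (dPP i Ux).
Qed.

Lemma calN_E i x : U x -> N i x = cpd i (projS L) x *m reflS x.
Proof.
move=> Ux; rewrite /calN calD_raw //; last exact: csmooth_cst.
by rewrite (cpd_cst i 1%:M) mulmx1 !sub0r opprK.
Qed.

Lemma csmooth_calN i : csmooth U (N i).
Proof.
have := csmoothM Uo (csmooth_cpd Uo i Ps) csmooth_reflS.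
by apply: (eq_csmooth Uo) => y Uy; rewrite calN_E.
Qed.

Lemma calD_E b i (F : P -> 'M[C]_(n.+2, b.+1)) x : csmooth U F -> U x ->
  calD L i F x = cpd i F x - N i x *m F x.
Proof. by move=> sF Ux; rewrite (calD_raw i sF Ux) (calN_E i Ux). Qed.

Lemma DEnd_E i (F : P -> cend) x : csmooth U F -> U x ->
  DEnd L i F x = cpd i F x - N i x *m F x + F x *m N i x.
Proof.
move=> sF Ux; rewrite /DEnd !calD_E //; last exact: csmooth_cst.
by rewrite (cpd_cst i 1%:M) mulmx1 sub0r mulmxN opprK.
Qed.

Lemma reflSK x : U x -> reflS x *m reflS x = 1%:M.
Proof.
move=> Ux; have [_ _] := idem_deriv_odd (PP Ux) (dPP 0 Ux); exact.
Qed.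

#[local] Opaque calN projS.

Lemma reflS_calN i x : U x -> reflS x *m N i x = - (N i x *m reflS x).
Proof.
move=> Ux; have [_ RQ _] := idem_deriv_odd (PP Ux) (dPP i Ux).
rewrite (calN_E i Ux); exact: odd_mul_refl RQ.
Qed.

Lemma calN_reflS i x : U x -> cpd i reflS x = 2 *: (N i x *m reflS x).
Proof. by move=> Ux; rewrite cpd_reflS // calN_E // -mulmxA reflSK // mulmx1. Qed.

Lemma codazzi x : U x -> dD L N x = 0.
Proof.
move=> Ux; have dN i j : cpd i (N j) x =
    cpd i (cpd j (projS L)) x *m reflS x +
    cpd j (projS L) x *m (2 *: cpd i (projS L) x).
  rewrite -cpd_reflS //.
  apply: etrans _ (cpdM Uo i (csmooth_cpd Uo j Ps) csmooth_reflS Ux).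
  by apply: (eq_cpd Uo) => // y Uy; rewrite calN_E.
have NN i j : N i x *m N j x = - (cpd i (projS L) x *m cpd j (projS L) x).
  have [_ RQ _] := idem_deriv_odd (PP Ux) (dPP j Ux).
  rewrite (calN_E i Ux) (calN_E j Ux).
  exact: (mulmx_odd2 _ RQ (reflSK Ux)).
rewrite /dD (DEnd_E 0 (csmooth_calN 1) Ux) (DEnd_E 1 (csmooth_calN 0) Ux).
exact: codazzi_alg (dN 0 1) (dN 1 0) (cpd_comm Uo 1 0 Ps Ux) (NN 0 1) (NN 1 0).
Qed.

Lemma DEnd_parity i (W : P -> cend) (e : C) x : csmooth U W ->
  (forall y, U y -> reflS y *m W y *m reflS y = e *: W y) -> U x ->
  reflS x *m DEnd L i W x *m reflS x = e *: DEnd L i W x.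
Proof.
move=> sW RW Ux; rewrite DEnd_E //.
have sR := csmooth_reflS.
apply: (odd_deriv_brac (reflSK Ux) (calN_reflS i Ux) (reflS_calN i Ux) (RW x Ux)).
have -> : e *: cpd i W x = cpd i (fun y => reflS y *m W y *m reflS y) x.
  apply: etrans (esym (cpd_scale Uo i e sW Ux)) _.
  by apply: (eq_cpd Uo) => // y Uy; rewrite RW.
by rewrite (cpdM Uo i (csmoothM Uo sR sW) sR Ux) (cpdM Uo i sR sW Ux) mulmxDl.
Qed.

End OneSurface.

(** * Gauge transformations *)

Section GaugeAlgebra.
Variables (K : numFieldType) (m : nat).
Local Notation M := 'M[K]_m.

(* the value at (d_0, d_1) of [A /\ B] *)
Definition bw (A0 A1 B0 B1 : M) : M :=
  (A0 *m B1 - B1 *m A0) - (A1 *m B0 - B0 *m A1).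

(** The fourth hypothesis equates the mixed second derivatives of Phi; cancelling Phi on the left
    leaves the zero curvature equation of A. *)
Lemma flat_alg (A0 A1 A01 A10 Phi Psi Phi0 Phi1 : M) :
  Psi *m Phi = 1%:M -> Phi0 = Phi *m A0 -> Phi1 = Phi *m A1 ->
  Phi0 *m A1 + Phi *m A01 = Phi1 *m A0 + Phi *m A10 ->
  A01 - A10 + (A0 *m A1 - A1 *m A0) = 0.
Proof.
move=> PP -> -> H; rewrite -[LHS]mul1mx -PP -mulmxA.
suff -> : Phi *m (A01 - A10 + (A0 *m A1 - A1 *m A0)) =
  (Phi *m A0 *m A1 + Phi *m A01) - (Phi *m A1 *m A0 + Phi *m A10).
  by rewrite H subrr mulmx0.
by mx_ring.
Qed.

(** Modulo the Codazzi equation and the two bracket relations, the curvature of - N + M + D is the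
    sum of d^D M + [M /\ D] and of d^D D; for M odd and D even these have opposite parities. *)
Lemma curvature_split (A01 A10 N0 N1 N01 N10 M0 M1 M01 M10 D0 D1 D01 D10 : M) :
  A01 = - N01 + M01 + D01 -> A10 = - N10 + M10 + D10 ->
  A01 - A10 + ((- N0 + M0 + D0) *m (- N1 + M1 + D1)
               - (- N1 + M1 + D1) *m (- N0 + M0 + D0)) = 0 ->
  (N01 - N0 *m N1 + N1 *m N0) - (N10 - N1 *m N0 + N0 *m N1) = 0 ->
  bw M0 M1 M0 M1 = bw N0 N1 N0 N1 -> D0 *m D1 = D1 *m D0 ->
  (((M01 - N0 *m M1 + M1 *m N0) - (M10 - N1 *m M0 + M0 *m N1))
   + bw M0 M1 D0 D1)
  + ((D01 - N0 *m D1 + D1 *m N0) - (D10 - N1 *m D0 + D0 *m N1)) = 0.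
Proof.
move=> -> -> F Cz MM DD.
have MM0 : bw M0 M1 M0 M1 - bw N0 N1 N0 N1 = 0 by rewrite MM subrr.
have DD0 : D0 *m D1 - D1 *m D0 = 0 by rewrite DD subrr.
(* [bw M0 M1 M0 M1] is twice a commutator, whence the factor one half. *)
transitivity ((- N01 + M01 + D01 - (- N10 + M10 + D10)
   + ((- N0 + M0 + D0) *m (- N1 + M1 + D1)
               - (- N1 + M1 + D1) *m (- N0 + M0 + D0)))
   + ((N01 - N0 *m N1 + N1 *m N0) - (N10 - N1 *m N0 + N0 *m N1))
   - (2^-1 *: (bw M0 M1 M0 M1 - bw N0 N1 N0 N1) + (D0 *m D1 - D1 *m D0))).
  rewrite /bw; do 6? mx_expand; apply/matrixP => ? ?.
  by rewrite ?(addmxE, oppmxE, scalemxE, zeromxE); field.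
by rewrite F Cz MM0 DD0 scaler0 !addr0 subr0.
Qed.

Lemma parity_split (Rf X Y : M) :
  Rf *m X *m Rf = - X -> Rf *m Y *m Rf = Y -> X + Y = 0 -> Y = 0.
Proof.
move=> oX eY XY; have : Rf *m (X + Y) *m Rf = 0 by rewrite XY mulmx0 mul0mx.
rewrite mulmxDr mulmxDl oX eY => YX.
have : 2 *: Y = 0.
  transitivity ((X + Y) + (- X + Y)); first by mx_ring.
  by rewrite XY YX addr0.
by move/eqP; rewrite scaler_eq0 pnatr_eq0 /= => /eqP.
Qed.

(** The first factor is the derivative of the gauged projection, the second its reflection, so the
    product is N of the new surface. In the commutator with Pr the even D drops out and - N cancels
    Q; only the odd Mu survives. *)
Lemma gauge_proj_deriv (Phi Psi Pr Q N Mu D Rf : M) :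
  Psi *m Phi = 1%:M -> Rf = 2 *: Pr - 1%:M -> Rf *m Rf = 1%:M ->
  N = Q *m Rf -> Rf *m N = - (N *m Rf) -> Rf *m Mu *m Rf = - Mu ->
  Rf *m D *m Rf = D ->
  (Phi *m (Q + (- N + Mu + D) *m Pr - Pr *m (- N + Mu + D)) *m Psi) *m
  (2 *: (Phi *m Pr *m Psi) - Phi *m Psi) = Phi *m Mu *m Psi.
Proof.
move=> PP RE RR NE RN RM RD.
have PrE : Pr = 2^-1 *: (Rf + 1%:M).
  by rewrite RE; apply/matrixP => ? ?; rewrite ?(addmxE, oppmxE, scalemxE); field.
have QE : Q = N *m Rf by rewrite NE -mulmxA RR mulmx1.
have MR : Rf *m Mu = - (Mu *m Rf).
  by rewrite -mulNmx -RM -(mulmxA (Rf *m Mu)) RR mulmx1.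
have DR : Rf *m D = D *m Rf by rewrite -[in RHS]RD -(mulmxA (Rf *m D)) RR mulmx1.
have -> : 2 *: (Phi *m Pr *m Psi) - Phi *m Psi = Phi *m Rf *m Psi.
  by rewrite RE; mx_ring.
rewrite -!mulmxA (mulmxA Psi Phi) PP mul1mx; congr (_ *m _); rewrite !mulmxA.
congr (_ *m _).
have -> : Q + (- N + Mu + D) *m Pr - Pr *m (- N + Mu + D) =
   Q + 2^-1 *: ((- N + Mu + D) *m Rf - (- (Rf *m N) + Rf *m Mu + Rf *m D)).
  by rewrite PrE; mx_ring.
rewrite RN MR DR QE.
have -> : N *m Rf + 2^-1 *: ((- N + Mu + D) *m Rf -
   (- (- (N *m Rf)) - Mu *m Rf + D *m Rf)) = Mu *m Rf.
  do 6? mx_expand; apply/matrixP => ? ?.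
  by rewrite ?(addmxE, oppmxE, scalemxE, zeromxE); field.
by rewrite -mulmxA RR mulmx1.
Qed.

(** The gauged Mu is N of the new surface, so subtracting its bracket leaves the bracket with - N,
    which rebuilds D, and the bracket with D. *)
Lemma gauge_DEnd (Phi Psi W W' N Mu D : M) : Psi *m Phi = 1%:M ->
  Phi *m (W' + (- N + Mu + D) *m W - W *m (- N + Mu + D)) *m Psi
  - (Phi *m Mu *m Psi) *m (Phi *m W *m Psi)
  + (Phi *m W *m Psi) *m (Phi *m Mu *m Psi) =
  Phi *m ((W' - N *m W + W *m N) + (D *m W - W *m D)) *m Psi.
Proof.
move=> PP.
have E A B : (Phi *m A *m Psi) *m (Phi *m B *m Psi) = Phi *m (A *m B) *m Psi.
  by rewrite -!mulmxA (mulmxA Psi Phi) PP mul1mx.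
by rewrite !E; mx_ring.
Qed.

Lemma gauge_bw (Phi Psi A0 A1 B0 B1 : M) : Psi *m Phi = 1%:M ->
  bw (Phi *m A0 *m Psi) (Phi *m A1 *m Psi) (Phi *m B0 *m Psi) (Phi *m B1 *m Psi)
  = Phi *m bw A0 A1 B0 B1 *m Psi.
Proof.
move=> PP.
have E A B : (Phi *m A *m Psi) *m (Phi *m B *m Psi) = Phi *m (A *m B) *m Psi.
  by rewrite -!mulmxA (mulmxA Psi Phi) PP mul1mx.
by rewrite /bw !E; mx_ring.
Qed.

Section Star.
Variables (j00 j01 j10 : K).
Hypothesis jdet : - j00 ^+ 2 - j01 * j10 = 1.
(* the components of the Hodge dual of A for a traceless complex structure *)
Definition star0 (A0 A1 : M) := - (j00 *: A0 + j10 *: A1).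
Definition star1 (A0 A1 : M) := - (j01 *: A0 - j00 *: A1).

(** A traceless 2 by 2 matrix of determinant 1 squares to -1. *)
Lemma star0K A0 A1 : star0 (star0 A0 A1) (star1 A0 A1) = - A0.
Proof.
apply/matrixP => k l; rewrite /star0 /star1 ?(addmxE, oppmxE, scalemxE).
by rewrite -[A0 k l in RHS]mul1r -jdet; ring.
Qed.

Lemma star1K A0 A1 : star1 (star0 A0 A1) (star1 A0 A1) = - A1.
Proof.
apply/matrixP => k l; rewrite /star0 /star1 ?(addmxE, oppmxE, scalemxE).
by rewrite -[A1 k l in RHS]mul1r -jdet; ring.
Qed.

(** [bw] is alternating in the form index, and a traceless matrix is skew for an alternating pairing
    in dimension 2. *)
Lemma bw_starl A0 A1 B0 B1 :
  bw (star0 A0 A1) (star1 A0 A1) B0 B1 = - bw A0 A1 (star0 B0 B1) (star1 B0 B1).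
Proof. by rewrite /bw /star0 /star1; mx_ring. Qed.

Lemma bw_starlr A0 A1 B0 B1 :
  bw (star0 A0 A1) (star1 A0 A1) (star0 B0 B1) (star1 B0 B1) = bw A0 A1 B0 B1.
Proof.
rewrite bw_starl star0K star1K /bw.
by mx_ring.
Qed.

End Star.

End GaugeAlgebra.

(** * The Willmore equation as an identity between angles *)

Section WillmoreAlgebra.
Variables (K : numFieldType) (m : nat).
Local Notation M := 'M[K]_m.

(** Let a, b be cosine and sine of an angle, so c, s belong to the double angle; r and S are the
    duals of q and N. With X = [q /\ S] and Z = [q /\ N] every bracket is a combination of X and Z.
    The difference formulas give [q_mu /\ S_mu] = a X + b Z for the dual S_mu of N_mu. On the left Y
    contributes 2 a X, and the bracket with q_mu - q exactly the remaining 2 b Z. *)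
Lemma willmore_alg (a b : K) (q0 q1 r0 r1 N0 N1 S0 S1 Y : M) :
  a ^+ 2 + b ^+ 2 = 1 ->
  bw r0 r1 S0 S1 = bw q0 q1 N0 N1 -> bw r0 r1 N0 N1 = - bw q0 q1 S0 S1 ->
  Y = 2 *: bw q0 q1 S0 S1 ->
  let c := a ^+ 2 - b ^+ 2 in let s := 2 * (a * b) in
  a *: Y + bw ((c - 1) *: q0 + s *: r0) ((c - 1) *: q1 + s *: r1)
             (a *: S0 - b *: N0) (a *: S1 - b *: N1) =
  2 *: bw (c *: q0 + s *: r0) (c *: q1 + s *: r1)
             (a *: S0 - b *: N0) (a *: S1 - b *: N1).
Proof.
move=> ab rS rN -> c s.
have bwE (u v u' v' : K) : bw (u *: q0 + v *: r0) (u *: q1 + v *: r1)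
   (u' *: S0 - v' *: N0) (u' *: S1 - v' *: N1) =
   (u * u' + v * v') *: bw q0 q1 S0 S1 + (v * u' - u * v') *: bw q0 q1 N0 N1.
  transitivity (u * u' *: bw q0 q1 S0 S1 - u * v' *: bw q0 q1 N0 N1 +
    v * u' *: bw r0 r1 S0 S1 - v * v' *: bw r0 r1 N0 N1).
    by rewrite /bw; mx_ring.
  by rewrite rS rN; mx_ring.
rewrite !bwE {bwE}; move: (bw q0 q1 S0 S1) (bw q0 q1 N0 N1) => X Z.
have b2 : b ^+ 2 = 1 - a ^+ 2 by rewrite -ab; ring.
have cE : c = 2 * a ^+ 2 - 1 by rewrite /c b2; ring.
apply/matrixP => k l; rewrite ?(addmxE, oppmxE, scalemxE, zeromxE).
have E1 : c * a + s * b = a.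
  transitivity (2 * a * (a ^+ 2 + b ^+ 2) - a); last by rewrite ab; ring.
  by rewrite cE /s; ring.
have E2 : s * a - c * b = b by rewrite cE /s; ring.
transitivity ((2 * a + (c * a + s * b) - a) * X k l
  + ((s * a - c * b) + b) * Z k l); first by ring.
transitivity (2 * ((c * a + s * b) * X k l + (s * a - c * b) * Z k l)); last by ring.
by rewrite E1 E2; ring.
Qed.

End WillmoreAlgebra.

Lemma ord2 (j : 'I_2) : j = 0 \/ j = 1.
Proof. by case: j => [[|[|//]] hj]; [left|right]; exact/val_inj. Qed.

Section FormAlgebra.
Variables (K : numFieldType) (m : nat).
Local Notation M := 'M[K]_m.

Lemma gauge_deriv (Phi Psi Phi' Psi' A W W' : M) :
  Phi' = Phi *m A -> Psi' = - (A *m Psi) ->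
  (Phi' *m W + Phi *m W') *m Psi + Phi *m W *m Psi' =
  Phi *m (W' + A *m W - W *m A) *m Psi.
Proof. by move=> -> ->; mx_ring. Qed.

Lemma inv_deriv (Phi Psi Phi' Psi' A : M) :
  Psi *m Phi = 1%:M -> Phi *m Psi = 1%:M -> Phi' = Phi *m A ->
  Psi' *m Phi + Psi *m Phi' = 0 -> Psi' = - (A *m Psi).
Proof.
move=> PP PP' -> H.
have : (Psi' *m Phi + Psi *m (Phi *m A)) *m Psi = 0 by rewrite H mul0mx.
rewrite mulmxDl -!mulmxA PP' mulmx1 (mulmxA Psi Phi) PP mul1mx.
by move/eqP; rewrite addr_eq0 => /eqP.
Qed.

Lemma dD_lin (k l : K) (N0 N1 A0 A1 A01 A10 B0 B1 B01 B10 : M) :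
  ((k *: A01 + l *: B01) - N0 *m (k *: A1 + l *: B1) + (k *: A1 + l *: B1) *m N0)
  - ((k *: A10 + l *: B10) - N1 *m (k *: A0 + l *: B0) + (k *: A0 + l *: B0) *m N1)
  = k *: ((A01 - N0 *m A1 + A1 *m N0) - (A10 - N1 *m A0 + A0 *m N1))
  + l *: ((B01 - N0 *m B1 + B1 *m N0) - (B10 - N1 *m B0 + B0 *m N1)).
Proof. by mx_ring. Qed.

Lemma gauge_bw_add (Phi Psi X0 X1 D0 D1 W0 W1 : M) :
  Phi *m (X0 + (D0 *m W1 - W1 *m D0)) *m Psi
  - Phi *m (X1 + (D1 *m W0 - W0 *m D1)) *m Psi
  = Phi *m ((X0 - X1) + bw D0 D1 W0 W1) *m Psi.
Proof. by rewrite /bw; mx_ring. Qed.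

Lemma comb_mul (k l k' l' : K) (A B : M) :
  k' *: (k *: A + l *: B) + l' *: (k *: B - l *: A) =
  (k' * k - l' * l) *: A + (k' * l + l' * k) *: B.
Proof. by mx_ring. Qed.

Lemma comm_comb (q0 q1 : M) (u0 u1 v0 v1 w0 w1 z0 z1 : K) :
  q0 *m q1 = q1 *m q0 ->
  bw (u0 *: q0 + u1 *: q1) (v0 *: q0 + v1 *: q1)
     (w0 *: q0 + w1 *: q1) (z0 *: q0 + z1 *: q1) = 0.
Proof. by rewrite /bw => h; do 6? mx_expand; rewrite h; mx_ring. Qed.

Lemma comb_expand0 (u v g h : K) (A B : M) :
  u *: A + v *: - (g *: A + h *: B) = (u - v * g) *: A + - (v * h) *: B.
Proof. by mx_ring. Qed.

Lemma comb_expand1 (u v g h : K) (A B : M) :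
  u *: B + v *: - (g *: A + h *: B) = - (v * g) *: A + (u - v * h) *: B.
Proof. by mx_ring. Qed.

Lemma bw_self_comm (A B : M) : bw A B A B = 0 -> A *m B = B *m A.
Proof.
rewrite /bw => H; apply: (@sub_eq0 _ _ _ _ (2^-1 *: 0)); last exact: scaler0.
rewrite -H; apply/matrixP => ? ?.
by rewrite ?(addmxE, oppmxE, scalemxE); field.
Qed.

(** Rotating N towards its dual keeps [N /\ N]: the mixed brackets cancel and the squares have total
    weight 1. *)
Lemma bw_rot (a b : K) (N0 N1 S0 S1 : M) : a ^+ 2 + b ^+ 2 = 1 ->
  bw S0 S1 N0 N1 = - bw N0 N1 S0 S1 -> bw S0 S1 S0 S1 = bw N0 N1 N0 N1 ->
  bw (a *: N0 + b *: S0) (a *: N1 + b *: S1) (a *: N0 + b *: S0) (a *: N1 + b *: S1)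
  = bw N0 N1 N0 N1.
Proof.
move=> ab SN SS.
transitivity (a ^+ 2 *: bw N0 N1 N0 N1 + b ^+ 2 *: bw S0 S1 S0 S1
  + (a * b) *: (bw S0 S1 N0 N1 + bw N0 N1 S0 S1)); first by rewrite /bw; mx_ring.
by rewrite SN SS addNr scaler0 addr0 -scalerDl ab scale1r.
Qed.

Lemma odd_add (Rf A B : M) : Rf *m A *m Rf = - A -> Rf *m B *m Rf = - B ->
  Rf *m (A + B) *m Rf = - (A + B).
Proof. by move=> hA hB; rewrite mulmxDr mulmxDl hA hB opprD. Qed.

Lemma odd_sub (e : K) (Rf A B : M) : Rf *m A *m Rf = e *: A ->
  Rf *m B *m Rf = e *: B -> Rf *m (A - B) *m Rf = e *: (A - B).
Proof. by move=> hA hB; rewrite mulmxBr mulmxBl hA hB scalerBr. Qed.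

Lemma comb_sub1 (c s : K) (A B : M) :
  c *: A + s *: B = 1 *: ((c - 1) *: A + s *: B) + 1 *: A.
Proof. by mx_ring. Qed.

Lemma comb_add1 (c s g h : K) (A B : M) :
  ((c - 1) *: A + s *: B) + (g *: A + h *: B) =
  (g + c - 1) *: A + (h + s) *: B.
Proof. by mx_ring. Qed.

Lemma conj_mul (Rf A B : M) : Rf *m Rf = 1%:M ->
  Rf *m (A *m B) *m Rf = (Rf *m A *m Rf) *m (Rf *m B *m Rf).
Proof. by move=> RR; rewrite -!mulmxA (mulmxA Rf Rf) RR mul1mx. Qed.

Lemma odd_even_bw (Rf A0 A1 B0 B1 : M) : Rf *m Rf = 1%:M ->
  Rf *m A0 *m Rf = - A0 -> Rf *m A1 *m Rf = - A1 ->
  Rf *m B0 *m Rf = B0 -> Rf *m B1 *m Rf = B1 ->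
  Rf *m bw A0 A1 B0 B1 *m Rf = - bw A0 A1 B0 B1.
Proof.
move=> RR h0 h1 k0 k1; rewrite /bw !(mulmxBr, mulmxBl) !(conj_mul _ _ RR).
by rewrite h0 h1 k0 k1; mx_ring.
Qed.

Lemma gauge_calD b (Phi Psi N Mu D : M) (v v' : 'M[K]_(m, b)) :
  Psi *m Phi = 1%:M ->
  (Phi *m (- N + Mu + D)) *m v + Phi *m v' - (Phi *m Mu *m Psi) *m (Phi *m v) =
  Phi *m (v' - N *m v + D *m v).
Proof.
move=> PP; rewrite -[Phi *m Mu *m Psi *m _]mulmxA (mulmxA Psi Phi) PP mul1mx.
by mx_ring.
Qed.

Lemma gauge_apply b (Phi Psi D X Y Z : M) (v w : 'M[K]_(m, b)) :
  Psi *m Phi = 1%:M -> D + Y = Z ->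
  Phi *m (w + D *m v) + (Phi *m X *m Psi + Phi *m Y *m Psi) *m (Phi *m v) =
  Phi *m (w + (X + Z) *m v).
Proof.
move=> PP <-; rewrite mulmxDl -!mulmxA !(mulmxA Psi Phi) PP !mul1mx.
by mx_ring.
Qed.

End FormAlgebra.

(** * Type components and the Hodge dual *)

Section Hodge.
Variables (R : realType) (n : nat) (L : 'rV[R]_2 -> {vspace 'cV[R]_n.+2}).
Local Notation C := R[i].
Local Notation P := 'rV[R]_2.
Local Notation cend := 'M[C]_n.+2.
Local Notation cf := (mform R n.+1 n.+1).

Lemma hodgeE a b (w : mform R a b) j x : hodge L w j x =
  - ((cstruct L x 0 j)%:C *: w 0 x + (cstruct L x 1 j)%:C *: w 1 x).
Proof.
rewrite /hodge /compJ !big_ord_recl big_ord0 addr0.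
by have -> : lift ord0 ord0 = 1 :> 'I_2 by exact/val_inj.
Qed.

(** Every combination of the two type components has this form. Since the dual squares to -1, these
    operators compose like the complex numbers c + i s, and real coefficients preserve real
    forms. *)
Definition comb (c s : C) (w : cf) : cf :=
  fun j x => c *: w j x + s *: hodge L w j x.

Lemma type10E (w : cf) j x : type10 L w j x = 2^-1 *: (w j x + 'i%C *: hodge L w j x).
Proof. by rewrite /type10 /hodge scalerN. Qed.

Lemma type01E (w : cf) j x : type01 L w j x = 2^-1 *: (w j x - 'i%C *: hodge L w j x).
Proof. by rewrite /type01 /hodge scalerN opprK. Qed.

Lemma types_comb (u v : C) (w : cf) j x :
  u *: type10 L w j x + v *: type01 L w j x =
  comb ((u + v) / 2) ('i%C * (u - v) / 2) w j x.
Proof.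
rewrite type10E type01E /comb; move: (w j x) (hodge L w j x) => A B.
rewrite !scalerA !scalerDr !scalerN !scalerA addrACA -scalerDl -scalerBl.
by congr (_ *: _ + _ *: _); ring.
Qed.

End Hodge.

#[local] Opaque hodge.

(** * Structure equations transported by a gauge transformation *)

Section Gauge.
Variables (R : realType) (n : nat) (U : set 'rV[R]_2).
Local Notation C := R[i].
Local Notation P := 'rV[R]_2.
Local Notation cend := 'M[C]_n.+2.
Local Notation cf := (mform R n.+1 n.+1).
Variables (L L' : P -> {vspace 'cV[R]_n.+2}) (q : cf) (Phi Psi : P -> cend).
Variables (a b : C).
Hypothesis ab : a ^+ 2 + b ^+ 2 = 1.
Let c := a ^+ 2 - b ^+ 2.
Let s := 2 * (a * b).
Hypothesis Uo : open U.
Hypothesis Ps : csmooth U (projS L).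
Hypothesis PP : forall x, U x -> projS L x *m projS L x = projS L x.
Hypothesis Js : forall i j, smooth U (fun y => cstruct L y i j).
Hypothesis Jtr : forall x, U x -> cstruct L x 1 1 = - cstruct L x 0 0.
Hypothesis Jdet : forall x, U x ->
  - cstruct L x 0 0 ^+ 2 - cstruct L x 0 1 * cstruct L x 1 0 = 1.
Hypothesis Phis : csmooth U Phi.
Hypothesis Psis : csmooth U Psi.
Hypothesis PsiPhi : forall x, U x -> Psi x *m Phi x = 1%:M.
Hypothesis PhiPsi : forall x, U x -> Phi x *m Psi x = 1%:M.
Hypothesis qs : forall i, csmooth U (q i).
Hypothesis qeven : forall i x, U x ->
  reflS L x *m q i x *m reflS L x = q i x.
Hypothesis qcomm : forall x, U x -> q 0 x *m q 1 x = q 1 x *m q 0 x.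
Hypothesis dDq : forall x, U x -> dD L q x = 0.
Hypothesis cwq : forall x, U x ->
  dD L (hodge L (calN L)) x = 2 *: brac_wedge q (hodge L (calN L)) x.
Hypothesis PS' : forall x, U x -> projS L' x = Phi x *m projS L x *m Psi x.
Hypothesis JJ' : forall x, U x -> cstruct L' x = cstruct L x.

Let N := calN L.
(** In the notation of the overview [Mu] is N_mu, [Dl] is q_mu - q, [Q] is q_mu and [A] is phi^-1
    dphi. *)
Let Mu : cf := comb L a b N.
Let Dl : cf := comb L (c - 1) s q.
Let Q : cf := comb L c s q.
Let A : cf := fun i x => - N i x + Mu i x + Dl i x.
Hypothesis dPhi : forall i x, U x -> cpd i Phi x = Phi x *m A i x.

Let Ns i : csmooth U (N i). Proof. exact: csmooth_calN. Qed.

Lemma csmooth_hodge (w : cf) j : (forall i, csmooth U (w i)) ->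
  csmooth U (hodge L w j).
Proof.
move=> ws; have := csmoothN Uo (csmoothD Uo
  (csmoothZ Uo (cfun_smooth_real Uo (Js 0 j)) (ws 0))
  (csmoothZ Uo (cfun_smooth_real Uo (Js 1 j)) (ws 1))).
by apply: (eq_csmooth Uo) => y Uy; rewrite hodgeE.
Qed.

Lemma csmooth_comb (k l : C) (w : cf) j : (forall i, csmooth U (w i)) ->
  csmooth U (comb L k l w j).
Proof.
move=> ws; apply: (csmoothD Uo); apply: (csmooth_scale Uo) => //.
exact: csmooth_hodge.
Qed.

Lemma hodge_scale (k l : C) (w w' : cf) j x :
  hodge L (fun i y => k *: w i y + l *: w' i y) j x =
  k *: hodge L w j x + l *: hodge L w' j x.
Proof.
rewrite !hodgeE; move: (w 0 x) (w 1 x) (w' 0 x) (w' 1 x) => A0 A1 B0 B1.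
rewrite !scalerN -opprD; congr (- _); rewrite !scalerDr !scalerA addrACA.
by rewrite ![_ * k]mulrC ![_ * l]mulrC.
Qed.

Lemma hodge_conj (w : cf) (Rf T : cend) (k : C) j x :
  (forall i, Rf *m w i x *m T = k *: w i x) ->
  Rf *m hodge L w j x *m T = k *: hodge L w j x.
Proof.
move=> H; rewrite !hodgeE mulmxN mulNmx mulmxDr mulmxDl scalerN.
by rewrite -!scalemxAr -!scalemxAl !H scalerDr !scalerA ![_ * k]mulrC.
Qed.

Lemma comb_conj (w : cf) (Rf T : cend) (k u v : C) j x :
  (forall i, Rf *m w i x *m T = k *: w i x) ->
  Rf *m comb L u v w j x *m T = k *: comb L u v w j x.
Proof.
move=> H; rewrite /comb mulmxDr mulmxDl -!scalemxAr -!scalemxAl H.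
by rewrite (hodge_conj _ H) scalerDr !scalerA ![_ * k]mulrC.
Qed.

Lemma hodge_gauge (w w' : cf) j x : U x ->
  (forall i, w' i x = Phi x *m w i x *m Psi x) ->
  hodge L' w' j x = Phi x *m hodge L w j x *m Psi x.
Proof.
move=> Ux H; rewrite !hodgeE !H JJ' // mulmxN mulNmx mulmxDr mulmxDl.
by rewrite -!scalemxAr -!scalemxAl.
Qed.

Lemma comb_gauge (w w' : cf) u v j x : U x ->
  (forall i, w' i x = Phi x *m w i x *m Psi x) ->
  comb L' u v w' j x = Phi x *m comb L u v w j x *m Psi x.
Proof.
move=> Ux H; rewrite /comb H (hodge_gauge _ Ux H) mulmxDr mulmxDl.
by rewrite -!scalemxAr -!scalemxAl.
Qed.

Let JdetC x : U x -> - (cstruct L x 0 0)%:C ^+ 2 -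
  (cstruct L x 0 1)%:C * (cstruct L x 1 0)%:C = 1.
Proof.
by move=> Ux; rewrite -rmorphXn -rmorphM -rmorphN -rmorphB /= Jdet.
Qed.

Let hodge0 (w : cf) x : U x -> hodge L w 0 x =
  star0 (cstruct L x 0 0)%:C (cstruct L x 1 0)%:C (w 0 x) (w 1 x).
Proof. by move=> Ux; rewrite hodgeE. Qed.

Let hodge1 (w : cf) x : U x -> hodge L w 1 x =
  star1 (cstruct L x 0 0)%:C (cstruct L x 0 1)%:C (w 0 x) (w 1 x).
Proof. by move=> Ux; rewrite hodgeE Jtr // rmorphN scaleNr. Qed.

Lemma hodgeK (w : cf) j x : U x -> hodge L (hodge L w) j x = - w j x.
Proof.
move=> Ux; case: (ord2 j) => {j} ->.
  rewrite hodge0 // (hodge0 w Ux) (hodge1 w Ux); exact: star0K (JdetC Ux) _ _.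
rewrite hodge1 // (hodge0 w Ux) (hodge1 w Ux); exact: star1K (JdetC Ux) _ _.
Qed.

Lemma hodge_comb (k l : C) (w : cf) j x : U x ->
  hodge L (comb L k l w) j x = k *: hodge L w j x - l *: w j x.
Proof.
move=> Ux; apply: etrans (hodge_scale k l w (hodge L w) j x) _.
by rewrite hodgeK // (scalerN l (w j x)).
Qed.

Lemma comb_comb (k l k' l' : C) (w : cf) j x : U x ->
  comb L k' l' (comb L k l w) j x =
  comb L (k' * k - l' * l) (k' * l + l' * k) w j x.
Proof.
move=> Ux; apply: etrans _ (comb_mul k l k' l' (w j x) (hodge L w j x)).
by rewrite -(hodge_comb k l w j Ux).
Qed.

Lemma brac_hodge (w w' : cf) x : U x ->
  brac_wedge (hodge L w) (hodge L w') x = brac_wedge w w' x.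
Proof.
move=> Ux; rewrite /brac_wedge (hodge0 w Ux) (hodge1 w Ux) (hodge0 w' Ux)
  (hodge1 w' Ux); exact: bw_starlr (JdetC Ux) _ _ _ _.
Qed.

Lemma brac_hodgel (w w' : cf) x : U x ->
  brac_wedge (hodge L w) w' x = - brac_wedge w (hodge L w') x.
Proof.
move=> Ux; rewrite /brac_wedge (hodge0 w Ux) (hodge1 w Ux) (hodge0 w' Ux)
  (hodge1 w' Ux); exact: bw_starl.
Qed.

Let dDE (w : cf) x : (forall i, csmooth U (w i)) -> U x -> dD L w x =
  (cpd 0 (w 1) x - N 0 x *m w 1 x + w 1 x *m N 0 x) -
  (cpd 1 (w 0) x - N 1 x *m w 0 x + w 0 x *m N 1 x).
Proof.
move=> ws Ux.
by rewrite /dD (DEnd_E Uo Ps PP 0 (ws 1) Ux) (DEnd_E Uo Ps PP 1 (ws 0) Ux).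
Qed.

Lemma dD_linear (k l : C) (w w' v : cf) x :
  (forall i, csmooth U (w i)) -> (forall i, csmooth U (w' i)) ->
  (forall i y, U y -> v i y = k *: w i y + l *: w' i y) -> U x ->
  dD L v x = k *: dD L w x + l *: dD L w' x.
Proof.
move=> ws ws' vE Ux.
have sk i := csmooth_scale Uo k (ws i).
have sl i := csmooth_scale Uo l (ws' i).
have vs i : csmooth U (v i).
  by apply: (eq_csmooth Uo _ (csmoothD Uo (sk i) (sl i))) => y Uy; rewrite vE.
have cE i j : cpd i (v j) x = k *: cpd i (w j) x + l *: cpd i (w' j) x.
  transitivity (cpd i (fun y => k *: w j y + l *: w' j y) x).
    by apply: (eq_cpd Uo) => // y Uy; exact: vE.
  apply: etrans (cpdD Uo i (sk j) (sl j) Ux) _; congr (_ + _).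
    exact: (cpd_scale Uo).
  exact: (cpd_scale Uo).
rewrite (dDE vs Ux) (dDE ws Ux) (dDE ws' Ux) !cE !vE //.
exact: dD_lin.
Qed.

Let Mus i : csmooth U (Mu i). Proof. exact: csmooth_comb. Qed.
Let Dls i : csmooth U (Dl i). Proof. exact: csmooth_comb. Qed.
Let Qs i : csmooth U (Q i). Proof. exact: csmooth_comb. Qed.

Let NE i x : U x -> N i x = cpd i (projS L) x *m reflS L x.
Proof. exact: (calN_E Uo Ps PP). Qed.

Let As i : csmooth U (A i).
Proof. by apply: (csmoothD Uo) => //; apply: (csmoothD Uo) => //; exact: (csmoothN Uo). Qed.

Let cpdA i j x : U x ->
  cpd i (A j) x = - cpd i (N j) x + cpd i (Mu j) x + cpd i (Dl j) x.
Proof.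
move=> Ux; have sN := csmoothN Uo (Ns j).
apply: etrans (cpdD Uo i (csmoothD Uo sN (Mus j)) (Dls j) Ux) _.
congr (_ + _); apply: etrans (cpdD Uo i sN (Mus j) Ux) _.
by congr (_ + _); exact: (cpdN Uo).
Qed.

Lemma gauge_flat x : U x ->
  cpd 0 (A 1) x - cpd 1 (A 0) x + (A 0 x *m A 1 x - A 1 x *m A 0 x) = 0.
Proof.
move=> Ux; apply: (flat_alg (PsiPhi Ux) (dPhi 0 Ux) (dPhi 1 Ux)).
have E i j : cpd i (cpd j Phi) x = cpd i Phi x *m A j x + Phi x *m cpd i (A j) x.
  apply: etrans _ (cpdM Uo i Phis (As j) Ux).
  by apply: (eq_cpd Uo) => // y Uy; exact: dPhi.
by apply: etrans (esym (E 0 1)) _; apply: etrans _ (E 1 0); exact: (cpd_comm Uo).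
Qed.

Let N_odd i x : U x -> reflS L x *m N i x *m reflS L x = (-1) *: N i x.
Proof.
move=> Ux; rewrite scaleN1r (reflS_calN Uo Ps PP i Ux) mulNmx -mulmxA.
by rewrite (reflSK Uo Ps PP Ux) mulmx1.
Qed.

Let Mu_odd i x : U x -> reflS L x *m Mu i x *m reflS L x = (-1) *: Mu i x.
Proof. by move=> Ux; apply: comb_conj => j; exact: N_odd. Qed.

Let Dl_even i x : U x -> reflS L x *m Dl i x *m reflS L x = 1 *: Dl i x.
Proof. by move=> Ux; apply: comb_conj => j; rewrite scale1r qeven. Qed.

(** The dual mixes q_0 and q_1 by scalars only, so all these forms take values in the span of two
    commuting endomorphisms. *)
Let comb_comm (k l k' l' : C) x : U x ->
  bw (comb L k l q 0 x) (comb L k l q 1 x) (comb L k' l' q 0 x) (comb L k' l' q 1 x) = 0.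
Proof.
move=> Ux; rewrite /comb !hodgeE.
have E j u v i : exists u' v' : C, u *: q j x + v *: - ((cstruct L x 0 i)%:C *: q 0 x + (cstruct L x 1 i)%:C *: q 1 x) = u' *: q 0 x + v' *: q 1 x.
  case: (ord2 j) => {j} ->.
    exists (u - v * (cstruct L x 0 i)%:C), (- (v * (cstruct L x 1 i)%:C)).
    exact: comb_expand0.
  exists (- (v * (cstruct L x 0 i)%:C)), (u - v * (cstruct L x 1 i)%:C).
  exact: comb_expand1.
have [? [? ->]] := E 0 k l 0; have [? [? ->]] := E 1 k l 1.
have [? [? ->]] := E 0 k' l' 0; have [? [? ->]] := E 1 k' l' 1.
exact: comm_comb (qcomm Ux).
Qed.

Let Dl_comm x : U x -> Dl 0 x *m Dl 1 x = Dl 1 x *m Dl 0 x.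
Proof.
move=> Ux; apply: bw_self_comm; exact: comb_comm.
Qed.

Let bwMu x : U x -> bw (Mu 0 x) (Mu 1 x) (Mu 0 x) (Mu 1 x) =
  bw (N 0 x) (N 1 x) (N 0 x) (N 1 x).
Proof.
move=> Ux; apply: (bw_rot ab); [exact: brac_hodgel|exact: brac_hodge].
Qed.

Lemma dD_parity (w : cf) (e : C) x : (forall i, csmooth U (w i)) ->
  (forall i y, U y -> reflS L y *m w i y *m reflS L y = e *: w i y) -> U x ->
  reflS L x *m dD L w x *m reflS L x = e *: dD L w x.
Proof.
move=> ws we Ux; apply: odd_sub.
  exact: (DEnd_parity Uo Ps PP 0 (ws 1) (we 1) Ux).
exact: (DEnd_parity Uo Ps PP 1 (ws 0) (we 0) Ux).
Qed.

Lemma dD_gauge_potential x : U x -> dD L Dl x = 0.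
Proof.
move=> Ux.
have Cz := codazzi Uo Ps PP Ux.
rewrite (dDE Ns Ux) in Cz.
have H := curvature_split (cpdA 0 1 Ux) (cpdA 1 0 Ux) (gauge_flat Ux) Cz
  (bwMu Ux) (Dl_comm Ux).
rewrite -(dDE Mus Ux) -(dDE Dls Ux) in H.
apply: parity_split H; last exact: etrans (dD_parity Dls Dl_even Ux) (scale1r _).
apply: odd_add; first exact: etrans (dD_parity Mus Mu_odd Ux) (scaleN1r _).
apply: odd_even_bw.
- exact: (reflSK Uo Ps PP).
- exact: etrans (Mu_odd 0 Ux) (scaleN1r _).
- exact: etrans (Mu_odd 1 Ux) (scaleN1r _).
- exact: etrans (Dl_even 0 Ux) (scale1r _).
- exact: etrans (Dl_even 1 Ux) (scale1r _).
Qed.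

Let cpdPsi i x : U x -> cpd i Psi x = - (A i x *m Psi x).
Proof.
move=> Ux; apply: (inv_deriv (PsiPhi Ux) (PhiPsi Ux) (dPhi i Ux)).
apply: etrans (esym (cpdM Uo i Psis Phis Ux)) _.
apply: etrans (cpd_cst i (1%:M : cend) x).
by apply: (eq_cpd Uo) => // y Uy; exact: PsiPhi.
Qed.

Lemma cpd_gauge (W : P -> cend) i x : csmooth U W -> U x ->
  cpd i (fun y => Phi y *m W y *m Psi y) x =
  Phi x *m (cpd i W x + A i x *m W x - W x *m A i x) *m Psi x.
Proof.
move=> sW Ux.
apply: etrans (cpdM Uo i (csmoothM Uo Phis sW) Psis Ux) _.
rewrite (cpdM Uo i Phis sW Ux).
exact: gauge_deriv (dPhi i Ux) (cpdPsi i Ux).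
Qed.

Lemma csmooth_gauge (W : P -> cend) : csmooth U W ->
  csmooth U (fun y => Phi y *m W y *m Psi y).
Proof. by move=> sW; exact: (csmoothM Uo (csmoothM Uo Phis sW) Psis). Qed.

Let Ps' : csmooth U (projS L').
Proof.
by apply: (eq_csmooth Uo _ (csmooth_gauge Ps)) => y Uy; rewrite PS'.
Qed.

Let PP' x : U x -> projS L' x *m projS L' x = projS L' x.
Proof.
move=> Ux; rewrite PS' //.
by rewrite -!mulmxA (mulmxA (Psi x)) PsiPhi // mul1mx (mulmxA (projS L x)) PP.
Qed.

Lemma calN_gauge i x : U x -> calN L' i x = Phi x *m Mu i x *m Psi x.
Proof.
move=> Ux; rewrite (calN_E Uo Ps' PP' i Ux).
have -> : cpd i (projS L') x = Phi x *m
    (cpd i (projS L) x + A i x *m projS L x - projS L x *m A i x) *m Psi x.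
  apply: etrans _ (cpd_gauge i Ps Ux).
  by apply: (eq_cpd Uo) => // y Uy; exact: PS'.
rewrite /reflS PS' // -[1%:M](PhiPsi Ux).
apply: gauge_proj_deriv (PsiPhi Ux) (erefl _) (reflSK Uo Ps PP Ux) (NE i Ux)
  (reflS_calN Uo Ps PP i Ux) _ _.
  exact: etrans (Mu_odd i Ux) (scaleN1r _).
exact: etrans (Dl_even i Ux) (scale1r _).
Qed.

Lemma DEnd_gauge (W W' : P -> cend) i x : csmooth U W -> U x ->
  (forall y, U y -> W' y = Phi y *m W y *m Psi y) ->
  DEnd L' i W' x =
  Phi x *m (DEnd L i W x + (Dl i x *m W x - W x *m Dl i x)) *m Psi x.
Proof.
move=> sW Ux WE.
have sW' : csmooth U W'.
  by apply: (eq_csmooth Uo _ (csmooth_gauge sW)) => y Uy; rewrite WE.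
rewrite (DEnd_E Uo Ps' PP' i sW' Ux) (DEnd_E Uo Ps PP i sW Ux).
have -> : cpd i W' x = Phi x *m (cpd i W x + A i x *m W x - W x *m A i x) *m Psi x.
  apply: etrans _ (cpd_gauge i sW Ux).
  by apply: (eq_cpd Uo) => // y Uy; exact: WE.
rewrite WE // calN_gauge //.
exact: gauge_DEnd (PsiPhi Ux).
Qed.

Lemma dD_gauge (w w' : cf) x : (forall i, csmooth U (w i)) -> U x ->
  (forall i y, U y -> w' i y = Phi y *m w i y *m Psi y) ->
  dD L' w' x = Phi x *m (dD L w x + brac_wedge Dl w x) *m Psi x.
Proof.
move=> ws Ux wE; rewrite /dD (DEnd_gauge 0 (ws 1) Ux (wE 1)).
by rewrite (DEnd_gauge 1 (ws 0) Ux (wE 0)) gauge_bw_add.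
Qed.

Variable q' : cf.
Hypothesis q'E : forall i x, U x -> q' i x = Phi x *m Q i x *m Psi x.

(** q_mu is the sum of q_mu - q and q, both closed for D, and the extra bracket of q_mu - q with
    q_mu vanishes by commutativity. *)
Lemma dD_multiplier_gauge x : U x -> dD L' q' x = 0.
Proof.
move=> Ux; rewrite (dD_gauge Qs Ux q'E).
have -> : dD L Q x = 0.
  have QE i y : U y -> Q i y = 1 *: Dl i y + 1 *: q i y.
    by move=> Uy; rewrite /Q /Dl /comb; exact: comb_sub1.
  rewrite (dD_linear Dls qs QE Ux) (dD_gauge_potential Ux) dDq //.
  by rewrite !scaler0 addr0.
have -> : brac_wedge Dl Q x = 0 by exact: comb_comm.
by rewrite addr0 mulmx0 mul0mx.
Qed.

Lemma willmore_gauge x : U x ->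
  dD L' (hodge L' (calN L')) x = 2 *: brac_wedge q' (hodge L' (calN L')) x.
Proof.
move=> Ux.
(* This is the dual of N_mu; by Codazzi its N term adds nothing to the D-derivative. *)
pose w : cf := fun i y => a *: hodge L N i y + (- b) *: N i y.
have hs i : csmooth U (hodge L N i) by exact: csmooth_hodge.
have ws i : csmooth U (w i).
  by apply: (csmoothD Uo); apply: (csmooth_scale Uo).
have wE i y : U y -> hodge L' (calN L') i y = Phi y *m w i y *m Psi y.
  move=> Uy; rewrite (hodge_gauge (w := Mu) i Uy); last first.
    by move=> j; exact: calN_gauge.
  by rewrite (hodge_comb a b N i Uy) /w scaleNr.
rewrite (dD_gauge ws Ux wE).
have -> : dD L w x = a *: dD L (hodge L N) x.
  rewrite (dD_linear hs Ns (fun i y _ => erefl) Ux) (codazzi Uo Ps PP Ux).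
  by rewrite scaler0 addr0.
rewrite /brac_wedge !q'E // !wE // -!/(bw _ _ _ _).
rewrite (gauge_bw _ _ _ _ (PsiPhi Ux)).
rewrite scalemxAl scalemxAr; congr (_ *m _ *m _).
have wE' i : w i x = a *: hodge L N i x - b *: N i x by rewrite /w scaleNr.
rewrite !wE'.
apply: (willmore_alg ab); last exact: cwq.
  exact: (brac_hodge q N Ux).
exact: brac_hodgel.
Qed.

Lemma dlambda_comb (L0 : P -> {vspace 'cV[R]_n.+2}) (q0 : cf) (lam : C) i
    (v : P -> 'cV[C]_n.+2) x :
  dlambda L0 q0 lam i v x = calD L0 i v x +
  (comb L0 ((lam + lam^-1) / 2) ('i%C * (lam - lam^-1) / 2) (calN L0) i x +
   comb L0 ((lam ^+ 2 - 1 + (lam ^- 2 - 1)) / 2)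
     ('i%C * (lam ^+ 2 - 1 - (lam ^- 2 - 1)) / 2) q0 i x) *m v x.
Proof.
rewrite -(types_comb L0 lam lam^-1 (calN L0)).
by rewrite -(types_comb L0 (lam ^+ 2 - 1) (lam ^- 2 - 1) q0) !addrA.
Qed.

(** In complex notation the coefficient of N becomes (k + i l)(a + i b), and that of q becomes (k' +
    i l' + 1)(c + i s) - 1: the gauged D carries q_mu - q, which accounts for the shift by 1 already
    present in lambda^2 - 1. *)
Lemma dlambda_gauge (k l k' l' : C) i (v : P -> 'cV[C]_n.+2) x :
  csmooth U v -> U x ->
  calD L' i (fun y => Phi y *m v y) x +
   (comb L' k l (calN L') i x + comb L' k' l' q' i x) *m (Phi x *m v x) =
  Phi x *m (calD L i v x + (comb L (k * a - l * b) (k * b + l * a) N i x +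
     comb L (k' * c - l' * s + c - 1) (k' * s + l' * c + s) q i x) *m v x).
Proof.
move=> sv Ux.
have svP := csmoothM Uo Phis sv.
rewrite (calD_E Uo Ps' PP' i svP Ux) (calD_E Uo Ps PP i sv Ux).
rewrite (cpdM Uo i Phis sv Ux) (dPhi i Ux) calN_gauge //.
rewrite (gauge_calD _ _ _ _ _ (PsiPhi Ux)).
rewrite (comb_gauge (w := Mu) k l i Ux); last by move=> j; exact: calN_gauge.
rewrite (comb_gauge (w := Q) k' l' i Ux); last by move=> j; exact: q'E.
rewrite (comb_comb a b k l N i Ux) (comb_comb c s k' l' q i Ux).
apply: gauge_apply; [exact: PsiPhi|exact: comb_add1].
Qed.

End Gauge.

(** * Lorentzian linear algebra *)

Section LorentzAlgebra.
Variables (K : fieldType) (n : nat).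
Local Notation vec := 'cV[K]_n.+2.
Local Notation mat := 'M[K]_n.+2.
Implicit Types (u v w : vec) (V : {vspace vec}) (A : mat).
Local Notation eta := (eta K n).

Lemma tr_eta : eta^T = eta.
Proof. exact: tr_diag_mx. Qed.

Lemma etaK : eta *m eta = 1%:M.
Proof.
rewrite mulmx_diag -diag_const_mx; congr diag_mx; apply/rowP => j; rewrite !mxE.
by case: ifP; rewrite ?mulrNN mulr1.
Qed.

Lemma lorE u v : u^T *m eta *m v = (lor u v)%:M.
Proof. by rewrite [LHS]mx11_scalar. Qed.

Lemma lorC u v : lor u v = lor v u.
Proof.
rewrite /lor; transitivity ((u^T *m eta *m v)^T 0 0); first by rewrite [RHS]mxE.
by rewrite !trmx_mul trmxK tr_eta mulmxA.
Qed.

Lemma lorDr u v w : lor u (v + w) = lor u v + lor u w.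
Proof. by rewrite /lor mulmxDr mxE. Qed.
Lemma lorZr k u v : lor u (k *: v) = k * lor u v.
Proof. by rewrite /lor -scalemxAr mxE. Qed.
Lemma lorNr u v : lor u (- v) = - lor u v.
Proof. by rewrite -scaleN1r lorZr mulN1r. Qed.
Lemma lorBr u v w : lor u (v - w) = lor u v - lor u w.
Proof. by rewrite lorDr lorNr. Qed.
Lemma lor0r u : lor u 0 = 0.
Proof. by rewrite /lor mulmx0 mxE. Qed.
Lemma lorDl u v w : lor (v + w) u = lor v u + lor w u.
Proof. by rewrite lorC lorDr !(lorC u). Qed.
Lemma lorZl k u v : lor (k *: v) u = k * lor v u.
Proof. by rewrite lorC lorZr (lorC u). Qed.
Lemma lorNl u v : lor (- v) u = - lor v u.
Proof. by rewrite lorC lorNr lorC. Qed.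
Lemma lorBl u v w : lor (v - w) u = lor v u - lor w u.
Proof. by rewrite lorDl lorNl. Qed.
Lemma lor0l u : lor 0 u = 0.
Proof. by rewrite lorC lor0r. Qed.

Lemma eq_mulmx_col m p (A B : 'M[K]_(m, p)) :
  (forall w : 'cV_p, A *m w = B *m w) -> A = B.
Proof.
move=> H; apply/matrixP => i j.
by have /matrixP/(_ i 0) := H (delta_mx j 0); rewrite -!colE !mxE.
Qed.

Lemma wedge_mul u v w : wedge u v *m w = lor u w *: v - lor v w *: u.
Proof.
by rewrite /wedge mulmxBl -!mulmxA !(mulmxA _ eta) !lorE !mul_mx_scalar.
Qed.

Lemma lor_eq0 u : (forall v, lor u v = 0) -> u = 0.
Proof.
move=> H; have : u^T *m eta = 0.
  by apply: eq_mulmx_col => w; rewrite lorE H mul0mx raddf0.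
move=> /(congr1 (mulmxr eta)) /=; rewrite -mulmxA etaK mulmx1 mul0mx.
by move=> /(congr1 trmx); rewrite trmxK trmx0.
Qed.

(** Two candidates differ by a vector of V orthogonal to V. As A splits every vector into a part in
    V and a part orthogonal to V, this difference is orthogonal to everything. *)
Lemma orth_projP V A :
  (forall w, A *m w \in V /\ lorthogonal V (w - A *m w)) -> orth_proj V = A.
Proof.
move=> HA; apply: xget_unique => // B HB; apply: eq_mulmx_col => w.
have [Aw oA] := HA w; have [Bw oB] := HB w.
apply/eqP; rewrite -subr_eq0; apply/eqP.
have dV : B *m w - A *m w \in V by rewrite memvB.
have ol u : u \in V -> lor u (B *m w - A *m w) = 0.
  move=> uV; have -> : B *m w - A *m w = (w - A *m w) - (w - B *m w).
    by rewrite opprB [RHS]addrC addrA subrK.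
  by rewrite lorC lorBl oA // oB // subrr.
apply: lor_eq0 => v; have [Av oAv] := HA v.
by rewrite -[v](subrK (A *m v)) lorDr lorC oAv // lorC ol // addr0.
Qed.

Lemma lorthogonal_proj V A u w :
  (forall z, A *m z \in V /\ lorthogonal V (z - A *m z)) ->
  u \in V -> lor u (A *m w) = lor u w.
Proof.
move=> HA uV; have [_ /(_ u uV)] := HA w.
by rewrite lorC lorBr => /eqP; rewrite subr_eq0 eq_sym => /eqP.
Qed.

Lemma orth_proj_id V A u :
  (forall z, A *m z \in V /\ lorthogonal V (z - A *m z)) ->
  u \in V -> A *m u = u.
Proof.
move=> HA uV; apply/eqP; rewrite eq_sym -subr_eq0; apply/eqP; apply: lor_eq0 => v.
have [Au oA] := HA u; have [Av oAv] := HA v.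
by rewrite -[v](subrK (A *m v)) lorDr lorC oAv ?memvB // add0r oA.
Qed.

Definition wedge_by u v := wedge u v.
Fact wedge_by_linear u : linear (wedge_by u).
Proof.
move=> k v w; rewrite /wedge_by /wedge [(k *: v + w)^T]linearP /=.
rewrite mulmxDr !mulmxDl -!scalemxAl -!scalemxAr -!scalemxAl.
by rewrite scalerBr opprD addrACA.
Qed.
HB.instance Definition _ u := GRing.isLinear.Build K vec mat _ (wedge_by u)
  (@wedge_by_linear u).

Lemma wedgeZr k u v : wedge u (k *: v) = k *: wedge u v.
Proof. by rewrite -[LHS]/(wedge_by u (k *: v)) linearZ. Qed.
Lemma wedgeC u v : wedge u v = - wedge v u.
Proof. by rewrite /wedge opprB. Qed.
Lemma wedgeZl k u v : wedge (k *: u) v = k *: wedge u v.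
Proof. by rewrite wedgeC wedgeZr -scalerN -wedgeC. Qed.

(** With one factor on a line the wedges already form a linear space, the image of W under a linear
    map, so a sum of wedges is a single wedge. *)
Lemma wedgev_line (s : vec) (W : {vspace vec}) q : q \in wedgev <[s]>%VS W ->
  exists2 v, v \in W & q = wedge s v.
Proof.
move=> qW.
have sub : (wedgev <[s]> W <= linfun (wedge_by s) @: W)%VS.
  apply/span_subvP => A /allpairsP[[u v] /= [uV vW ->]].
  have /vlineP[k ->] := vbasis_mem uV.
  apply/memv_imgP; exists (k *: v); first by rewrite memvZ // (vbasis_mem vW).
  by rewrite lfunE /= /wedge_by wedgeZl wedgeZr.
have /memv_imgP[v vW ->] := subvP sub q qW.
by exists v => //; rewrite lfunE.
Qed.

Lemma memv_wedgev (V W : {vspace vec}) u v : u \in V -> v \in W -> wedge u v \in wedgev V W.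
Proof.
move=> uV vW; rewrite (coord_vbasis uV) (coord_vbasis vW).
rewrite -[wedge _ _]/(wedge_by _ _) linear_sum /=; apply: memv_suml => j _.
rewrite /wedge_by wedgeZr memvZ // wedgeC rpredN -[wedge _ _]/(wedge_by _ _).
rewrite linear_sum /=; apply: memv_suml => i _; rewrite /wedge_by wedgeZr memvZ //.
rewrite wedgeC rpredN; apply: memv_span; apply: allpairs_f; apply: mem_nth.
  by rewrite size_tuple.
by rewrite size_tuple.
Qed.

(** * Values of multipliers: wedges with a null vector *)

Section NullWedge.
Variables (s v v' : vec).
Hypotheses (ss : lor s s = 0) (vs : lor v s = 0) (vs' : lor v' s = 0).

(** Either product sends w to - (s, w)(v, v') s. *)
Lemma wedge_null_comm : wedge s v *m wedge s v' = wedge s v' *m wedge s v.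
Proof.
apply: eq_mulmx_col => w; rewrite -!mulmxA !wedge_mul.
have sv : lor s v = 0 by rewrite lorC.
have sv' : lor s v' = 0 by rewrite lorC.
rewrite !lorBr !lorZr ss sv sv' vs vs' !mulr0 !subr0 !scale0r !sub0r.
by rewrite (lorC v' v).
Qed.

Lemma wedge_null_kill : wedge s v *m s = 0.
Proof. by rewrite wedge_mul ss vs !scale0r subr0. Qed.

Lemma wedge_null_line u : lor s u = 0 -> wedge s v *m u = - lor v u *: s.
Proof. by move=> su; rewrite wedge_mul su scale0r sub0r scaleNr. Qed.
End NullWedge.

Lemma wedge_proj V A u v :
  (forall z, A *m z \in V /\ lorthogonal V (z - A *m z)) ->
  u \in V -> v \in V ->
  A *m wedge u v = wedge u v /\ wedge u v *m A = wedge u v.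
Proof.
move=> HA uV vV; split; apply: eq_mulmx_col => w; rewrite -mulmxA !wedge_mul.
  by rewrite mulmxBr -!scalemxAr !(orth_proj_id HA).
by rewrite !(lorthogonal_proj _ HA).
Qed.

Section Isometry.
Variables Phi : mat.
Hypothesis Phi_iso : Phi^T *m eta *m Phi = eta.
Definition iso_inv : mat := eta *m Phi^T *m eta.

Lemma iso_invl : iso_inv *m Phi = 1%:M.
Proof. by rewrite /iso_inv -mulmxA -mulmxA (mulmxA _ eta) Phi_iso etaK. Qed.
Lemma iso_invr : Phi *m iso_inv = 1%:M.
Proof. exact/mulmx1C/iso_invl. Qed.

Lemma iso_lor u v : lor (Phi *m u) (Phi *m v) = lor u v.
Proof.
have E : (Phi *m u)^T *m eta *m (Phi *m v) = u^T *m eta *m v.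
  by rewrite trmx_mul -[in RHS]Phi_iso !mulmxA.
by rewrite /lor E.
Qed.

Lemma wedge_conj u v :
  Phi *m wedge u v *m iso_inv = wedge (Phi *m u) (Phi *m v).
Proof.
apply: eq_mulmx_col => w.
rewrite -(mulmxA _ iso_inv) -(mulmxA Phi) !wedge_mul.
have H z : lor z (iso_inv *m w) = lor (Phi *m z) w.
  by rewrite -iso_lor mulmxA iso_invr mul1mx.
by rewrite !H mulmxBr -!scalemxAr.
Qed.

End Isometry.

Lemma mem_span4 (a b c d u : vec) : u \in <<[:: a; b; c; d]>>%VS ->
  exists k0 k1 k2 k3, u = k0 *: a + k1 *: b + k2 *: c + k3 *: d.
Proof.
rewrite !span_cons span_nil addv0.
move=> /memv_addP[_ /vlineP[k0 ->]] [_ /memv_addP[_ /vlineP[k1 ->]]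
  [_ /memv_addP[_ /vlineP[k2 ->]] [_ /vlineP[k3 ->] ->] ->] ->].
by exists k0, k1, k2, k3; rewrite !addrA.
Qed.

End LorentzAlgebra.

Section Cplx.
Variable R : realType.
Local Notation C := R[i].
Lemma cplx_inj a b : injective (@cplx R a b).
Proof.
move=> A B /matrixP E; apply/matrixP => i j; have := E i j.
by rewrite !mxE => -[].
Qed.
Lemma cplxD a b (A B : 'M[R]_(a, b)) : cplx (A + B) = cplx A + cplx B.
Proof. exact: (map_mxD (real_complex R)). Qed.
Lemma cplxB a b (A B : 'M[R]_(a, b)) : cplx (A - B) = cplx A - cplx B.
Proof. exact: (map_mxB (real_complex R)). Qed.
Lemma cplxM a b c (A : 'M[R]_(a, b)) (B : 'M[R]_(b, c)) :
  cplx (A *m B) = cplx A *m cplx B.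
Proof. exact: (map_mxM (real_complex R)). Qed.
Lemma cplxZ a b k (A : 'M[R]_(a, b)) : cplx (k *: A) = k%:C *: cplx A.
Proof. exact: (map_mxZ (real_complex R)). Qed.
Lemma cplx1 a : cplx (1%:M : 'M[R]_a) = 1%:M.
Proof. exact: (map_mx1 (real_complex R)). Qed.
Lemma cplxT a b (A : 'M[R]_(a, b)) : cplx A^T = (cplx A)^T.
Proof. by rewrite /cplx map_trmx. Qed.
Lemma cplx_eta n : cplx (eta R n) = eta C n.
Proof.
by apply/matrixP => i j; rewrite !mxE rmorphMn /=; case: ifP; rewrite ?rmorphN1 ?rmorph1.
Qed.
Lemma lor_cplx n (u v : 'cV[R]_n.+2) : lor (cplx u) (cplx v) = (lor u v)%:C.
Proof.
by rewrite /lor -cplx_eta -cplxT -!cplxM mxE.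
Qed.
Lemma conj_cplx a b (A : 'M[R]_(a, b)) : conj_mx (cplx A) = cplx A.
Proof. by apply/matrixP => i j; rewrite !mxE /= oppr0. Qed.
End Cplx.

(** * Calculus of real matrix fields *)

Section RealMatrixCalculus.
Variables (R : realType) (U : set 'rV[R]_2).
Hypothesis Uo : open U.
Local Notation P := 'rV[R]_2.

Lemma smooth_sub (V W : set P) (T : normedModType R) (f : P -> T) :
  V `<=` W -> smooth W f -> smooth V f.
Proof. by move=> VW sf s x Vx; apply: sf; exact: VW. Qed.

Lemma smooth_tr a b (F : P -> 'M[R]_(a.+1, b.+1)) : smooth U F ->
  smooth U (fun y => (F y)^T).
Proof.
move=> /(smooth_coordP Uo) sF; apply/(smooth_coordP Uo) => k l.
by apply: (eq_smooth Uo _ (sF l k)) => y _; rewrite mxE.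
Qed.

Lemma pd_tr a b i (F : P -> 'M[R]_(a.+1, b.+1)) x : smooth U F -> U x ->
  pd i (fun y => (F y)^T) x = (pd i F x)^T.
Proof.
move=> sF Ux; apply/matrixP => k l; rewrite [RHS]mxE.
apply: etrans (pd_coord i k l (smooth_diff (smooth_tr sF) Ux)) _.
apply: etrans _ (esym (pd_coord i l k (smooth_diff sF Ux))).
by apply: (eq_pd Uo) => // y _; rewrite mxE.
Qed.

Lemma smooth_mulmx a b c (F : P -> 'M[R]_(a.+1, b.+1)) (G : P -> 'M[R]_(b.+1, c.+1)) :
  smooth U F -> smooth U G -> smooth U (fun y => F y *m G y).
Proof.
move=> /(smooth_coordP Uo) sF /(smooth_coordP Uo) sG; apply/(smooth_coordP Uo) => k l.
apply: (eq_smooth Uo _ (smooth_sum Uo (index_enum 'I_b.+1) (Q := predT) _)).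
  move=> y _; rewrite mxE; apply: eq_bigr => j _; reflexivity.
by move=> j _; exact: (smoothM Uo).
Qed.

(** Read off from the complex product rule, as complexification is injective and commutes with
    derivatives. *)
Lemma pd_mulmx a b c i (F : P -> 'M[R]_(a.+1, b.+1)) (G : P -> 'M[R]_(b.+1, c.+1)) x :
  smooth U F -> smooth U G -> U x ->
  pd i (fun y => F y *m G y) x = pd i F x *m G x + F x *m pd i G x.
Proof.
move=> sF sG Ux; apply: cplx_inj; rewrite cplxD !cplxM -!cpd_cplx.
apply: etrans _ (cpdM Uo i (csmooth_cplx Uo sF) (csmooth_cplx Uo sG) Ux).
by apply: (eq_cpd Uo) => // y _; exact: cplxM.
Qed.

Lemma smooth_mxD a b (F G : P -> 'M[R]_(a.+1, b.+1)) :
  smooth U F -> smooth U G -> smooth U (fun y => F y + G y).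
Proof.
move=> /(smooth_coordP Uo) sF /(smooth_coordP Uo) sG; apply/(smooth_coordP Uo) => k l.
by apply: (eq_smooth Uo _ (smoothD Uo (sF k l) (sG k l))) => y _; rewrite mxE.
Qed.

Lemma pd_mxD a b i (F G : P -> 'M[R]_(a.+1, b.+1)) x :
  smooth U F -> smooth U G -> U x ->
  pd i (fun y => F y + G y) x = pd i F x + pd i G x.
Proof.
move=> sF sG Ux; apply: cplx_inj; rewrite cplxD -!cpd_cplx.
apply: etrans _ (cpdD Uo i (csmooth_cplx Uo sF) (csmooth_cplx Uo sG) Ux).
by apply: (eq_cpd Uo) => // y _; exact: cplxD.
Qed.

Lemma smooth_mxZ a b (f : P -> R) (F : P -> 'M[R]_(a.+1, b.+1)) :
  smooth U f -> smooth U F -> smooth U (fun y => f y *: F y).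
Proof.
move=> sf /(smooth_coordP Uo) sF; apply/(smooth_coordP Uo) => k l.
by apply: (eq_smooth Uo _ (smoothM Uo sf (sF k l))) => y _; rewrite mxE.
Qed.

Lemma pd_mxZ a b i (f : P -> R) (F : P -> 'M[R]_(a.+1, b.+1)) x :
  smooth U f -> smooth U F -> U x ->
  pd i (fun y => f y *: F y) x = pd i f x *: F x + f x *: pd i F x.
Proof.
move=> sf sF Ux; apply/matrixP => k l; have sF' := (smooth_coordP Uo F).1 sF.
apply: etrans (pd_coord i k l (smooth_diff (smooth_mxZ sf sF) Ux)) _.
transitivity (pd i (fun y => f y * F y k l) x).
  by apply: (eq_pd Uo) => // y _; rewrite mxE.
apply: etrans (pdM i (smooth_diff sf Ux) (smooth_diff (sF' k l) Ux)) _.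
rewrite [RHS]mxE [X in _ = X + _]mxE [X in _ = _ + X]mxE.
by congr (_ + _ * _); exact/esym/(pd_coord i k l (smooth_diff sF Ux)).
Qed.

Lemma pd_mx_comm a b i j (F : P -> 'M[R]_(a.+1, b.+1)) x : smooth U F -> U x ->
  pd i (pd j F) x = pd j (pd i F) x.
Proof.
move=> sF Ux; apply: cplx_inj.
apply: etrans (esym (cpd_cplx i (pd j F) x)) _.
apply: etrans _ (cpd_cplx j (pd i F) x).
have E k l : cpd k (fun y => cplx (pd l F y)) x = cpd k (cpd l (fun y => cplx (F y))) x.
  by apply: (eq_cpd Uo) => // y _; rewrite cpd_cplx.
apply: etrans (E i j) _; apply: etrans _ (esym (E j i)).
exact: (cpd_comm Uo i j (csmooth_cplx Uo sF) Ux).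
Qed.

Lemma smooth_lor n (u v : P -> 'cV[R]_n.+2) : smooth U u -> smooth U v ->
  smooth U (fun y => lor (u y) (v y)).
Proof.
move=> su sv.
have sE : smooth U (fun _ : P => eta R n) by exact: smooth_cst.
exact: (smooth_coordP Uo _).1 (smooth_mulmx (smooth_mulmx (smooth_tr su) sE) sv) 0 0.
Qed.

Lemma pd_lor n i (u v : P -> 'cV[R]_n.+2) x : smooth U u -> smooth U v -> U x ->
  pd i (fun y => lor (u y) (v y)) x = lor (pd i u x) (v x) + lor (u x) (pd i v x).
Proof.
move=> su sv Ux.
have sE : smooth U (fun _ : P => eta R n) by exact: smooth_cst.
have s1 := smooth_mulmx (smooth_tr su) sE.
apply: etrans (esym (pd_coord i 0 0 (smooth_diff (smooth_mulmx s1 sv) Ux))) _.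
rewrite (pd_mulmx i s1 sv Ux) (pd_mulmx i (smooth_tr su) sE Ux) (pd_tr i su Ux).
have -> : pd i (fun _ : P => eta R n) x = 0 by exact: derive_cst.
by rewrite mulmx0 addr0 mxE.
Qed.

End RealMatrixCalculus.

(** * Positivity of the metric of an immersion into the light-cone *)

Section Positivity.
Variables (K : realFieldType) (n : nat).
Local Notation vec := 'cV[K]_n.+2.
Implicit Types u v w s : vec.

Lemma lor_sum u v : lor u v =
  \sum_(j < n.+1) u (widen_ord (leqnSn _) j) 0 * v (widen_ord (leqnSn _) j) 0
  - u ord_max 0 * v ord_max 0.
Proof.
rewrite /lor mul_mx_diag mxE big_ord_recr /= !mxE eqxx mulrN1 mulNr.
congr (_ - _); apply: eq_bigr => j _; rewrite !mxE.
by rewrite -val_eqE /= ltn_eqF ?mulr1.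
Qed.

(** A nonzero null s has a nonzero timelike coordinate. Subtracting a multiple of s removes that
    coordinate from w without changing (w, w), which becomes a sum of squares. *)
Lemma lor_null_ge0 s w : s != 0 -> lor s s = 0 -> lor s w = 0 ->
  0 <= lor w w /\ (lor w w = 0 -> w \in <[s]>%VS).
Proof.
move=> s0 ss sw.
have spacelike u : u ord_max 0 = 0 -> 0 <= lor u u /\ (lor u u = 0 -> u = 0).
  move=> u0; rewrite lor_sum u0 mulr0 subr0.
  split; first by apply: sumr_ge0 => j _; rewrite -expr2 sqr_ge0.
  have nn (j : 'I_n.+1) : true ->
      0 <= u (widen_ord (leqnSn _) j) 0 * u (widen_ord (leqnSn _) j) 0.
    by move=> _; rewrite -expr2 sqr_ge0.
  move=> /(psumr_eq0P nn) H; apply/colP => j; rewrite [RHS]mxE.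
  have [->|jN] := eqVneq j ord_max; first by [].
  have jn : (j < n.+1)%N by rewrite ltn_neqAle -ltnS ltn_ord andbT.
  have -> : j = widen_ord (leqnSn _) (Ordinal jn) by exact/val_inj.
  have /eqP := H (Ordinal jn) isT.
  by rewrite -expr2 sqrf_eq0 => /eqP.
pose t := s ord_max 0.
have t0 : t != 0.
  apply/eqP => t0; have [_ /(_ ss) sE] := spacelike s t0.
  by rewrite sE eqxx in s0.
pose k := w ord_max 0 / t.
have w'0 : (w - k *: s) ord_max 0 = 0.
  by rewrite !mxE /k mulfVK ?subrr.
have E : lor (w - k *: s) (w - k *: s) = lor w w.
  by rewrite !(lorBr, lorBl, lorZr, lorZl) ss (lorC w s) sw; ring.
have [] := spacelike _ w'0; rewrite E => h1 h2; split => // /h2 /eqP.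
by rewrite subr_eq0 => /eqP ->; exact: memvZ (memv_line _).
Qed.

Lemma gram2_gt0 s a b : s != 0 -> lor s s = 0 -> lor s a = 0 -> lor s b = 0 ->
  free [:: s; a; b] -> 0 < lor a a * lor b b - lor a b ^+ 2.
Proof.
move=> s0 ss sa sb fr.
have Q x y : lor (x *: a + y *: b) (x *: a + y *: b) =
    x ^+ 2 * lor a a + 2 * x * y * lor a b + y ^+ 2 * lor b b.
  by rewrite !(lorDr, lorDl, lorZr, lorZl) (lorC b a); ring.
have pos x y : (x != 0) || (y != 0) ->
    0 < x ^+ 2 * lor a a + 2 * x * y * lor a b + y ^+ 2 * lor b b.
  move=> xy; rewrite -Q.
  have sw : lor s (x *: a + y *: b) = 0 by rewrite lorDr !lorZr sa sb !mulr0 addr0.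
  have [ge0 eq0] := lor_null_ge0 s0 ss sw.
  rewrite lt_neqAle ge0 andbT eq_sym; apply/negP => /eqP /eq0 /vlineP[k kE].
  have /freeP/(_ (fun i : 'I_3 => nth 0 [:: - k; x; y] i)) := fr.
  rewrite !big_ord_recl big_ord0 /= addr0 => H.
  have z : - k *: s + (x *: a + y *: b) = 0 by rewrite kE scaleNr addNr.
  have {}H := H z.
  have x0 : x = 0 by exact: (H (@Ordinal 3 1 isT)).
  have y0 : y = 0 by exact: (H (@Ordinal 3 2 isT)).
  by rewrite x0 y0 eqxx in xy.
have Apos := pos 1 0 _; rewrite oner_eq0 /= in Apos.
have {}Apos : 0 < lor a a by have := Apos isT; rewrite !(mulr0, mul0r, expr0n, addr0) expr1n mul1r.
(* This combination is orthogonal to a, and its square length is (a, a) times the Gram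
   determinant. *)
have := pos (- lor a b) (lor a a); rewrite (gt_eqF Apos) orbT => /(_ isT).
rewrite (_ : _ + _ = lor a a * (lor a a * lor b b - lor a b ^+ 2)); last by ring.
by rewrite pmulr_rgt0.
Qed.

End Positivity.

Section Gram.
Variables (K : fieldType).

Lemma det22 (A : 'M[K]_2) : \det A = A 0 0 * A 1 1 - A 0 1 * A 1 0.
Proof.
rewrite (expand_det_row A 0) big_ord_recl big_ord1 /cofactor !det_mx11 !mxE /=.
rewrite expr0 mul1r expr1 mulN1r mulrN.
by congr (A _ _ * A _ _ - A _ _ * A _ _); exact/val_inj.
Qed.

Lemma unitmx_injP m (A : 'M[K]_m) :
  (forall v : 'rV_m, v *m A = 0 -> v = 0) -> A \in unitmx.
Proof.
move=> H; rewrite unitmxE unitfE; apply/negP => /det0P[v v0 vA].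
by rewrite (H v vA) eqxx in v0.
Qed.

End Gram.

(** * Lifts and the central sphere congruence *)

Lemma lor_tension_alg (K : fieldType) n (u a b c d : 'cV[K]_n.+2) (e f g : K) :
  lor u a = - e -> lor u b = - f -> lor u c = - f -> lor u d = - g ->
  lor u (g *: a - f *: b - f *: c + e *: d) = - 2 * (e * g - f ^+ 2).
Proof. by move=> ha hb hc hd; rewrite lorDr !lorBr !lorZr ha hb hc hd; ring. Qed.

(** Here [kij] is the volume density times the inverse metric, [pij] its derivative in direction i,
    v the inverse density and d the inverse determinant. *)
Lemma laplacian_alg (K : fieldType) m (v d e f g k00 k01 k10 k11 p00 p01 p10 p11 : K)
    (S0 S1 S00 S01 S10 S11 : 'cV[K]_m) :
  v * k00 = d * g -> v * k11 = d * e -> v * k01 = d * - f -> v * k10 = d * - f ->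
  v *: ((p00 *: S0 + k00 *: S00 + (p01 *: S1 + k01 *: S01)) +
        (p10 *: S0 + k10 *: S10 + (p11 *: S1 + k11 *: S11))) =
  (v * (p00 + p10)) *: S0 + (v * (p01 + p11)) *: S1 +
  d *: (g *: S00 - f *: S01 - f *: S10 + e *: S11).
Proof.
move=> h00 h11 h01 h10; rewrite !(scalerDr, scalerA) h00 h11 h01 h10.
by apply/colP => l; rewrite ?(addmxE, oppmxE, scalemxE); ring.
Qed.

Section NullLift.
Variables (R : realType) (n : nat) (W : set 'rV[R]_2).
Local Notation P := 'rV[R]_2.
Local Notation rvec := 'cV[R]_n.+2.
Variable s : P -> rvec.
Hypothesis Wo : open W.
Hypothesis ss : smooth W s.
Hypothesis s_null : forall y, W y -> lor (s y) (s y) = 0.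

(* the determinant of the metric times the trace of the Hessian; unlike the
   Laplacian it is polynomial in the derivatives of f *)
Definition tension (f : P -> rvec) (x : P) : rvec :=
  let g := metric f x in
  g 1 1 *: pd 0 (pd 0 f) x - g 0 1 *: pd 0 (pd 1 f) x
  - g 0 1 *: pd 1 (pd 0 f) x + g 0 0 *: pd 1 (pd 1 f) x.

Lemma metricE (f : P -> rvec) x i j : metric f x i j = lor (pd i f x) (pd j f x).
Proof. by rewrite mxE. Qed.

Lemma metricC (f : P -> rvec) x i j : metric f x i j = metric f x j i.
Proof. by rewrite !metricE; exact: lorC. Qed.

Lemma det_metric (f : P -> rvec) x :
  \det (metric f x) = metric f x 0 0 * metric f x 1 1 - metric f x 0 1 ^+ 2.
Proof. by rewrite det22 (metricC f x 1 0) expr2. Qed.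

Let sp i := smooth_pd i ss.
Let spp i j := smooth_pd i (smooth_pd j ss).

Lemma lor_lift_pd i x : W x -> lor (s x) (pd i s x) = 0.
Proof.
move=> Wx; have := pd_lor Wo i ss ss Wx.
have -> : pd i (fun y => lor (s y) (s y)) x = 0.
  transitivity (pd i (fun _ : P => 0 : R) x); last exact: derive_cst.
  by apply: (eq_pd Wo) => // y; exact: s_null.
rewrite (lorC _ (s x)) => /esym/eqP; rewrite -mulr2n mulrn_eq0 /=.
by move/eqP.
Qed.

Lemma lor_lift_pd2 i j x : W x ->
  lor (s x) (pd i (pd j s) x) = - metric s x i j.
Proof.
move=> Wx; have := pd_lor Wo i ss (sp j) Wx.
have -> : pd i (fun y => lor (s y) (pd j s y)) x = 0.
  transitivity (pd i (fun _ : P => 0 : R) x); last exact: derive_cst.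
  by apply: (eq_pd Wo) => // y; exact: lor_lift_pd.
by move/esym/eqP; rewrite addr_eq0 metricE => /eqP ->; rewrite opprK.
Qed.

(** By the preceding identity this is minus the trace of the metric against its own adjugate. Being
    nonzero, it puts [tension s] outside the span of s and ds and makes the frame of S
    nondegenerate. *)
Lemma lor_lift_tension x : W x -> lor (s x) (tension s x) = - 2 * \det (metric s x).
Proof.
move=> Wx; rewrite det_metric; apply: lor_tension_alg.
- exact: (lor_lift_pd2 0 0 Wx).
- exact: (lor_lift_pd2 0 1 Wx).
- by rewrite (metricC s x 0 1); exact: (lor_lift_pd2 1 0 Wx).
- exact: (lor_lift_pd2 1 1 Wx).
Qed.

Lemma smooth_metric i j : smooth W (fun y => metric s y i j).
Proof.
by apply: (eq_smooth Wo _ (smooth_lor Wo (sp i) (sp j))) => y _; rewrite metricE.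
Qed.

Lemma smooth_det_metric : smooth W (fun y => \det (metric s y)).
Proof.
apply: (eq_smooth Wo _ (smoothB Wo (smoothM Wo (smooth_metric 0 0) (smooth_metric 1 1))
  (smoothM Wo (smooth_metric 0 1) (smooth_metric 0 1)))) => y _.
by rewrite det_metric expr2.
Qed.

Lemma smooth_tension : smooth W (tension s).
Proof.
have N1 (f : P -> rvec) : smooth W f -> smooth W (fun y => - f y).
  move=> sf; apply: (eq_smooth Wo _ (smooth_mxZ Wo (smooth_cst Wo (-1 : R)) sf)).
  by move=> y _; rewrite scaleN1r.
apply: (smooth_mxD Wo); last exact: (smooth_mxZ Wo (smooth_metric _ _) (spp _ _)).
apply: (smooth_mxD Wo); last first.
  by apply: N1; exact: (smooth_mxZ Wo (smooth_metric _ _) (spp _ _)).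
apply: (smooth_mxD Wo); first exact: (smooth_mxZ Wo (smooth_metric _ _) (spp _ _)).
by apply: N1; exact: (smooth_mxZ Wo (smooth_metric _ _) (spp _ _)).
Qed.

Section Immersion.
Hypothesis det0 : forall y, W y -> 0 < \det (metric s y).

(** In 'I_2 the operation [1 - i] exchanges the two indices, so the matrix is the adjugate of the
    metric. *)
Lemma invmx_metric x : W x -> invmx (metric s x) = (\det (metric s x))^-1 *:
  \matrix_(i, j) (if i == j then metric s x (1 - i) (1 - i)
                  else - metric s x 0 1).
Proof.
move=> Wx; set B := \matrix_(i, j) _.
have BE i j : B i j = if i == j then metric s x (1 - i) (1 - i)
  else - metric s x 0 1 by rewrite mxE.
have d0 : \det (metric s x) != 0 by rewrite gt_eqF // det0.
have U : metric s x \in unitmx by rewrite unitmxE unitfE.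
suff E : ((\det (metric s x))^-1 *: B) *m metric s x = 1%:M.
  by rewrite -[LHS]mul1mx -E -mulmxA mulmxV // mulmx1.
rewrite -scalemxAl; apply/matrixP => i j.
rewrite mxE [X in _ * X]mxE big_ord_recl big_ord1 !BE [RHS]mxE.
have -> : lift ord0 ord0 = 1 :> 'I_2 by exact/val_inj.
have d0' := d0; rewrite det_metric in d0'.
have m1 := metricC s x 1 0.
have E0 : 1 - 0 = 1 :> 'I_2 by exact/val_inj.
have E1 : 1 - 1 = 0 :> 'I_2 by exact/val_inj.
case: (ord2 i) => ->; case: (ord2 j) => ->; rewrite det_metric ?E0 ?E1 ?m1 /=;
  by field.
Qed.

Lemma invmx_metricE x i j : W x -> invmx (metric s x) i j =
  (\det (metric s x))^-1 *
  (if i == j then metric s x (1 - i) (1 - i) else - metric s x 0 1).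
Proof. by move=> Wx; rewrite invmx_metric // mxE [X in _ * X]mxE. Qed.

(** Derivatives that fall on the density or on the inverse metric yield only multiples of ds; hence
    [tension] may replace the Laplacian in a frame of S. *)
Lemma laplacian_tension x : W x -> exists a b,
  laplacian s x = a *: pd 0 s x + b *: pd 1 s x
                  + (\det (metric s x))^-1 *: tension s x.
Proof.
move=> Wx; set vol := fun y => Num.sqrt (\det (metric s y)).
have vs : smooth W vol by exact: (smooth_sqrt Wo det0 smooth_det_metric).
pose k i j y := vol y * invmx (metric s y) i j.
have ks i j : smooth W (k i j).
  apply: (smoothM Wo vs).
  have iv := smoothV Wo (fun y Wy => lt0r_neq0 (det0 Wy)) smooth_det_metric.
  case: (eqVneq i j) => [ij|ij].
    apply: (eq_smooth Wo _ (smoothM Wo iv (smooth_metric (1 - i) (1 - i)))).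
    by move=> y Wy; rewrite invmx_metricE // ij eqxx.
  apply: (eq_smooth Wo _ (smoothM Wo iv (smoothN Wo (smooth_metric 0 1)))).
  by move=> y Wy; rewrite invmx_metricE // (negbTE ij).
have E i : pd i (fun y => \sum_(j < 2) (vol y * invmx (metric s y) i j) *: pd j s y) x =
   pd i (k i 0) x *: pd 0 s x + k i 0 x *: pd i (pd 0 s) x +
   (pd i (k i 1) x *: pd 1 s x + k i 1 x *: pd i (pd 1 s) x).
  transitivity (pd i (fun y => k i 0 y *: pd 0 s y + k i 1 y *: pd 1 s y) x).
    apply: (eq_pd Wo) => // y _; rewrite big_ord_recl big_ord1.
    by have -> : lift ord0 ord0 = 1 :> 'I_2 by exact/val_inj.
  have s0 := smooth_mxZ Wo (ks i 0) (sp 0).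
  have s1 := smooth_mxZ Wo (ks i 1) (sp 1).
  apply: etrans (pd_mxD Wo i s0 s1 Wx) _; congr (_ + _).
    exact: (pd_mxZ Wo).
  exact: (pd_mxZ Wo).
rewrite /laplacian -/vol big_ord_recl big_ord1.
have -> : lift ord0 ord0 = 1 :> 'I_2 by exact/val_inj.
rewrite (E 0) (E 1).
exists ((vol x)^-1 * (pd 0 (k 0 0) x + pd 1 (k 1 0) x)).
exists ((vol x)^-1 * (pd 0 (k 0 1) x + pd 1 (k 1 1) x)).
have v0 : vol x != 0 by rewrite gt_eqF // sqrtr_gt0 det0.
have kE i j : (vol x)^-1 * k i j x = invmx (metric s x) i j.
  by rewrite /k mulrA mulVf // mul1r.
have K00 : (vol x)^-1 * k 0 0 x = (\det (metric s x))^-1 * metric s x 1 1.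
  rewrite kE invmx_metricE //=.
  by have -> : 1 - 0 = 1 :> 'I_2 by exact/val_inj.
have K11 : (vol x)^-1 * k 1 1 x = (\det (metric s x))^-1 * metric s x 0 0.
  rewrite kE invmx_metricE //=.
  by have -> : 1 - 1 = 0 :> 'I_2 by exact/val_inj.
have K01 : (vol x)^-1 * k 0 1 x = (\det (metric s x))^-1 * - metric s x 0 1.
  by rewrite kE invmx_metricE.
have K10 : (vol x)^-1 * k 1 0 x = (\det (metric s x))^-1 * - metric s x 0 1.
  by rewrite kE invmx_metricE.
exact: laplacian_alg K00 K11 K01 K10.
Qed.

End Immersion.

End NullLift.

(** * Orthogonal projection onto the span of a frame *)

Section FrameProj.
Variables (K : fieldType) (n m : nat) (M : 'M[K]_(n.+2, m)) (X : m.-tuple 'cV[K]_n.+2).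
Hypothesis MX : forall j, col j M = X`_j.

Definition gram : 'M[K]_m := M^T *m eta K n *m M.
(** The least squares formula. It is rational in the frame, which is how the smoothness of the
    projection is obtained. *)
Definition frame_proj : 'M[K]_n.+2 := M *m invmx gram *m M^T *m eta K n.

Lemma lor_col (j : 'I_m) (z : 'cV[K]_n.+2) : lor X`_j z = (M^T *m eta K n *m z) j 0.
Proof.
rewrite -MX /lor tr_col -row_mul !mxE; apply: eq_bigr => l _.
by rewrite [row _ _ _ _]mxE.
Qed.

Lemma gramE (j k : 'I_m) : gram j k = lor X`_j X`_k.
Proof.
rewrite lor_col -MX /gram !mxE; apply: eq_bigr => l _.
by rewrite [col _ _ _ _]mxE.
Qed.

Lemma frame_projP : gram \in unitmx -> forall w,
  frame_proj *m w \in <<X>>%VS /\ lorthogonal <<X>>%VS (w - frame_proj *m w).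
Proof.
move=> gU w; split.
  have -> : frame_proj *m w = M *m (invmx gram *m M^T *m eta K n *m w).
    by rewrite /frame_proj !mulmxA.
  set c := (X in M *m X).
  have -> : M *m c = \sum_j c j 0 *: col j M.
    apply/colP => i; rewrite mxE summxE; apply: eq_bigr => j _.
    by rewrite !mxE mulrC.
  apply: memv_suml => j _; rewrite MX memvZ // memv_span // mem_nth //.
  by rewrite size_tuple.
move=> u /coord_span ->; rewrite lorC.
have lor_suml z : lor (\sum_(i < m) coord X i u *: X`_i) z =
    \sum_(i < m) coord X i u * lor X`_i z.
  elim/big_rec2: _ => [|i y1 y2 _ <-]; first exact: lor0l.
  by rewrite lorDl lorZl.
rewrite lor_suml big1 // => j _; rewrite lor_col.
suff -> : M^T *m eta K n *m (w - frame_proj *m w) = 0 by rewrite mxE mulr0.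
rewrite mulmxBr /frame_proj !mulmxA -/gram mulmxV //.
by rewrite mul1mx subrr.
Qed.

End FrameProj.

(** The shape of the Gram matrix of s, d_0 s, d_1 s and the tension. Column 0 forces the last
    coordinate of a kernel vector to vanish, the middle block the next two, and the last column the
    first. *)
Lemma gram4_unit (K : fieldType) (G : 'M[K]_4) (c e f g p r t : K) :
  c != 0 -> e * g - f ^+ 2 != 0 ->
  (forall j k : 'I_4, G j k = nth 0 (nth [::] [:: [:: 0; 0; 0; c]; [:: 0; e; f; p];
     [:: 0; f; g; r]; [:: c; p; r; t]] j) k) ->
  G \in unitmx.
Proof.
move=> c0 d0 GE; apply: unitmx_injP => v vG.
have E (k : 'I_4) : \sum_j v 0 j * G j k = 0.
  by have /matrixP/(_ 0 k) := vG; rewrite !mxE.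
have o1 : lift ord0 ord0 = @Ordinal 4 1 isT by exact/val_inj.
have o2 : lift ord0 (lift ord0 ord0) = @Ordinal 4 2 isT by exact/val_inj.
have o3 : lift ord0 (lift ord0 (lift ord0 ord0)) = @Ordinal 4 3 isT by exact/val_inj.
have S (k : 'I_4) : v 0 (@Ordinal 4 0 isT) * G (@Ordinal 4 0 isT) k
  + v 0 (@Ordinal 4 1 isT) * G (@Ordinal 4 1 isT) k
  + v 0 (@Ordinal 4 2 isT) * G (@Ordinal 4 2 isT) k
  + v 0 (@Ordinal 4 3 isT) * G (@Ordinal 4 3 isT) k = 0.
  rewrite -(E k) !big_ord_recl big_ord0 addr0 !addrA -o1 -o2 -o3.
  by congr (v _ _ * G _ _ + _ + _ + _); exact/val_inj.
set v0 := v 0 (@Ordinal 4 0 isT) in S; set v1 := v 0 (@Ordinal 4 1 isT) in S.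
set v2 := v 0 (@Ordinal 4 2 isT) in S; set v3 := v 0 (@Ordinal 4 3 isT) in S.
have S0 := S (@Ordinal 4 0 isT); have S1 := S (@Ordinal 4 1 isT).
have S2 := S (@Ordinal 4 2 isT); have S3 := S (@Ordinal 4 3 isT).
rewrite !GE /= in S0 S1 S2 S3.
have v30 : v3 = 0.
  by apply/eqP; have /eqP := S0; rewrite !mulr0 !add0r mulf_eq0 (negbTE c0) orbF.
rewrite v30 !mul0r !addr0 !mulr0 !add0r in S1 S2 S3.
have v10 : v1 = 0.
  have : v1 * (e * g - f ^+ 2) = 0.
    by transitivity ((v1 * e + v2 * f) * g - (v1 * f + v2 * g) * f); [ring|rewrite S1 S2 !mul0r subr0].
  by move/eqP; rewrite mulf_eq0 (negbTE d0) orbF => /eqP.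
have v20 : v2 = 0.
  have : v2 * (e * g - f ^+ 2) = 0.
    by transitivity ((v1 * f + v2 * g) * e - (v1 * e + v2 * f) * f); [ring|rewrite S1 S2 !mul0r subr0].
  by move/eqP; rewrite mulf_eq0 (negbTE d0) orbF => /eqP.
have v00 : v0 = 0.
  apply/eqP; have /eqP := S3; rewrite v10 v20 !mul0r !addr0.
  by rewrite mulf_eq0 (negbTE c0) orbF.
apply/rowP => j; rewrite mxE.
by case: j => [[|[|[|[|//]]]] hj]; rewrite ?(bool_irrelevance hj isT);
  [exact: v00|exact: v10|exact: v20|exact: v30].
Qed.

Section SmoothDet.
Variables (R : realType) (W : set 'rV[R]_2).
Hypothesis Wo : open W.

Lemma smooth_det m (F : 'rV[R]_2 -> 'M[R]_m) :
  (forall i j, smooth W (fun y => F y i j)) -> smooth W (fun y => \det (F y)).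
Proof.
move=> sF; apply: (smooth_sum Wo) => p _; apply: (smoothM Wo).
  exact: (smooth_cst Wo).
exact: (smooth_prod Wo).
Qed.

(** Cramer's rule: the entries are cofactors divided by the determinant. *)
Lemma smooth_invmx m (F : 'rV[R]_2 -> 'M[R]_m) :
  (forall i j, smooth W (fun y => F y i j)) ->
  (forall y, W y -> F y \in unitmx) ->
  forall i j, smooth W (fun y => invmx (F y) i j).
Proof.
move=> sF FU i j.
have dV : smooth W (fun y => (\det (F y))^-1).
  apply: (smoothV Wo); last exact: smooth_det.
  by move=> y Wy; have := FU y Wy; rewrite unitmxE unitfE.
have cof : smooth W (fun y => \adj (F y) i j).
  apply: (eq_smooth Wo (f := fun y => (-1) ^+ (j + i) * \det (row' j (col' i (F y))))).
    by move=> y _; rewrite mxE.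
  apply: (smoothM Wo); first exact: (smooth_cst Wo).
  apply: smooth_det => k l; apply: (eq_smooth Wo _ (sF (lift j k) (lift i l))).
  by move=> y _; rewrite !mxE.
apply: (eq_smooth Wo _ (smoothM Wo dV cof)) => y Wy.
by rewrite /invmx (FU y Wy) [RHS]mxE.
Qed.

End SmoothDet.

(** The second derivatives of k S expanded by Leibniz. The leading factor k^3 is k^2 from the metric
    times k from the lift; all other terms lie in the span of S and its first derivatives. *)
Lemma tension_scale_alg (K : fieldType) m
    (e f g e' f' g' k k0 k1 k00 k01 k10 k11 : K)
    (S S0 S1 S00 S01 S10 S11 T00 T01 T10 T11 : 'cV[K]_m) :
  e' = k ^+ 2 * e -> f' = k ^+ 2 * f -> g' = k ^+ 2 * g ->
  T00 = k00 *: S + k0 *: S0 + (k0 *: S0 + k *: S00) ->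
  T01 = k01 *: S + k1 *: S0 + (k0 *: S1 + k *: S01) ->
  T10 = k10 *: S + k0 *: S1 + (k1 *: S0 + k *: S10) ->
  T11 = k11 *: S + k1 *: S1 + (k1 *: S1 + k *: S11) ->
  g' *: T00 - f' *: T01 - f' *: T10 + e' *: T11 =
  (k ^+ 2 * (g * k00 - f * k01 - f * k10 + e * k11)) *: S
  + (2 * k ^+ 2 * (g * k0 - f * k1)) *: S0
  + (2 * k ^+ 2 * (e * k1 - f * k0)) *: S1
  + k ^+ 3 *: (g *: S00 - f *: S01 - f *: S10 + e *: S11).
Proof.
move=> -> -> -> -> -> -> ->.
by apply/colP => l; rewrite ?(addmxE, oppmxE, scalemxE); ring.
Qed.

Lemma det_scale_alg (K : fieldType) (e f g e' f' g' k : K) :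
  e' = k ^+ 2 * e -> f' = k ^+ 2 * f -> g' = k ^+ 2 * g ->
  e' * g' - f' ^+ 2 = (k ^+ 2) ^+ 2 * (e * g - f ^+ 2).
Proof. by move=> -> -> ->; ring. Qed.

Lemma lor_scale_alg (K : fieldType) n (u a b : 'cV[K]_n.+2) (p q k : K) :
  lor u u = 0 -> lor u a = 0 -> lor u b = 0 ->
  lor (p *: u + k *: a) (q *: u + k *: b) = k ^+ 2 * lor a b.
Proof.
move=> uu ua ub; rewrite lorDl !lorZl !lorDr !lorZr uu ub (lorC a u) ua; ring.
Qed.

Lemma JmxE (R : realType) (g : 'M[R]_2) i j : Jmx g i j =
  (Num.sqrt (\det g))^-1 * (if i == 0 then - g 1 j else g 0 j).
Proof. by rewrite mxE [X in _ * X]mxE. Qed.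

Lemma Jmx_scale (R : realType) (g g' : 'M[R]_2) (k : R) : k != 0 ->
  Num.sqrt (\det g') = k * Num.sqrt (\det g) ->
  (forall i j, g' i j = k * g i j) -> Jmx g' = Jmx g.
Proof.
move=> k0 vE gE; apply/matrixP => i j; rewrite !JmxE vE !gE invfM.
by case: ifP => _; rewrite -?mulrN mulrACA mulVf // mul1r.
Qed.

(** * Change of lift *)

Section ScaleLift.
Variables (R : realType) (n : nat) (V : set 'rV[R]_2).
Local Notation P := 'rV[R]_2.
Local Notation rvec := 'cV[R]_n.+2.
Variables (s s' : P -> rvec) (f : P -> R).
Hypothesis Vo : open V.
Hypothesis ss : smooth V s.
Hypothesis s_null : forall y, V y -> lor (s y) (s y) = 0.
Hypothesis fs : smooth V f.
Hypothesis s'E : forall y, V y -> s' y = f y *: s y.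

Lemma pd_scale_lift i x : V x ->
  pd i s' x = pd i f x *: s x + f x *: pd i s x.
Proof.
move=> Vx; apply: etrans _ (pd_mxZ Vo i fs ss Vx).
exact: (eq_pd Vo).
Qed.

Lemma pd2_scale_lift i j x : V x ->
  pd i (pd j s') x = pd i (pd j f) x *: s x + pd j f x *: pd i s x
  + (pd i f x *: pd j s x + f x *: pd i (pd j s) x).
Proof.
move=> Vx.
have s1 := smooth_mxZ Vo (smooth_pd j fs) ss.
have s2 := smooth_mxZ Vo fs (smooth_pd j ss).
transitivity (pd i (fun y => pd j f y *: s y + f y *: pd j s y) x).
  by apply: (eq_pd Vo) => // y Vy; exact: pd_scale_lift.
apply: etrans (pd_mxD Vo i s1 s2 Vx) _; congr (_ + _).
  exact: (pd_mxZ Vo i (smooth_pd j fs) ss Vx).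
exact: (pd_mxZ Vo i fs (smooth_pd j ss) Vx).
Qed.

Lemma metric_scale_lift i j x : V x ->
  metric s' x i j = f x ^+ 2 * metric s x i j.
Proof.
move=> Vx; rewrite metricE (metricE s) (pd_scale_lift i Vx) (pd_scale_lift j Vx).
apply: lor_scale_alg; first exact: s_null.
  exact: (lor_lift_pd Vo).
exact: (lor_lift_pd Vo).
Qed.

Lemma tension_scale_lift x : V x -> exists a b c,
  tension s' x = a *: s x + b *: pd 0 s x + c *: pd 1 s x + f x ^+ 3 *: tension s x.
Proof.
move=> Vx; do 3 eexists; exact: (tension_scale_alg
  (metric_scale_lift 0 0 Vx) (metric_scale_lift 0 1 Vx) (metric_scale_lift 1 1 Vx)
  (pd2_scale_lift 0 0 Vx) (pd2_scale_lift 0 1 Vx)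
  (pd2_scale_lift 1 0 Vx) (pd2_scale_lift 1 1 Vx)).
Qed.

Lemma Jmx_scale_lift x : V x -> f x != 0 -> Jmx (metric s' x) = Jmx (metric s x).
Proof.
move=> Vx f0.
have dE : \det (metric s' x) = (f x ^+ 2) ^+ 2 * \det (metric s x).
  rewrite !det_metric; exact: (det_scale_alg (metric_scale_lift 0 0 Vx)
    (metric_scale_lift 0 1 Vx) (metric_scale_lift 1 1 Vx)).
have vE : Num.sqrt (\det (metric s' x)) = f x ^+ 2 * Num.sqrt (\det (metric s x)).
  by rewrite dE sqrtrM ?sqr_ge0 // sqrtr_sqr ger0_norm ?sqr_ge0.
have ME i j : metric s' x i j = f x ^+ 2 * metric s x i j.
  exact: metric_scale_lift.
exact: Jmx_scale (expf_neq0 2 f0) vE ME.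
Qed.

End ScaleLift.

(** * Lifts on neighbourhoods and the conformal structure *)

Section Surface.
Variables (R : realType) (n : nat) (U : set 'rV[R]_2).
Local Notation C := R[i].
Local Notation P := 'rV[R]_2.
Local Notation rvec := 'cV[R]_n.+2.
Local Notation cvec := 'cV[C]_n.+2.
Variable L : P -> {vspace rvec}.

(** Unlike [is_lift], this names the open set, so that one lift serves at all its points and can be
    differentiated there. *)
Definition lift_on (W : set P) (s : P -> rvec) :=
  [/\ open W, W `<=` U, smooth W s &
    forall y, W y -> s y != 0 /\ L y = <[s y]>%VS].

Hypothesis HL : is_surface U L.
Let Uo : open U. Proof. by case: HL. Qed.

Lemma lift_on_is_lift W s y : lift_on W s -> W y -> is_lift L y s.
Proof. by case=> Wo _ sW H Wy; exists W; split. Qed.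

Lemma is_lift_lift_on x s : is_lift L x s -> U x -> exists2 W, lift_on W s & W x.
Proof.
move=> [V [Vo Vx sV H]] Ux; exists (V `&` U) => //; split.
- exact: openI.
- by move=> y [].
- by apply: smooth_sub sV => y [].
- by move=> y [Vy _]; exact: H.
Qed.

Lemma lift_on_null W s y : lift_on W s -> W y -> lor (s y) (s y) = 0.
Proof.
move=> [_ WU _ H] Wy; have [_ nullL _] := HL; have [_ LE] := H y Wy.
by apply: (nullL y); [exact: WU|rewrite LE memv_line].
Qed.

Lemma lift_on_ratio W s W' s' x : lift_on W s -> lift_on W' s' -> W x -> W' x ->
  exists (V : set P) (f : P -> R), [/\ open V, V x, V `<=` W `&` W', smooth V f &
    forall y, V y -> f y != 0 /\ s' y = f y *: s y].
Proof.
move=> [Wo WU sW H] [Wo' WU' sW' H'] Wx Wx'.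
(* The ratio of the lifts is read off from a coordinate in which s does not vanish at x, hence
   nowhere near x. *)
have [k sk] : exists k, s x k 0 != 0.
  have [s0 _] := H x Wx; apply/existsP; apply: contraNT s0 => /existsPn E.
  apply/eqP/colP => k; rewrite mxE; apply/eqP.
  by have := E k; rewrite negbK.
have ck : {for x, continuous (fun y => s y k 0)}.
  apply: differentiable_continuous.
  exact: (smooth_diff ((smooth_coordP Wo s).1 sW k 0) Wx).
have nb : \forall y \near x, (W `&` W') y /\ s y k 0 != 0.
  near=> y; split; first by split; near: y; apply: open_nbhs_nbhs; split.
  near: y; have /cvgr_neq0 := ck; exact.
(* An interior, hence open by construction. *)
exists [set y | nbhs y (fun z => (W `&` W') z /\ s z k 0 != 0)]%classic.
set V := [set y | _]%classic.
have Vo : open V by exact: open_interior.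
have VE y : V y -> (W `&` W') y /\ s y k 0 != 0 by exact: nbhs_singleton.
exists (fun y => s' y k 0 * (s y k 0)^-1); split => //.
- by move=> y /VE[].
- apply: (smoothM Vo).
    apply: (smooth_sub (W := W')); last exact: ((smooth_coordP Wo' s').1 sW' k 0).
    by move=> y /VE[[]].
  apply: (smoothV Vo); first by move=> y /VE[].
  apply: (smooth_sub (W := W)); last exact: ((smooth_coordP Wo s).1 sW k 0).
  by move=> y /VE[[]].
- move=> y /VE[[Wy Wy'] yk].
  have [s0 LE] := H y Wy; have [s0' LE'] := H' y Wy'.
  have : s' y \in <[s y]>%VS by rewrite -LE LE' memv_line.
  move=> /vlineP[c cE].
  have -> : s' y k 0 * (s y k 0)^-1 = c by rewrite cE mxE mulfK.
  split => //; apply: contraNneq s0' => c0.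
  by rewrite cE c0 scale0r.
Unshelve. all: by end_near. Qed.

(** The immersion hypothesis provides one good lift at each point; for any other lift the
    determinant changes by the fourth power of the nonzero ratio. *)
Lemma det_metric_gt0 W s y : lift_on W s -> W y -> 0 < \det (metric s y).
Proof.
move=> sW Wy; have Uy : U y by case: sW => _ + _ _; apply.
have [_ _ /(_ y Uy)[s' ls' fr]] := HL.
have [W' sW' Wy'] := is_lift_lift_on ls' Uy.
have [V [f [Vo Vy VW fV fE]]] := lift_on_ratio sW sW' Wy Wy'.
have [Wo _ sWs _] := sW; have [Wo' _ sWs' H'] := sW'.
have ssV : smooth V s by apply: smooth_sub sWs => z /VW[].
have nullV z : V z -> lor (s z) (s z) = 0.
  by move=> /VW[Wz _]; exact: lift_on_null sW Wz.
have sE z : V z -> s' z = f z *: s z by move=> /fE[].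
have dE : \det (metric s' y) = (f y ^+ 2) ^+ 2 * \det (metric s y).
  rewrite !det_metric; exact: (det_scale_alg
    (metric_scale_lift Vo ssV nullV fV sE 0 0 Vy)
    (metric_scale_lift Vo ssV nullV fV sE 0 1 Vy)
    (metric_scale_lift Vo ssV nullV fV sE 1 1 Vy)).
have null' z : W' z -> lor (s' z) (s' z) = 0 by exact: lift_on_null sW'.
have pos : 0 < \det (metric s' y).
  rewrite det_metric !metricE; apply: (gram2_gt0 (s := s' y)) => //.
  - by have [] := H' y Wy'.
  - exact: null'.
  - exact: (lor_lift_pd Wo' sWs' null').
  - exact: (lor_lift_pd Wo' sWs' null').
have f0 : 0 < (f y ^+ 2) ^+ 2.
  by have [f0 _] := fE y Vy; rewrite exprn_even_gt0 //= expf_neq0.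
by rewrite dE pmulr_rgt0 in pos.
Qed.

Lemma local_lift_on x : U x -> exists2 W, lift_on W (local_lift L x) & W x.
Proof.
move=> Ux; apply: is_lift_lift_on => //.
have [_ _ /(_ x Ux)[s' ls' _]] := HL.
exact: (xgetPex (fun=> 0) (ex_intro _ s' ls')).
Qed.

(** The lifts selected by [local_lift] at different points are unrelated. Conformal invariance of J
    allows a single s on all of W, which the smoothness of [cstruct] requires. *)
Lemma cstruct_lift W s x : lift_on W s -> W x -> cstruct L x = Jmx (metric s x).
Proof.
move=> sW Wx; have Ux : U x by case: sW => _ + _ _; apply.
have [W' lW' Wx'] := local_lift_on Ux.
have [V [f [Vo Vx VW fV fE]]] := lift_on_ratio sW lW' Wx Wx'.
have [_ _ sWs _] := sW.
have ssV : smooth V s by apply: smooth_sub sWs => z /VW[].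
have nullV z : V z -> lor (s z) (s z) = 0.
  by move=> /VW[Wz _]; exact: lift_on_null sW Wz.
apply: (Jmx_scale_lift Vo ssV nullV fV _ Vx); last by have [] := fE x Vx.
by move=> z /fE[].
Qed.

End Surface.

Lemma half_sub_add (K : numFieldType) (V : lmodType K) (A B : V) :
  2^-1 *: (A - B) + 2^-1 *: (A + B) = A.
Proof.
rewrite -scalerDr addrACA addNr addr0 -[A in A + _]scale1r -{2}[A]scale1r -scalerDl scalerA mulVf ?scale1r //.
Qed.

Section Spans.
Variables (K : fieldType) (V : vectType K).
Implicit Types (a b c d : V) (W : {vspace V}).

Lemma span3_subv a b c W : a \in W -> b \in W -> c \in W ->
  (<<[:: a; b; c]>> <= W)%VS.
Proof.
by move=> aW bW cW; apply/span_subvP => v; rewrite !inE => /or3P[] /eqP ->.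
Qed.

Lemma span4_subv a b c d W : a \in W -> b \in W -> c \in W -> d \in W ->
  (<<[:: a; b; c; d]>> <= W)%VS.
Proof.
by move=> aW bW cW dW; apply/span_subvP => v; rewrite !inE => /or4P[] /eqP ->.
Qed.

Lemma subv_antisym (W W' : {vspace V}) : (W <= W')%VS -> (W' <= W)%VS -> W = W'.
Proof. by move=> h h'; apply: subv_anti; rewrite h h'. Qed.

Lemma mem_span3 a b c : let S := <<[:: a; b; c]>>%VS in
  [/\ a \in S, b \in S & c \in S].
Proof. by split; apply: memv_span; rewrite !inE eqxx ?orbT. Qed.

Lemma mem_span4_gen a b c d : let S := <<[:: a; b; c; d]>>%VS in
  [/\ a \in S, b \in S, c \in S & d \in S].
Proof. by split; apply: memv_span; rewrite !inE eqxx ?orbT. Qed.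

End Spans.

Lemma cplx_lin2 (R : realType) m (k l : R) (A B : 'cV[R]_m) :
  cplx (k *: A + l *: B) = k%:C *: cplx A + l%:C *: cplx B.
Proof. by rewrite cplxD !cplxZ. Qed.

Lemma cplx_lin4 (R : realType) m (k0 k1 k2 k3 : R) (A0 A1 A2 A3 : 'cV[R]_m) :
  cplx (k0 *: A0 + k1 *: A1 + k2 *: A2 + k3 *: A3) =
  k0%:C *: cplx A0 + k1%:C *: cplx A1 + k2%:C *: cplx A2 + k3%:C *: cplx A3.
Proof. by rewrite !cplxD !cplxZ. Qed.

(** * Bundles spanned by a lift *)

Section Bundles.
Variables (R : realType) (n : nat) (U : set 'rV[R]_2).
Local Notation C := R[i].
Local Notation P := 'rV[R]_2.
Local Notation rvec := 'cV[R]_n.+2.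
Local Notation cvec := 'cV[C]_n.+2.
Variable L : P -> {vspace rvec}.
Hypothesis HL : is_surface U L.
Let Uo : open U. Proof. by case: HL. Qed.

Definition frame3 (s : P -> rvec) (x : P) : seq cvec :=
  [:: cplx (s x); cplx (pd 0 s x); cplx (pd 1 s x)].
Definition frame4 (s : P -> rvec) (x : P) : 4.-tuple cvec :=
  [tuple cplx (s x); cplx (pd 0 s x); cplx (pd 1 s x); cplx (tension s x)].

Section Change.
Variables (W W' : set P) (s s' : P -> rvec) (x : P).
Hypotheses (sW : lift_on U L W s) (sW' : lift_on U L W' s').
Hypotheses (Wx : W x) (Wx' : W' x).

Lemma lift_change : exists (k p q a b c : R), [/\ k != 0, s' x = k *: s x,
  pd 0 s' x = p *: s x + k *: pd 0 s x, pd 1 s' x = q *: s x + k *: pd 1 s x &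
  tension s' x = a *: s x + b *: pd 0 s x + c *: pd 1 s x + k ^+ 3 *: tension s x].
Proof.
have [V [f [Vo Vx VW fV fE]]] := lift_on_ratio sW sW' Wx Wx'.
have [_ _ sWs _] := sW.
have ssV : smooth V s by apply: smooth_sub sWs => z /VW[].
have nullV z : V z -> lor (s z) (s z) = 0.
  by move=> /VW[Wz _]; exact: (lift_on_null HL sW Wz).
have sE z : V z -> s' z = f z *: s z by move=> /fE[].
have [f0 _] := fE x Vx.
have [a [b [c tE]]] := tension_scale_lift Vo ssV nullV fV sE Vx.
exists (f x), (pd 0 f x), (pd 1 f x), a, b, c; split => //.
- exact: sE.
- exact: (pd_scale_lift Vo ssV fV sE 0 Vx).
- exact: (pd_scale_lift Vo ssV fV sE 1 Vx).
Qed.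

Lemma span_frame_sub :
  (<<frame3 s' x>> <= <<frame3 s x>>)%VS /\ (<<frame4 s' x>> <= <<frame4 s x>>)%VS.
Proof.
have [k [p [q [a [b [c [_ E E0 E1 ET]]]]]]] := lift_change.
have [m0 m1 m2] := mem_span3 (cplx (s x)) (cplx (pd 0 s x)) (cplx (pd 1 s x)).
have [n0 n1 n2 n3] := mem_span4_gen (cplx (s x)) (cplx (pd 0 s x))
  (cplx (pd 1 s x)) (cplx (tension s x)).
split.
  apply: span3_subv.
  - rewrite E cplxZ; exact: memvZ m0.
  - rewrite E0 cplx_lin2; exact: memvD (memvZ _ m0) (memvZ _ m1).
  - rewrite E1 cplx_lin2; exact: memvD (memvZ _ m0) (memvZ _ m2).
apply: span4_subv.
- rewrite E cplxZ; exact: memvZ n0.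
- rewrite E0 cplx_lin2; exact: memvD (memvZ _ n0) (memvZ _ n1).
- rewrite E1 cplx_lin2; exact: memvD (memvZ _ n0) (memvZ _ n2).
- rewrite ET cplx_lin4; exact: (memvD (memvD (memvD (memvZ _ n0) (memvZ _ n1))
    (memvZ _ n2)) (memvZ _ n3)).
Qed.

End Change.

Lemma span_frame_eq W W' s s' x : lift_on U L W s -> lift_on U L W' s' ->
  W x -> W' x ->
  <<frame3 s' x>>%VS = <<frame3 s x>>%VS /\ <<frame4 s' x>>%VS = <<frame4 s x>>%VS.
Proof.
move=> sW sW' Wx Wx'.
have [a b] := span_frame_sub sW sW' Wx Wx'.
have [c d] := span_frame_sub sW' sW Wx' Wx.
split; [exact: subv_antisym a c|exact: subv_antisym b d].
Qed.

Lemma Lambda0_lift W s x : lift_on U L W s -> W x ->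
  Lambda0 L x = <[cplx (s x)]>%VS.
Proof.
move=> sW Wx; have Ux : U x by case: sW => _ + _ _; apply.
have [W' lW' Wx'] := local_lift_on HL Ux.
have [k [p [q [a [b [c [k0 E _ _ _]]]]]]] := lift_change sW lW' Wx Wx'.
rewrite /Lambda0 E cplxZ; apply/eqP; rewrite eqEsubv -!memvE.
rewrite memvZ ?memv_line //=.
have kC : k%:C != 0 by rewrite (fmorph_eq0 (real_complex R)).
by rewrite -[X in X \in _](scalerK kC) memvZ // memv_line.
Qed.

(** The two type components of ds are combinations of its values, and conversely they add up to
    ds. *)
Lemma Lambda1_local x : Lambda1 L x = <<frame3 (local_lift L x) x>>%VS.
Proof.
set l := local_lift L x.
have [m0 m1 m2] := mem_span3 (cplx (l x)) (cplx (pd 0 l x)) (cplx (pd 1 l x)).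
have md j : dlift L x j x \in <<frame3 l x>>%VS.
  by case: (ord2 j) => ->; [exact: m1|exact: m2].
have mJ j : compJ L (dlift L x) j x \in <<frame3 l x>>%VS.
  by apply: memv_suml => i _; exact: memvZ (md i).
have m10 j : type10 L (dlift L x) j x \in <<frame3 l x>>%VS.
  by apply: memvZ; exact: memvB (md j) (memvZ _ (mJ j)).
have m01 j : type01 L (dlift L x) j x \in <<frame3 l x>>%VS.
  by apply: memvZ; exact: memvD (md j) (memvZ _ (mJ j)).
apply: subv_antisym.
  by rewrite /Lambda1 subv_add; apply/andP; split;
    [exact: span3_subv m0 (m10 0) (m10 1)|exact: span3_subv m0 (m01 0) (m01 1)].
have [a0 a1 a2] := mem_span3 (cplx (l x)) (type10 L (dlift L x) 0 x)
  (type10 L (dlift L x) 1 x).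
have [b0 b1 b2] := mem_span3 (cplx (l x)) (type01 L (dlift L x) 0 x)
  (type01 L (dlift L x) 1 x).
have in1 j : cplx (pd j l x) \in Lambda1 L x.
  rewrite (_ : cplx _ = type10 L (dlift L x) j x + type01 L (dlift L x) j x).
    by case: (ord2 j) => ->; [exact: memv_add a1 b1|exact: memv_add a2 b2].
  exact/esym/half_sub_add.
exact: span3_subv (subvP (addvSl _ _) _ a0) (in1 0) (in1 1).
Qed.

End Bundles.

Lemma cplx_lin3 (R : realType) m (k l p : R) (A B D : 'cV[R]_m) :
  cplx (k *: A + l *: B + p *: D) = k%:C *: cplx A + l%:C *: cplx B + p%:C *: cplx D.
Proof. by rewrite !cplxD !cplxZ. Qed.

Section GramTable.
Variables (K : fieldType) (n : nat) (u a b t : 'cV[K]_n.+2).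
Hypotheses (uu : lor u u = 0) (ua : lor u a = 0) (ub : lor u b = 0).
Hypotheses (ut : lor u t != 0) (ab : lor a a * lor b b - lor a b ^+ 2 != 0).
Variable M : 'M[K]_(n.+2, 4).
Hypothesis MX : forall j : 'I_4, col j M = [tuple u; a; b; t]`_j.

Lemma gram_frame_unit : gram M \in unitmx.
Proof.
apply: (@gram4_unit _ _ (lor u t) (lor a a) (lor a b) (lor b b)
  (lor a t) (lor b t) (lor t t) ut ab) => j k.
rewrite (gramE MX).
have au : lor a u = 0 by rewrite lorC.
have bu : lor b u = 0 by rewrite lorC.
by case: j => [[|[|[|[|//]]]] hj]; case: k => [[|[|[|[|//]]]] hk] /=;
  rewrite ?uu ?ua ?ub ?au ?bu //; exact: lorC.
Qed.

End GramTable.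

(** * The projection onto S and its smoothness *)

Section SphereCongruence.
Variables (R : realType) (n : nat) (U : set 'rV[R]_2).
Local Notation C := R[i].
Local Notation P := 'rV[R]_2.
Local Notation rvec := 'cV[R]_n.+2.
Local Notation cvec := 'cV[C]_n.+2.
Variable L : P -> {vspace rvec}.
Hypothesis HL : is_surface U L.
Let Uo : open U. Proof. by case: HL. Qed.

Lemma csc_local x : U x -> csc L x = <<frame4 (local_lift L x) x>>%VS.
Proof.
move=> Ux; set l := local_lift L x.
have [W lW Wx] := local_lift_on HL Ux.
have [Wo _ lWs _] := lW.
have dpos y : W y -> 0 < \det (metric l y) by exact: (det_metric_gt0 HL lW).
have [a [b E]] := laplacian_tension Wo lWs dpos Wx.
have [m0 m1 m2] := mem_span3 (cplx (l x)) (cplx (pd 0 l x)) (cplx (pd 1 l x)).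
have [n0 n1 n2 n3] := mem_span4_gen (cplx (l x)) (cplx (pd 0 l x))
  (cplx (pd 1 l x)) (cplx (tension l x)).
have lE : cplx (laplacian l x) = a%:C *: cplx (pd 0 l x) + b%:C *: cplx (pd 1 l x)
    + (\det (metric l x))^-1%:C *: cplx (tension l x).
  rewrite E; exact: cplx_lin3.
rewrite /csc -/l Lambda1_local -/l; apply: subv_antisym.
  rewrite subv_add; apply/andP; split; first exact: span3_subv n0 n1 n2.
  rewrite -memvE lE.
  exact: memvD (memvD (memvZ _ n1) (memvZ _ n2)) (memvZ _ n3).
have sub3 v : v \in <<frame3 l x>>%VS ->
    v \in (<<frame3 l x>> + <[cplx (laplacian l x)]>)%VS.
  by move=> vm; exact: subvP (addvSl _ _) _ vm.
have d0 : (\det (metric l x))%:C != 0.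
  by rewrite (fmorph_eq0 (real_complex R)) gt_eqF // dpos.
have tE : cplx (tension l x) = (\det (metric l x))%:C *:
    (cplx (laplacian l x) - (a%:C *: cplx (pd 0 l x) + b%:C *: cplx (pd 1 l x))).
  rewrite lE addrAC subrr add0r scalerA.
  by rewrite (fmorphV (real_complex R)) mulfV // scale1r.
have lm : cplx (laplacian l x) \in (<<frame3 l x>> + <[cplx (laplacian l x)]>)%VS.
  exact: subvP (addvSr _ _) _ (memv_line _).
apply: (span4_subv (sub3 _ m0) (sub3 _ m1) (sub3 _ m2)).
rewrite tE; apply: memvZ.
exact: memvB lm (memvD (memvZ _ (sub3 _ m1)) (memvZ _ (sub3 _ m2))).
Qed.

Section WithLift.
Variables (W : set P) (s : P -> rvec).
Hypothesis sW : lift_on U L W s.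
Let Wo : open W. Proof. by case: sW. Qed.
Let ss : smooth W s. Proof. by case: sW. Qed.
Let snull y (Wy : W y) : lor (s y) (s y) = 0 := lift_on_null HL sW Wy.
Let WU y : W y -> U y. Proof. by case: sW => _ + _ _; apply. Qed.

Lemma Lambda1_lift x : W x -> Lambda1 L x = <<frame3 s x>>%VS.
Proof.
move=> Wx; have [W' lW' Wx'] := local_lift_on HL (WU Wx).
by have [<- _] := span_frame_eq HL sW lW' Wx Wx'; exact: Lambda1_local.
Qed.

Lemma csc_lift x : W x -> csc L x = <<frame4 s x>>%VS.
Proof.
move=> Wx; have [W' lW' Wx'] := local_lift_on HL (WU Wx).
have [_ <-] := span_frame_eq HL sW lW' Wx Wx'; exact: csc_local (WU Wx).
Qed.

(** S has a real frame, so its complex projection is the complexification of a real [frame_proj],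
    whose inverse Gram matrix is smooth by real calculus. *)
Definition rframe (x : P) : 4.-tuple rvec :=
  [tuple s x; pd 0 s x; pd 1 s x; tension s x].
Definition rframe_mx (x : P) : 'M[R]_(n.+2, 4) :=
  \matrix_(i, j) (rframe x)`_j i 0.

Let col_rframe x (j : 'I_4) : col j (rframe_mx x) = (rframe x)`_j.
Proof. by apply/colP => i; rewrite !mxE. Qed.

Let gram_unit x : W x -> gram (rframe_mx x) \in unitmx.
Proof.
move=> Wx; apply: (gram_frame_unit (snull Wx) _ _ _ _ (col_rframe x)).
- exact: (lor_lift_pd Wo ss snull).
- exact: (lor_lift_pd Wo ss snull).
- rewrite (lor_lift_tension Wo ss snull Wx); apply: mulf_neq0.
    by rewrite oppr_eq0 pnatr_eq0.
  exact: lt0r_neq0 (det_metric_gt0 HL sW Wx).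
- have := lt0r_neq0 (det_metric_gt0 HL sW Wx).
  by rewrite det_metric (metricE s x 0 0) (metricE s x 1 1) (metricE s x 0 1).
Qed.

Let col_frame4 x (j : 'I_4) : col j (cplx (rframe_mx x)) = (frame4 s x)`_j.
Proof.
have -> : (frame4 s x)`_j = cplx (rframe x)`_j.
  by case: j => [[|[|[|[|//]]]] hj].
by rewrite -col_rframe; apply/colP => i; rewrite !mxE.
Qed.

Lemma frame_proj_cplx x : frame_proj (cplx (rframe_mx x)) =
  cplx (frame_proj (rframe_mx x)).
Proof.
by rewrite /frame_proj /gram -cplx_eta -cplxT -!cplxM /cplx -map_invmx -!cplxM.
Qed.

Lemma projS_lift_spec x : W x -> forall w,
  cplx (frame_proj (rframe_mx x)) *m w \in csc L x /\
  lorthogonal (csc L x) (w - cplx (frame_proj (rframe_mx x)) *m w).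
Proof.
move=> Wx w; rewrite (csc_lift Wx) -frame_proj_cplx.
apply: (frame_projP (col_frame4 x)).
rewrite /gram -cplx_eta -cplxT -!cplxM /cplx map_unitmx.
exact: gram_unit.
Qed.

Lemma projS_lift x : W x -> projS L x = cplx (frame_proj (rframe_mx x)).
Proof. by move=> Wx; apply: orth_projP; exact: projS_lift_spec. Qed.

Let coordS (f : P -> rvec) i : smooth W f -> smooth W (fun y => f y i 0).
Proof. by move=> /(smooth_coordP Wo); apply. Qed.

Lemma smooth_rframe_mx i j : smooth W (fun y => rframe_mx y i j).
Proof.
have E (f : P -> rvec) : (forall y, (rframe y)`_j = f y) -> smooth W f ->
    smooth W (fun y => rframe_mx y i j).
  move=> fE sf; apply: (eq_smooth Wo _ (coordS i sf)) => y _.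
  by rewrite mxE fE.
case: j E => [[|[|[|[|//]]]] hj] E.
- exact: (E s (fun=> erefl) ss).
- exact: (E (pd 0 s) (fun=> erefl) (smooth_pd 0 ss)).
- exact: (E (pd 1 s) (fun=> erefl) (smooth_pd 1 ss)).
- exact: (E (tension s) (fun=> erefl) (smooth_tension Wo ss)).
Qed.

Let mulS a b c (F : P -> 'M[R]_(a, b)) (G : P -> 'M[R]_(b, c)) :
  (forall i j, smooth W (fun y => F y i j)) ->
  (forall i j, smooth W (fun y => G y i j)) ->
  forall i j, smooth W (fun y => (F y *m G y) i j).
Proof.
move=> sF sG i j; apply: (eq_smooth Wo _ (smooth_sum Wo (index_enum 'I_b) (Q := predT) _)).
  move=> y _; rewrite mxE; apply: eq_bigr => k _; reflexivity.
by move=> k _; exact: (smoothM Wo).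
Qed.

Lemma smooth_frame_proj : smooth W (fun y => frame_proj (rframe_mx y)).
Proof.
apply/(smooth_coordP Wo).
have sT i j : smooth W (fun y => (rframe_mx y)^T i j).
  by apply: (eq_smooth Wo _ (smooth_rframe_mx j i)) => y _; rewrite [RHS]mxE.
have sE i j : smooth W (fun _ : P => eta R n i j) by exact: (smooth_cst Wo).
have sG : forall i j, smooth W (fun y => gram (rframe_mx y) i j).
  exact: (mulS (mulS sT sE) smooth_rframe_mx).
have sI := smooth_invmx Wo sG gram_unit.
exact: (mulS (mulS (mulS smooth_rframe_mx sI) sT) sE).
Qed.

End WithLift.

(** [smooth] is a condition at each point separately, so it may be checked on a neighbourhood
    carrying a lift. *)
Lemma csmooth_projS : csmooth U (projS L).
Proof.
have H x : U x -> exists2 W : set P, open W /\ W x & csmooth W (projS L).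
  move=> Ux; have [W lW Wx] := local_lift_on HL Ux.
  have [Wo _ _ _] := lW; exists W => //.
  apply: (eq_csmooth Wo _ (csmooth_cplx Wo (smooth_frame_proj lW))) => y Wy.
  by rewrite (projS_lift lW Wy).
split=> k x Ux; have [W [_ Wx] [s1 s2]] := H x Ux; [exact: s1|exact: s2].
Qed.

Lemma projS_spec x : U x -> forall w, projS L x *m w \in csc L x /\
  lorthogonal (csc L x) (w - projS L x *m w).
Proof.
move=> Ux w; have [W lW Wx] := local_lift_on HL Ux.
by rewrite (projS_lift lW Wx); exact: (projS_lift_spec lW Wx w).
Qed.

Lemma projS_idem x : U x -> projS L x *m projS L x = projS L x.
Proof.
move=> Ux; apply: eq_mulmx_col => w; rewrite -mulmxA.
have [wS _] := projS_spec Ux w; exact: orth_proj_id (projS_spec Ux) wS.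
Qed.

Lemma smooth_cstruct i j : smooth U (fun y => cstruct L y i j).
Proof.
move=> k x Ux; have [W lW Wx] := local_lift_on HL Ux.
have [Wo _ ls _] := lW.
set l := local_lift L x in lW ls *.
suff sJ : smooth W (fun y => cstruct L y i j) by exact: sJ.
have dpos y : W y -> 0 < \det (metric l y) by exact: (det_metric_gt0 HL lW).
have sv := smooth_sqrt Wo dpos (smooth_det_metric Wo ls).
have iv : smooth W (fun y => (Num.sqrt (\det (metric l y)))^-1).
  by apply: (smoothV Wo) sv => y Wy; rewrite gt_eqF // sqrtr_gt0 dpos.
have sM : smooth W (fun y => if i == 0 then - metric l y 1 j else metric l y 0 j).
  by case: (i == 0); [apply: (smoothN Wo)|]; exact: (smooth_metric Wo ls).
apply: (eq_smooth Wo _ (smoothM Wo iv sM)) => y Wy.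
by rewrite (cstruct_lift HL lW Wy) JmxE.
Qed.

Lemma cstruct_tr x : U x -> cstruct L x 1 1 = - cstruct L x 0 0.
Proof.
move=> Ux; have [W lW Wx] := local_lift_on HL Ux.
rewrite (cstruct_lift HL lW Wx) (JmxE _ 1 1) (JmxE _ 0 0) /= mulrN opprK.
by rewrite (metricC _ x 1 0).
Qed.

Lemma cstruct_det x : U x ->
  - cstruct L x 0 0 ^+ 2 - cstruct L x 0 1 * cstruct L x 1 0 = 1.
Proof.
move=> Ux; have [W lW Wx] := local_lift_on HL Ux.
have dpos := det_metric_gt0 HL lW Wx.
rewrite (cstruct_lift HL lW Wx) !JmxE /= (metricC _ x 1 0).
have := det_metric (local_lift L x) x.
move: (metric _ x 0 0) (metric _ x 0 1) (metric _ x 1 1) => e f g dE.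
set v := Num.sqrt _.
have v2 : v ^+ 2 = e * g - f ^+ 2 by rewrite -dE sqr_sqrtr // ltW.
have v0 : v != 0 by rewrite gt_eqF // sqrtr_gt0.
have -> : - (v^-1 * - f) ^+ 2 - v^-1 * - g * (v^-1 * e) = (e * g - f ^+ 2) / v ^+ 2.
  by field.
by rewrite -v2 mulfV // expf_neq0.
Qed.

End SphereCongruence.

Lemma lor_isometry_mx (K : fieldType) n (A : 'M[K]_n.+2) :
  (forall u v, lor (A *m u) (A *m v) = lor u v) -> A^T *m eta K n *m A = eta K n.
Proof.
move=> H; have E (u v : 'cV[K]_n.+2) : u^T *m (A^T *m eta K n *m A) *m v = u^T *m eta K n *m v.
  apply/matrixP => i j; rewrite (ord1 i) (ord1 j).
  by have := H u v; rewrite /lor trmx_mul !mulmxA.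
apply: eq_mulmx_col => v; apply: trmx_inj; apply: eq_mulmx_col => u.
apply: trmx_inj; rewrite !trmx_mul !trmxK.
have := E u v; rewrite -!mulmxA => ->.
by [].
Qed.

Lemma unimodular_neq0 (R : realType) (mu : R[i]) : `|mu| = 1 -> mu != 0.
Proof. by move=> hmu; rewrite -normr_eq0 hmu oner_neq0. Qed.

(** * The spectral deformation *)

(* For m = exp (i t), (m + m^-1) / 2 = cos t and j (m - m^-1) / 2 = - sin t with
   j = i; the identities below are the addition formulas. *)
Section UnimodularAlg.
Variables (K : numFieldType) (j : K).
Hypothesis jj : j * j = -1.

Lemma cos_sin_sqr (m : K) : m != 0 ->
  ((m + m^-1) / 2) ^+ 2 + (j * (m - m^-1) / 2) ^+ 2 = 1.
Proof.
move=> m0; have -> : (j * (m - m^-1) / 2) ^+ 2 = (j * j) * ((m - m^-1) / 2) ^+ 2 by ring.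
by rewrite jj; field.
Qed.

Lemma cos_double (m : K) : m != 0 ->
  (m ^+ 2 - 1 + (m ^- 2 - 1)) / 2 =
  ((m + m^-1) / 2) ^+ 2 - (j * (m - m^-1) / 2) ^+ 2 - 1.
Proof.
move=> m0; have -> : (j * (m - m^-1) / 2) ^+ 2 = (j * j) * ((m - m^-1) / 2) ^+ 2 by ring.
by rewrite jj; field.
Qed.

Lemma cos_sqr (m : K) : m != 0 -> (m ^+ 2 + m ^- 2) / 2 =
  ((m + m^-1) / 2) ^+ 2 - (j * (m - m^-1) / 2) ^+ 2.
Proof.
move=> m0; have -> : (j * (m - m^-1) / 2) ^+ 2 = (j * j) * ((m - m^-1) / 2) ^+ 2 by ring.
by rewrite jj; field.
Qed.

Lemma sin_sqr (m : K) : m != 0 -> j * (m ^+ 2 - m ^- 2) / 2 =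
  2 * ((m + m^-1) / 2 * (j * (m - m^-1) / 2)).
Proof. by move=> m0; field. Qed.

Lemma sin_double (m : K) : m != 0 ->
  j * (m ^+ 2 - 1 - (m ^- 2 - 1)) / 2 =
  2 * ((m + m^-1) / 2 * (j * (m - m^-1) / 2)).
Proof. by move=> m0; field. Qed.

Lemma cos_add (m l : K) : m != 0 -> l != 0 ->
  (l + l^-1) / 2 * ((m + m^-1) / 2) - j * (l - l^-1) / 2 * (j * (m - m^-1) / 2)
  = (m * l + (m * l)^-1) / 2.
Proof.
move=> m0 l0; have -> : j * (l - l^-1) / 2 * (j * (m - m^-1) / 2) =
  (j * j) * ((l - l^-1) / 2 * ((m - m^-1) / 2)) by ring.
by rewrite jj; field; rewrite m0 l0.
Qed.

Lemma sin_add (m l : K) : m != 0 -> l != 0 ->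
  (l + l^-1) / 2 * (j * (m - m^-1) / 2) + j * (l - l^-1) / 2 * ((m + m^-1) / 2)
  = j * (m * l - (m * l)^-1) / 2.
Proof. by move=> m0 l0; field; rewrite m0 l0. Qed.

Lemma cos_add2 (m l : K) : m != 0 -> l != 0 ->
  let c := ((m + m^-1) / 2) ^+ 2 - (j * (m - m^-1) / 2) ^+ 2 in
  let s := 2 * ((m + m^-1) / 2 * (j * (m - m^-1) / 2)) in
  (l ^+ 2 - 1 + (l ^- 2 - 1)) / 2 * c - j * (l ^+ 2 - 1 - (l ^- 2 - 1)) / 2 * s + c - 1 =
  ((m * l) ^+ 2 - 1 + ((m * l) ^- 2 - 1)) / 2.
Proof.
move=> m0 l0 c s.
have -> : c = (m ^+ 2 + m ^- 2) / 2.
  rewrite /c; have -> : (j * (m - m^-1) / 2) ^+ 2 = (j * j) * ((m - m^-1) / 2) ^+ 2 by ring.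
  by rewrite jj; field.
have -> : j * (l ^+ 2 - 1 - (l ^- 2 - 1)) / 2 * s =
  (j * j) * ((l ^+ 2 - l ^- 2) / 2 * ((m ^+ 2 - m ^- 2) / 2)).
  by rewrite /s; field; rewrite m0 l0.
by rewrite jj; field; rewrite m0 l0.
Qed.

Lemma sin_add2 (m l : K) : m != 0 -> l != 0 ->
  let c := ((m + m^-1) / 2) ^+ 2 - (j * (m - m^-1) / 2) ^+ 2 in
  let s := 2 * ((m + m^-1) / 2 * (j * (m - m^-1) / 2)) in
  (l ^+ 2 - 1 + (l ^- 2 - 1)) / 2 * s + j * (l ^+ 2 - 1 - (l ^- 2 - 1)) / 2 * c + s =
  j * ((m * l) ^+ 2 - 1 - ((m * l) ^- 2 - 1)) / 2.
Proof.
move=> m0 l0 c s.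
have -> : c = (m ^+ 2 + m ^- 2) / 2.
  rewrite /c; have -> : (j * (m - m^-1) / 2) ^+ 2 = (j * j) * ((m - m^-1) / 2) ^+ 2 by ring.
  by rewrite jj; field.
by rewrite /s; field; rewrite m0 l0.
Qed.
End UnimodularAlg.

(** * Pointwise algebra of phi^-1 dphi on the frame of a lift *)

Section NullFrame.
Variables (K : fieldType) (n : nat).
Local Notation vec := 'cV[K]_n.+2.
Local Notation mat := 'M[K]_n.+2.

(** As a and b are orthogonal to s, a wedge of s with v sends each of them to a multiple of s. *)
Lemma wedge_contract (s a b v0 v1 : vec) (e f g : K) :
  lor s a = 0 -> lor s b = 0 -> exists k,
  g *: (wedge s v0 *m a) - f *: (wedge s v0 *m b)
  - f *: (wedge s v1 *m a) + e *: (wedge s v1 *m b) = k *: s.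
Proof.
move=> sa sb; rewrite !wedge_null_line //.
exists (- (g * lor v0 a - f * lor v0 b - f * lor v1 a + e * lor v1 b)).
by apply/colP => l; rewrite ?(addmxE, oppmxE, scalemxE); ring.
Qed.

Lemma form_contract (a b c s e f g : K) (N0 N1 H0 H1 q0 q1 r0 r1 : mat) (x y : vec) :
  let A0 := - N0 + (a *: N0 + b *: H0) + (c *: q0 + s *: r0) in
  let A1 := - N1 + (a *: N1 + b *: H1) + (c *: q1 + s *: r1) in
  let Z (B0 B1 : mat) := g *: (B0 *m x) - f *: (B0 *m y) - f *: (B1 *m x) + e *: (B1 *m y) in
  Z A0 A1 = (a - 1) *: Z N0 N1 + b *: Z H0 H1 + c *: Z q0 q1 + s *: Z r0 r1.
Proof. by move=> A0 A1 Z; rewrite /Z /A0 /A1; mx_ring. Qed.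

Lemma form_contract_line (a b c s e f g k0 k1 : K)
    (N0 N1 H0 H1 q0 q1 r0 r1 : mat) (x y u : vec) :
  g *: (N0 *m x) - f *: (N0 *m y) - f *: (N1 *m x) + e *: (N1 *m y) = 0 ->
  g *: (H0 *m x) - f *: (H0 *m y) - f *: (H1 *m x) + e *: (H1 *m y) = 0 ->
  g *: (q0 *m x) - f *: (q0 *m y) - f *: (q1 *m x) + e *: (q1 *m y) = k0 *: u ->
  g *: (r0 *m x) - f *: (r0 *m y) - f *: (r1 *m x) + e *: (r1 *m y) = k1 *: u ->
  g *: ((- N0 + (a *: N0 + b *: H0) + (c *: q0 + s *: r0)) *m x)
  - f *: ((- N0 + (a *: N0 + b *: H0) + (c *: q0 + s *: r0)) *m y)
  - f *: ((- N1 + (a *: N1 + b *: H1) + (c *: q1 + s *: r1)) *m x)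
  + e *: ((- N1 + (a *: N1 + b *: H1) + (c *: q1 + s *: r1)) *m y) =
  (c * k0 + s * k1) *: u.
Proof.
move=> hN hH hq hr; apply: etrans (form_contract _ _ _ _ _ _ _ _ _ _ _ _ _ _ _ _ _) _.
by rewrite hN hH hq hr !scaler0 !add0r !scalerA scalerDl.
Qed.

Lemma form_kill (a b c s : K) (N H q r : mat) (x : vec) :
  N *m x = 0 -> H *m x = 0 -> q *m x = 0 -> r *m x = 0 ->
  (- N + (a *: N + b *: H) + (c *: q + s *: r)) *m x = 0.
Proof.
move=> hN hH hq hr; rewrite !mulmxDl mulNmx -!scalemxAl hN hH hq hr.
by rewrite !scaler0 oppr0 !addr0.
Qed.

(** With the components of J inserted, the metric trace of the dual of N is v (e g - f^2) (N_0 y -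
    N_1 x). *)
Lemma star_contract (v e f g : K) (N0 N1 : mat) (x y : vec) :
  N1 *m x = N0 *m y ->
  g *: ((- ((v * - f) *: N0 + (v * e) *: N1)) *m x)
  - f *: ((- ((v * - f) *: N0 + (v * e) *: N1)) *m y)
  - f *: ((- ((v * - g) *: N0 + (v * f) *: N1)) *m x)
  + e *: ((- ((v * - g) *: N0 + (v * f) *: N1)) *m y) = 0.
Proof.
move=> h; do 6? mx_expand; rewrite h.
by apply/matrixP => ? ?; rewrite ?(addmxE, oppmxE, scalemxE, zeromxE); ring.
Qed.

(** The y's are the normal parts of the second derivatives, so their metric trace is the normal part
    of the tension, zero because the tension lies in S. This is the mean curvature property that
    singles out the central sphere congruence. *)
Lemma tension_contract (e f g : K) (Pr : mat)
    (x00 x01 x10 x11 y00 y01 y10 y11 : vec) :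
  y00 = x00 - Pr *m x00 -> y01 = x01 - Pr *m x01 ->
  y10 = x10 - Pr *m x10 -> y11 = x11 - Pr *m x11 ->
  Pr *m (g *: x00 - f *: x01 - f *: x10 + e *: x11) =
    g *: x00 - f *: x01 - f *: x10 + e *: x11 ->
  g *: y00 - f *: y01 - f *: y10 + e *: y11 = 0.
Proof.
move=> -> -> -> -> h; apply/eqP; rewrite -[X in _ == X](subrr (g *: x00 - f *: x01 - f *: x10 + e *: x11)).
by rewrite -[X in _ == _ - X]h; apply/eqP; mx_ring.
Qed.

Lemma tension_gauge (Phi A0 A1 : mat) (e f g k : K) (s a b s00 s01 s10 s11
    t00 t01 t10 t11 : vec) :
  g *: (A0 *m a) - f *: (A0 *m b) - f *: (A1 *m a) + e *: (A1 *m b) = k *: s ->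
  t00 = Phi *m A0 *m a + Phi *m s00 -> t01 = Phi *m A0 *m b + Phi *m s01 ->
  t10 = Phi *m A1 *m a + Phi *m s10 -> t11 = Phi *m A1 *m b + Phi *m s11 ->
  g *: t00 - f *: t01 - f *: t10 + e *: t11 =
  Phi *m (g *: s00 - f *: s01 - f *: s10 + e *: s11) + k *: (Phi *m s).
Proof.
move=> h -> -> -> ->; rewrite scalemxAr -h; mx_ring.
Qed.

End NullFrame.

Lemma refl_mul (K : fieldType) m (Q P0 : 'M[K]_m) (v : 'cV[K]_m) :
  P0 *m v = v -> Q *m (2 *: P0 - 1%:M) *m v = Q *m v.
Proof.
move=> Pv; rewrite -mulmxA mulmxBl -scalemxAl Pv mul1mx.
by congr (_ *m _); apply/colP => l; rewrite ?(addmxE, oppmxE, scalemxE); ring.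
Qed.

Lemma refl_conj (K : fieldType) m (P0 q : 'M[K]_m) :
  P0 *m q = q -> q *m P0 = q ->
  (2 *: P0 - 1%:M) *m q *m (2 *: P0 - 1%:M) = q.
Proof.
move=> Pq qP; have -> : (2 *: P0 - 1%:M) *m q = q.
  rewrite mulmxBl -scalemxAl Pq mul1mx.
  by apply/matrixP => ? ?; rewrite ?(addmxE, oppmxE, scalemxE); ring.
rewrite mulmxBr -scalemxAr qP mulmx1.
by apply/matrixP => ? ?; rewrite ?(addmxE, oppmxE, scalemxE); ring.
Qed.

Lemma span3_orth (K : fieldType) n (a b c z v : 'cV[K]_n.+2) :
  lor z a = 0 -> lor z b = 0 -> lor z c = 0 -> v \in <<[:: a; b; c]>>%VS ->
  lor v z = 0.
Proof.
move=> ha hb hc; rewrite !span_cons span_nil addv0.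
move=> /memv_addP[_ /vlineP[k0 ->]] [_ /memv_addP[_ /vlineP[k1 ->]]
  [_ /vlineP[k2 ->] ->] ->].
by rewrite lorC !lorDr !lorZr ha hb hc !mulr0 !addr0.
Qed.

(** * N and the multiplier on the frame of a lift *)

Section FrameFacts.
Variables (R : realType) (n : nat) (U : set 'rV[R]_2).
Local Notation C := R[i].
Local Notation P := 'rV[R]_2.
Local Notation rvec := 'cV[R]_n.+2.
Local Notation cvec := 'cV[C]_n.+2.
Local Notation cend := 'M[C]_n.+2.
Variable L : P -> {vspace rvec}.
Hypothesis HL : is_surface U L.
Variables (W : set P) (s : P -> rvec).
Hypothesis sW : lift_on U L W s.
Let Uo : open U. Proof. by case: HL. Qed.
Let Wo : open W. Proof. by case: sW. Qed.
Let ss : smooth W s. Proof. by case: sW. Qed.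
Let snull y (Wy : W y) : lor (s y) (s y) = 0 := lift_on_null HL sW Wy.
Let WU y : W y -> U y. Proof. by case: sW => _ + _ _; apply. Qed.
Let PsW : csmooth W (projS L).
Proof.
have [h1 h2] := csmooth_projS HL.
by split; [apply: smooth_sub h1|apply: smooth_sub h2] => y; exact: WU.
Qed.

Lemma frame4_mem x : W x -> [/\ cplx (s x) \in csc L x,
  cplx (pd 0 s x) \in csc L x, cplx (pd 1 s x) \in csc L x &
  cplx (tension s x) \in csc L x].
Proof.
move=> Wx; rewrite (csc_lift HL sW Wx); exact: mem_span4_gen.
Qed.

Lemma projS_csc x v : U x -> v \in csc L x -> projS L x *m v = v.
Proof. move=> Ux vm; exact: orth_proj_id (projS_spec HL Ux) vm. Qed.

Let Ps x : W x -> projS L x *m cplx (s x) = cplx (s x).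
Proof. by move=> Wx; have [h _ _ _] := frame4_mem Wx; exact: projS_csc (WU Wx) h. Qed.

Let Psj j x : W x -> projS L x *m cplx (pd j s x) = cplx (pd j s x).
Proof.
move=> Wx; have [_ h0 h1 _] := frame4_mem Wx.
by case: (ord2 j) => ->; [exact: projS_csc (WU Wx) h0|exact: projS_csc (WU Wx) h1].
Qed.

(** Differentiate P f = f. On sections of S, N therefore returns the normal part of the derivative;
    it kills s because ds lies in S. *)
Let dP (f : P -> rvec) i x : smooth W f ->
  (forall y, W y -> projS L y *m cplx (f y) = cplx (f y)) -> W x ->
  cpd i (projS L) x *m cplx (f x) = cplx (pd i f x) - projS L x *m cplx (pd i f x).
Proof.
move=> sf Pf Wx; have sc := csmooth_cplx Wo sf.
have E : cplx (pd i f x) = cpd i (projS L) x *m cplx (f x) +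
    projS L x *m cplx (pd i f x).
  apply: etrans (esym (cpd_cplx i f x)) _.
  transitivity (cpd i (fun y => projS L y *m cplx (f y)) x).
    by apply: (eq_cpd Wo) => // y Wy; rewrite Pf.
  apply: etrans (cpdM Wo i PsW sc Wx) _; congr (_ + _ *m _).
  exact: cpd_cplx.
by rewrite {1}E addrK.
Qed.

Let NE i x (v : cvec) : W x -> projS L x *m v = v ->
  calN L i x *m v = cpd i (projS L) x *m v.
Proof.
move=> Wx Pv.
rewrite (calN_E Uo (csmooth_projS HL) (fun y => @projS_idem _ _ _ _ HL y) i (WU Wx)).
exact: refl_mul.
Qed.

Lemma calN_lift i x : W x -> calN L i x *m cplx (s x) = 0.
Proof.
move=> Wx; rewrite (NE i Wx (Ps Wx)) (dP i ss Ps Wx) (Psj i Wx).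
exact: subrr.
Qed.

Lemma calN_lift_pd i j x : W x -> calN L i x *m cplx (pd j s x) =
  cplx (pd i (pd j s) x) - projS L x *m cplx (pd i (pd j s) x).
Proof.
move=> Wx; rewrite (NE i Wx (Psj j Wx)).
exact: (dP i (smooth_pd j ss) (fun y => @Psj j y) Wx).
Qed.

Lemma hodge_kill (w : mform R n.+1 n.+1) (v : cvec) j x :
  (forall i, w i x *m v = 0) -> hodge L w j x *m v = 0.
Proof.
move=> wv; rewrite hodgeE mulNmx mulmxDl -!scalemxAl !wv.
by rewrite !scaler0 addr0 oppr0.
Qed.

Let lor0 x : W x -> lor (cplx (s x)) (cplx (s x)) = 0.
Proof. by move=> Wx; rewrite lor_cplx snull. Qed.
Let lorj j x : W x -> lor (cplx (s x)) (cplx (pd j s x)) = 0.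
Proof. by move=> Wx; rewrite lor_cplx (lor_lift_pd Wo ss snull). Qed.

Lemma Lambda1_orth x v : W x -> v \in Lambda1 L x -> lor v (cplx (s x)) = 0.
Proof.
move=> Wx; rewrite (Lambda1_lift HL sW Wx).
exact: span3_orth (lor0 Wx) (lorj 0 Wx) (lorj 1 Wx).
Qed.

Lemma multiplier_wedge (q : cend) x : W x ->
  q \in wedgev (Lambda0 L x) (Lambda1 L x) ->
  exists2 v, v \in Lambda1 L x & q = wedge (cplx (s x)) v.
Proof. by move=> Wx; rewrite (Lambda0_lift HL sW Wx) => /wedgev_line. Qed.

Section Multiplier.
Variables (q : mform R n.+1 n.+1) (x : P).
Hypothesis Wx : W x.
Hypothesis qmem : forall i, q i x \in wedgev (Lambda0 L x) (Lambda1 L x).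

Lemma multiplier_kill i : q i x *m cplx (s x) = 0.
Proof.
have [v vL ->] := multiplier_wedge Wx (qmem i).
exact: wedge_null_kill (lor0 Wx) (Lambda1_orth Wx vL).
Qed.

Lemma hodge_multiplier_mem j :
  hodge L q j x \in wedgev (Lambda0 L x) (Lambda1 L x).
Proof.
by rewrite hodgeE memvN; exact: memvD (memvZ _ (qmem 0)) (memvZ _ (qmem 1)).
Qed.

Lemma multiplier_comm : q 0 x *m q 1 x = q 1 x *m q 0 x.
Proof.
have [v vL ->] := multiplier_wedge Wx (qmem 0).
have [w wL ->] := multiplier_wedge Wx (qmem 1).
exact: wedge_null_comm (lor0 Wx) (Lambda1_orth Wx vL) (Lambda1_orth Wx wL).
Qed.

(** A wedge of two vectors of S has image in S and kills the orthogonal of S, so the projection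
    fixes it from both sides. *)
Lemma multiplier_even i : reflS L x *m q i x *m reflS L x = q i x.
Proof.
have [v vL ->] := multiplier_wedge Wx (qmem i).
have [sm _ _ _] := frame4_mem Wx.
have vm : v \in csc L x by exact: (subvP (addvSl _ _) _ vL).
have [h1 h2] := wedge_proj (projS_spec HL (WU Wx)) sm vm.
by rewrite /reflS; exact: refl_conj h1 h2.
Qed.

End Multiplier.

End FrameFacts.

Lemma cplx_tension (R : realType) m (g f e : R) (A B D E : 'cV[R]_m) :
  cplx (g *: A - f *: B - f *: D + e *: E) =
  g%:C *: cplx A - f%:C *: cplx B - f%:C *: cplx D + e%:C *: cplx E.
Proof. by rewrite cplxD !cplxB !cplxZ. Qed.

Lemma free3P (K : fieldType) (V : vectType K) (a b c : V) :
  free [:: a; b; c] <-> forall k0 k1 k2 : K,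
    k0 *: a + k1 *: b + k2 *: c = 0 -> [/\ k0 = 0, k1 = 0 & k2 = 0].
Proof.
split=> [fr k0 k1 k2 E|H].
  have /freeP/(_ (fun i : 'I_3 => [:: k0; k1; k2]`_i)) := fr.
  rewrite !big_ord_recl big_ord0 /= addr0 addrA => /(_ E) h.
  by split; [exact: (h (@Ordinal 3 0 isT))|exact: (h (@Ordinal 3 1 isT))
    |exact: (h (@Ordinal 3 2 isT))].
apply: (introT (@freeP K V 3 [tuple a; b; c])) => k.
rewrite !big_ord_recl big_ord0 /= addr0 addrA => /H[h0 h1 h2] i.
by case: i => [[|[|[|//]]] hi]; [rewrite -h0|rewrite -h1|rewrite -h2];
  congr k; exact/val_inj.
Qed.

Lemma tension_gauge_cplx (R : realType) n (g f e g' f' e' : R)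
    (Phi A0 A1 : 'M[R[i]]_n.+2) (k : R[i]) (s a b s00 s01 s10 s11
    t00 t01 t10 t11 : 'cV[R]_n.+2) :
  g' = g -> f' = f -> e' = e ->
  g%:C *: (A0 *m cplx a) - f%:C *: (A0 *m cplx b) - f%:C *: (A1 *m cplx a)
  + e%:C *: (A1 *m cplx b) = k *: cplx s ->
  cplx t00 = Phi *m A0 *m cplx a + Phi *m cplx s00 ->
  cplx t01 = Phi *m A0 *m cplx b + Phi *m cplx s01 ->
  cplx t10 = Phi *m A1 *m cplx a + Phi *m cplx s10 ->
  cplx t11 = Phi *m A1 *m cplx b + Phi *m cplx s11 ->
  cplx (g' *: t00 - f' *: t01 - f' *: t10 + e' *: t11) =
  Phi *m cplx (g *: s00 - f *: s01 - f *: s10 + e *: s11) + k *: (Phi *m cplx s).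
Proof.
move=> -> -> -> h h00 h01 h10 h11; rewrite !cplx_tension.
exact: tension_gauge h h00 h01 h10 h11.
Qed.

Lemma eq_span4 (K : fieldType) (V : vectType K) (a b c a' b' c' d : V) :
  a = a' -> b = b' -> c = c' ->
  <<[:: a; b; c; d]>>%VS = <<[:: a'; b'; c'; d]>>%VS.
Proof. by move=> -> -> ->. Qed.

Lemma eq_span3 (K : fieldType) (V : vectType K) (a b c a' b' c' : V) :
  a = a' -> b = b' -> c = c' -> <<[:: a; b; c]>>%VS = <<[:: a'; b'; c']>>%VS.
Proof. by move=> -> -> ->. Qed.

Section SpanGauge.
Variables (K : fieldType) (n : nat).
Local Notation vec := 'cV[K]_n.+2.
Variables (Phi Psi : 'M[K]_n.+2) (a b c d d' : vec) (k : K).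
Hypothesis PsiPhi : Psi *m Phi = 1%:M.
Hypothesis dE : d' = Phi *m d + k *: (Phi *m a).

(** The last vector is carried over only up to a multiple of the first, a triangular change that
    leaves the span intact. *)
Lemma span_gauge v : v \in <<[:: a; b; c; d]>>%VS ->
  Phi *m v \in <<[:: Phi *m a; Phi *m b; Phi *m c; d']>>%VS.
Proof.
have [h0 h1 h2 h3] := mem_span4_gen (Phi *m a) (Phi *m b) (Phi *m c) d'.
move=> /mem_span4[k0 [k1 [k2 [k3 ->]]]]; rewrite !mulmxDr -!scalemxAr.
have -> : Phi *m d = d' - k *: (Phi *m a) by rewrite dE addrK.
by rewrite !memvD ?memvZ // memvB // memvZ.
Qed.

Lemma span_gauge_inv u : u \in <<[:: Phi *m a; Phi *m b; Phi *m c; d']>>%VS ->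
  Psi *m u \in <<[:: a; b; c; d]>>%VS.
Proof.
have [h0 h1 h2 h3] := mem_span4_gen a b c d.
move=> /mem_span4[k0 [k1 [k2 [k3 ->]]]]; rewrite dE !mulmxDr -!scalemxAr.
rewrite !mulmxDr -!scalemxAr !mulmxA PsiPhi !mul1mx.
by rewrite !memvD ?memvZ // memvD // memvZ.
Qed.

Lemma span3_gauge v : v \in <<[:: a; b; c]>>%VS ->
  Phi *m v \in <<[:: Phi *m a; Phi *m b; Phi *m c]>>%VS.
Proof.
have [h0 h1 h2] := mem_span3 (Phi *m a) (Phi *m b) (Phi *m c).
rewrite !span_cons span_nil !addv0 => /memv_addP[_ /vlineP[k0 ->]]
  [_ /memv_addP[_ /vlineP[k1 ->]] [_ /vlineP[k2 ->] ->] ->].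
rewrite !mulmxDr -!scalemxAr.
apply: memv_add; first by apply: memvZ; exact: memv_line.
by apply: memv_add; apply: memvZ; exact: memv_line.
Qed.

End SpanGauge.

(** * Geometry of the deformed surface *)

Section GaugeGeometry.
Variables (R : realType) (n : nat) (U : set 'rV[R]_2).
Local Notation C := R[i].
Local Notation P := 'rV[R]_2.
Local Notation rvec := 'cV[R]_n.+2.
Local Notation cvec := 'cV[C]_n.+2.
Local Notation cend := 'M[C]_n.+2.
Variables (L : P -> {vspace rvec}) (q : mform R n.+1 n.+1) (phi : P -> 'M[R]_n.+2).
Hypothesis HL : is_surface U L.
Hypothesis qmem : forall i x, U x -> q i x \in wedgev (Lambda0 L x) (Lambda1 L x).
Hypothesis phis : smooth U phi.
Hypothesis phi_iso : forall x, U x -> (phi x)^T *m eta R n *m phi x = eta R n.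
Variables (al be ga de : C).
(** phi^-1 dphi with arbitrary coefficients: the geometry uses only that it combines N, q and their
    duals. *)
Let A : mform R n.+1 n.+1 := fun i x =>
  - calN L i x + comb L al be (calN L) i x + comb L ga de q i x.
Hypothesis dPhi : forall i x, U x ->
  cpd i (fun y => cplx (phi y)) x = cplx (phi x) *m A i x.
Let Uo : open U. Proof. by case: HL. Qed.
Local Notation L' := (gauge_surface phi L).

Let psi y : 'M[R]_n.+2 := iso_inv (phi y).
Let psiphi x : U x -> psi x *m phi x = 1%:M.
Proof. by move=> Ux; exact: iso_invl (phi_iso Ux). Qed.

Section OneLift.
Variables (W : set P) (s : P -> rvec).
Hypothesis sW : lift_on U L W s.
Let Wo : open W. Proof. by case: sW. Qed.
Let ss : smooth W s. Proof. by case: sW. Qed.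
Let WU y : W y -> U y. Proof. by case: sW => _ + _ _; apply. Qed.
Let phisW : smooth W phi. Proof. by apply: smooth_sub phis => y; exact: WU. Qed.
Let s' y : rvec := phi y *m s y.

Let A_kill i x : W x -> A i x *m cplx (s x) = 0.
Proof.
move=> Wx; apply: form_kill.
- exact: (calN_lift HL sW).
- by apply: hodge_kill => j; exact: (calN_lift HL sW).
- exact: (multiplier_kill HL sW Wx (fun j => qmem j (WU Wx))).
- apply: hodge_kill => j.
  exact: (multiplier_kill HL sW Wx (fun j => qmem j (WU Wx))).
Qed.

Let cplx_pd_gauge (f : P -> rvec) i x : smooth W f -> W x ->
  cplx (pd i (fun y => phi y *m f y) x) =
  cplx (phi x) *m A i x *m cplx (f x) + cplx (phi x) *m cplx (pd i f x).
Proof.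
move=> sf Wx; apply: etrans (esym (cpd_cplx i _ x)) _.
transitivity (cpd i (fun y => cplx (phi y) *m cplx (f y)) x).
  by apply: (eq_cpd Wo) => // y _; exact: cplxM.
apply: etrans (cpdM Wo i (csmooth_cplx Wo phisW) (csmooth_cplx Wo sf) Wx) _.
rewrite (dPhi i (WU Wx)); congr (_ + _ *m _); exact: cpd_cplx.
Qed.

(** The term A s of the product rule vanishes; consequently phi s and s induce the same metric. *)
Lemma pd_gauge_lift i x : W x -> pd i s' x = phi x *m pd i s x.
Proof.
move=> Wx; apply: cplx_inj; apply: etrans (cplx_pd_gauge i ss Wx) _.
by rewrite -mulmxA A_kill // mulmx0 add0r cplxM.
Qed.

Let pd2_gauge i j x : W x -> cplx (pd i (pd j s') x) =
  cplx (phi x) *m A i x *m cplx (pd j s x) + cplx (phi x) *m cplx (pd i (pd j s) x).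
Proof.
move=> Wx; apply: etrans _ (cplx_pd_gauge i (smooth_pd j ss) Wx).
by congr cplx; apply: (eq_pd Wo) => // y; exact: pd_gauge_lift.
Qed.

Lemma metric_gauge_lift x : W x -> metric s' x = metric s x.
Proof.
move=> Wx; apply/matrixP => i j; rewrite metricE (metricE s).
rewrite (pd_gauge_lift i Wx) (pd_gauge_lift j Wx).
exact: iso_lor (phi_iso (WU Wx)) _ _.
Qed.

(** The metric trace of B(ds), with the coefficients of [tension]; it measures how far phi is from
    commuting with [tension]. *)
Let Z (x : P) (B : mform R n.+1 n.+1) : cvec :=
  (metric s x 1 1)%:C *: (B 0 x *m cplx (pd 0 s x))
  - (metric s x 0 1)%:C *: (B 0 x *m cplx (pd 1 s x))
  - (metric s x 0 1)%:C *: (B 1 x *m cplx (pd 0 s x))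
  + (metric s x 0 0)%:C *: (B 1 x *m cplx (pd 1 s x)).

Let ZN x : W x -> Z x (calN L) = 0.
Proof.
move=> Wx; apply: (tension_contract (calN_lift_pd HL sW 0 0 Wx)
  (calN_lift_pd HL sW 0 1 Wx) (calN_lift_pd HL sW 1 0 Wx)
  (calN_lift_pd HL sW 1 1 Wx)).
have [_ _ _ tm] := frame4_mem HL sW Wx.
have := projS_csc HL (WU Wx) tm.
by rewrite /tension cplx_tension.
Qed.

Let ZhN x : W x -> Z x (hodge L (calN L)) = 0.
Proof.
move=> Wx; rewrite /Z !hodgeE (cstruct_lift HL sW Wx) !JmxE /=.
rewrite (metricC s x 1 0) !rmorphM !rmorphN /=.
apply: star_contract.
(* N_1 d_0 s and N_0 d_1 s are the normal parts of the two mixed second derivatives of s, which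
   agree. *)
apply: etrans (calN_lift_pd HL sW 1 0 Wx) _.
apply: etrans _ (esym (calN_lift_pd HL sW 0 1 Wx)).
by rewrite (pd_mx_comm Wo 1 0 ss Wx).
Qed.

Let Zq x (r : mform R n.+1 n.+1) : W x ->
  (forall i, r i x \in wedgev (Lambda0 L x) (Lambda1 L x)) ->
  exists k, Z x r = k *: cplx (s x).
Proof.
move=> Wx rm; rewrite /Z.
have [v vL ->] := multiplier_wedge HL sW Wx (rm 0).
have [w wL ->] := multiplier_wedge HL sW Wx (rm 1).
have l j : lor (cplx (s x)) (cplx (pd j s x)) = 0.
  rewrite lor_cplx (lor_lift_pd Wo ss _ j Wx) //.
  by move=> y Wy; exact: (lift_on_null HL sW Wy).
exact: wedge_contract (l 0) (l 1).
Qed.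

Let ZA x : W x -> exists k, Z x A = k *: cplx (s x).
Proof.
move=> Wx.
have [k0 E0] := Zq Wx (fun i => qmem i (WU Wx)).
have [k1 E1] := Zq Wx (hodge_multiplier_mem (fun i => qmem i (WU Wx))).
exists (ga * k0 + de * k1).
exact: form_contract_line (ZN Wx) (ZhN Wx) E0 E1.
Qed.

(** The metric is unchanged and the second derivatives of phi s differ from the images of those of s
    by A(ds), whose trace is a multiple of s. *)
Lemma tension_gauge_lift x : W x -> exists k, cplx (tension s' x) =
  cplx (phi x) *m cplx (tension s x) + k *: (cplx (phi x) *m cplx (s x)).
Proof.
move=> Wx; have [k E] := ZA Wx; exists k.
have m i j : metric s' x i j = metric s x i j by rewrite metric_gauge_lift.
exact: (tension_gauge_cplx (m 1 1) (m 0 1) (m 0 0) E (pd2_gauge 0 0 Wx)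
  (pd2_gauge 0 1 Wx) (pd2_gauge 1 0 Wx) (pd2_gauge 1 1 Wx)).
Qed.

Lemma lift_on_gauge : lift_on U L' W s'.
Proof.
have [_ WU' _ H] := sW; split => //; first exact: (smooth_mulmx Wo).
move=> y Wy; have [s0 LE] := H y Wy; split.
  apply: contraNneq s0 => s'0.
  by rewrite -[s y]mul1mx -(psiphi (WU Wy)) -mulmxA -/(s' y) s'0 mulmx0.
by rewrite /gauge_surface LE limg_line lfunE.
Qed.

End OneLift.

Lemma gauge_is_surface : is_surface U L'.
Proof.
have [_ nullL H] := HL; split => //.
  move=> x v Ux /memv_imgP[w wL ->]; rewrite lfunE /=.
  by rewrite (iso_lor (phi_iso Ux)); exact: nullL Ux wL.
move=> x Ux; have [s ls fr] := H x Ux.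
have [W sW Wx] := is_lift_lift_on HL ls Ux.
exists (fun y => phi y *m s y).
  exact: lift_on_is_lift (lift_on_gauge sW) Wx.
rewrite (pd_gauge_lift sW 0 Wx) (pd_gauge_lift sW 1 Wx).
apply/free3P => k0 k1 k2 E; apply/(free3P (s x) (pd 0 s x) (pd 1 s x)).1 => //.
rewrite !scalemxAr -!mulmxDr in E.
by rewrite -[LHS]mul1mx -(psiphi Ux) -mulmxA E mulmx0.
Qed.

Lemma cstruct_gauge x : U x -> cstruct L' x = cstruct L x.
Proof.
move=> Ux; have [W lW Wx] := local_lift_on HL Ux.
rewrite (cstruct_lift gauge_is_surface (lift_on_gauge lW) Wx).
by rewrite (cstruct_lift HL lW Wx) (metric_gauge_lift lW Wx).
Qed.

Let PsiPhi x : U x -> cplx (psi x) *m cplx (phi x) = 1%:M.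
Proof. by move=> Ux; rewrite -cplxM psiphi // cplx1. Qed.

(** One frame describes the bundles of both surfaces at x, so that membership transfers by linear
    algebra alone. *)
Lemma frame_gauge x : U x -> exists (a b c d d' : cvec) (k : C),
  [/\ csc L x = <<[:: a; b; c; d]>>%VS,
      csc L' x = <<[:: cplx (phi x) *m a; cplx (phi x) *m b; cplx (phi x) *m c; d']>>%VS,
      d' = cplx (phi x) *m d + k *: (cplx (phi x) *m a),
      Lambda1 L x = <<[:: a; b; c]>>%VS &
      Lambda1 L' x = <<[:: cplx (phi x) *m a; cplx (phi x) *m b; cplx (phi x) *m c]>>%VS
      /\ (Lambda0 L x = <[a]>%VS /\ Lambda0 L' x = <[cplx (phi x) *m a]>%VS)].
Proof.
move=> Ux; have [W lW Wx] := local_lift_on HL Ux.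
set s := local_lift L x in lW.
have [k tE] := tension_gauge_lift lW Wx.
have lW' := lift_on_gauge lW.
exists (cplx (s x)), (cplx (pd 0 s x)), (cplx (pd 1 s x)), (cplx (tension s x)).
exists (cplx (tension (fun y => phi y *m s y) x)), k.
have E0 : cplx (pd 0 (fun y => phi y *m s y) x) = cplx (phi x) *m cplx (pd 0 s x).
  rewrite (pd_gauge_lift lW 0 Wx); exact: cplxM.
have E1 : cplx (pd 1 (fun y => phi y *m s y) x) = cplx (phi x) *m cplx (pd 1 s x).
  rewrite (pd_gauge_lift lW 1 Wx); exact: cplxM.
have Es : cplx (phi x *m s x) = cplx (phi x) *m cplx (s x) by exact: cplxM.
split; [exact: (csc_lift HL lW Wx)| |exact: tE|exact: (Lambda1_lift HL lW Wx)|split].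
- by apply: etrans (csc_lift gauge_is_surface lW' Wx) _; exact: eq_span4 Es E0 E1.
- by apply: etrans (Lambda1_lift gauge_is_surface lW' Wx) _; exact: eq_span3 Es E0 E1.
- split; first exact: (Lambda0_lift HL lW Wx).
  by rewrite -Es; exact: (Lambda0_lift gauge_is_surface lW' Wx).
Qed.

Lemma csc_gauge x v : U x -> v \in csc L x -> cplx (phi x) *m v \in csc L' x.
Proof.
move=> Ux; have [a [b [c [d [d' [k [-> -> dE _ _]]]]]]] := frame_gauge Ux.
exact: span_gauge dE _.
Qed.

Lemma csc_gauge_inv x u : U x -> u \in csc L' x -> cplx (psi x) *m u \in csc L x.
Proof.
move=> Ux; have [a [b [c [d [d' [k [-> -> dE _ _]]]]]]] := frame_gauge Ux.
exact: span_gauge_inv (PsiPhi Ux) dE _.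
Qed.

Lemma Lambda1_gauge x v : U x -> v \in Lambda1 L x ->
  cplx (phi x) *m v \in Lambda1 L' x.
Proof.
move=> Ux; have [a [b [c [d [d' [k [_ _ _ -> [-> _]]]]]]]] := frame_gauge Ux.
exact: span3_gauge.
Qed.

Lemma Lambda0_gauge x v : U x -> v \in Lambda0 L x ->
  cplx (phi x) *m v \in Lambda0 L' x.
Proof.
move=> Ux; have [a [b [c [d [d' [k [_ _ _ _ [_ [-> ->]]]]]]]]] := frame_gauge Ux.
by move=> /vlineP[l ->]; rewrite -scalemxAr memvZ // memv_line.
Qed.

Lemma cplx_phi_iso x : U x ->
  (cplx (phi x))^T *m eta C n *m cplx (phi x) = eta C n.
Proof. by move=> Ux; rewrite -cplx_eta -cplxT -!cplxM phi_iso. Qed.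

Lemma lorthogonal_gauge x w : U x -> lorthogonal (csc L x) w ->
  lorthogonal (csc L' x) (cplx (phi x) *m w).
Proof.
move=> Ux ow u um.
have PhiPsi : cplx (phi x) *m cplx (psi x) = 1%:M by exact/mulmx1C/PsiPhi.
rewrite -[u]mul1mx -PhiPsi -mulmxA (iso_lor (cplx_phi_iso Ux)).
exact: ow (csc_gauge_inv Ux um).
Qed.

Lemma projS_gauge x : U x -> projS L' x =
  cplx (phi x) *m projS L x *m cplx (psi x).
Proof.
move=> Ux; apply: orth_projP => w.
have [Pm Po] := projS_spec HL Ux (cplx (psi x) *m w).
have PhiPsi : cplx (phi x) *m cplx (psi x) = 1%:M by exact/mulmx1C/PsiPhi.
split; first by rewrite -!mulmxA; exact: csc_gauge.
have := lorthogonal_gauge Ux Po.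
by rewrite mulmxBr (mulmxA (cplx (phi x))) PhiPsi mul1mx !mulmxA.
Qed.

End GaugeGeometry.

(** * Reality conditions *)

Section Conj.
Variable R : realType.
Local Notation C := R[i].

Lemma imag_sqr : 'i%C * 'i%C = -1 :> C.
Proof. by apply: complexP; rewrite /=; ring. Qed.

Lemma conjc_unimodular (mu : C) : `|mu| = 1 -> conjc mu = mu^-1.
Proof.
move=> h; have mu0 : mu != 0 by rewrite -normr_eq0 h oner_neq0.
apply: (mulfI mu0); rewrite mulfV //.
by have := normCK mu; rewrite h expr1n => /esym.
Qed.

Lemma conj_mxM a b c (A : 'M[C]_(a, b)) (B : 'M[C]_(b, c)) :
  conj_mx (A *m B) = conj_mx A *m conj_mx B.
Proof. exact: (map_mxM (@conjc R)). Qed.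
Lemma conj_mxD a b (A B : 'M[C]_(a, b)) : conj_mx (A + B) = conj_mx A + conj_mx B.
Proof. exact: (map_mxD (@conjc R)). Qed.
Lemma conj_mxN a b (A : 'M[C]_(a, b)) : conj_mx (- A) = - conj_mx A.
Proof. exact: (map_mxN (@conjc R)). Qed.
Lemma conj_mxZ a b k (A : 'M[C]_(a, b)) : conj_mx (k *: A) = conjc k *: conj_mx A.
Proof. exact: (map_mxZ (@conjc R)). Qed.

Lemma conj_cplx_mulmxZ a b c (A : 'M[R]_(a, b)) k (B : 'M[C]_(b, c)) :
  conj_mx (cplx A *m (k *: B)) = cplx A *m (conjc k *: conj_mx B).
Proof. by rewrite conj_mxM conj_cplx conj_mxZ. Qed.

Lemma conjc_real (k : R) : conjc k%:C = k%:C.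
Proof. by rewrite /= oppr0. Qed.

Lemma conj_comb n (L : 'rV[R]_2 -> {vspace 'cV[R]_n.+2}) (c s : C)
    (w : mform R n.+1 n.+1) j x :
  conjc c = c -> conjc s = s -> (forall i, conj_mx (w i x) = w i x) ->
  conj_mx (comb L c s w j x) = comb L c s w j x.
Proof.
move=> hc hs hw; rewrite /comb conj_mxD !conj_mxZ hw hc hs hodgeE.
by rewrite conj_mxN conj_mxD !conj_mxZ !conjc_real !hw.
Qed.

(** With [conjc_sin], makes the coefficients of q_mu real, hence the new multiplier real. *)
Lemma conjc_cos (m : C) : conjc m = m^-1 -> m != 0 ->
  conjc ((m ^+ 2 + m ^- 2) / 2) = (m ^+ 2 + m ^- 2) / 2.
Proof.
move=> hm m0; have mj : conjc (m ^+ 2) = m ^- 2 by rewrite rmorphXn /= hm exprVn.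
have mj' : conjc (m ^- 2) = m ^+ 2 by rewrite fmorphV /= mj invrK.
have h2 : conjc 2^-1 = 2^-1 :> C by rewrite fmorphV (rmorph_nat (@conjc R)).
have hM (x y : C) : conjc (x * y) = conjc x * conjc y by exact: (rmorphM (@conjc R)).
have hD (x y : C) : conjc (x + y) = conjc x + conjc y by exact: (rmorphD (@conjc R)).
rewrite hM hD mj mj' h2.
by rewrite addrC.
Qed.

Lemma conjc_sin (m : C) : conjc m = m^-1 -> m != 0 ->
  conjc ('i%C * (m ^+ 2 - m ^- 2) / 2) = 'i%C * (m ^+ 2 - m ^- 2) / 2.
Proof.
move=> hm m0; have mj : conjc (m ^+ 2) = m ^- 2 by rewrite rmorphXn /= hm exprVn.
have mj' : conjc (m ^- 2) = m ^+ 2 by rewrite fmorphV /= mj invrK.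
have h2 : conjc 2^-1 = 2^-1 :> C by rewrite fmorphV (rmorph_nat (@conjc R)).
have hM (x y : C) : conjc (x * y) = conjc x * conjc y by exact: (rmorphM (@conjc R)).
have hB (x y : C) : conjc (x - y) = conjc x - conjc y by exact: (rmorphB (@conjc R)).
rewrite !hM hB mj mj' h2.
have -> : conjc 'i%C = - 'i%C :> C by apply: complexP; rewrite /= ?oppr0.
by rewrite mulNr -mulrN opprB.
Qed.

End Conj.

Section Misc.
Variables (R : realType) (U : set 'rV[R]_2).
Hypothesis Uo : open U.

Lemma csmooth_sum a b (I : Type) (r : seq I) (F : I -> 'rV[R]_2 -> 'M[R[i]]_(a.+1, b.+1)) :
  (forall i, csmooth U (F i)) -> csmooth U (fun y => \sum_(i <- r) F i y).
Proof.
move=> sF; elim: r => [|i r IH].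
  by apply: (eq_csmooth Uo _ (csmooth_cst Uo 0)) => y _; rewrite big_nil.
apply: (eq_csmooth Uo _ (csmoothD Uo (sF i) IH)) => y _.
by rewrite big_cons.
Qed.

Lemma invmx_uniq (K : comUnitRingType) m (A B : 'M[K]_m) : B *m A = 1%:M -> invmx A = B.
Proof.
move=> BA; have [_ AU] := mulmx1_unit BA.
by rewrite -[LHS]mul1mx -BA -mulmxA mulmxV // mulmx1.
Qed.

Lemma lorthogonalZ (K : fieldType) n (V : {vspace 'cV[K]_n.+2}) k w :
  lorthogonal V w -> lorthogonal V (k *: w).
Proof. by move=> ow u uV; rewrite lorZl ow // mulr0. Qed.

Lemma iso_inv_cplx n (A : 'M[R]_n.+2) : cplx (iso_inv A) = iso_inv (cplx A).
Proof. by rewrite /iso_inv !cplxM cplx_eta cplxT. Qed.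

End Misc.

(** * The deformation at a unimodular parameter *)

Section Spectral.
Variables (R : realType) (n : nat) (U : set 'rV[R]_2).
Local Notation C := R[i].
Local Notation P := 'rV[R]_2.
Local Notation rvec := 'cV[R]_n.+2.
Local Notation cvec := 'cV[C]_n.+2.
Local Notation cend := 'M[C]_n.+2.
Variables (L : P -> {vspace rvec}) (q : mform R n.+1 n.+1).
Variables (mu : C) (phi : P -> 'M[R]_n.+2).
Hypothesis hcw : constrained_willmore U L q.
Hypothesis hmu : `|mu| = 1.
Hypothesis hphi : intertwining_isometry U L q mu phi.

Local Notation L' := (gauge_surface phi L).
Local Notation q' := (Ad phi (qmu L q mu)).
Local Notation a := ((mu + mu^-1) / 2).
Local Notation b := ('i%C * (mu - mu^-1) / 2).
Local Notation c := (a ^+ 2 - b ^+ 2).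
Local Notation s := (2 * (a * b)).
Let Phi y : cend := cplx (phi y).
Let Psi y : cend := cplx (iso_inv (phi y)).

Let HL : is_surface U L. Proof. by case: hcw. Qed.
Let Uo : open U. Proof. by case: HL. Qed.
Let qs i : csmooth U (q i). Proof. by case: hcw. Qed.
Let qconj i x (Ux : U x) : conj_mx (q i x) = q i x.
Proof. by have [_ _ /(_ i x Ux)[]] := hcw. Qed.
Let qmem i x (Ux : U x) : q i x \in wedgev (Lambda0 L x) (Lambda1 L x).
Proof. by have [_ _ /(_ i x Ux)[]] := hcw. Qed.
Let dDq x (Ux : U x) : dD L q x = 0.
Proof. by have [_ _ _ h _] := hcw; exact: h. Qed.
Let cwq x (Ux : U x) : dD L (hodge L (calN L)) x =
  2 *: brac_wedge q (hodge L (calN L)) x.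
Proof. by have [_ _ _ _ h] := hcw; exact: h. Qed.

Let mu0 : mu != 0. Proof. exact: unimodular_neq0. Qed.
Let ab : a ^+ 2 + b ^+ 2 = 1.
Proof. exact (cos_sin_sqr (imag_sqr R) mu0). Qed.

Let phis : smooth U phi. Proof. by case: hphi. Qed.
Let phi_iso x (Ux : U x) : (phi x)^T *m eta R n *m phi x = eta R n.
Proof. by apply: lor_isometry_mx => u v; have [_ h _] := hphi; exact: h. Qed.

Let Phis : csmooth U Phi. Proof. exact: csmooth_cplx. Qed.
Let Psis : csmooth U Psi.
Proof.
apply: (csmooth_cplx Uo).
have sE : smooth U (fun _ : P => eta R n) by exact: smooth_cst.
exact: (smooth_mulmx Uo (smooth_mulmx Uo sE (smooth_tr Uo phis)) sE).
Qed.
Let PsiPhi x (Ux : U x) : Psi x *m Phi x = 1%:M.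
Proof. by rewrite /Psi /Phi -cplxM (iso_invl (phi_iso Ux)) cplx1. Qed.
Let PhiPsi x (Ux : U x) : Phi x *m Psi x = 1%:M.
Proof. exact/mulmx1C/PsiPhi. Qed.

Let Ps := csmooth_projS HL.
Let PP x (Ux : U x) : projS L x *m projS L x = projS L x := projS_idem HL Ux.
Let Js := smooth_cstruct HL.
Let Jtr x (Ux : U x) := cstruct_tr HL Ux.
Let Jdet x (Ux : U x) := cstruct_det HL Ux.

Let qeven i x (Ux : U x) : reflS L x *m q i x *m reflS L x = q i x.
Proof.
have [W lW Wx] := local_lift_on HL Ux.
exact: (multiplier_even HL lW Wx (fun j => qmem j Ux)).
Qed.

Let qcomm x (Ux : U x) : q 0 x *m q 1 x = q 1 x *m q 0 x.
Proof.
have [W lW Wx] := local_lift_on HL Ux.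
exact: (multiplier_comm HL lW Wx (fun j => qmem j Ux)).
Qed.

(** On constant fields d vanishes, so the intertwining identity reads off the derivative of phi. *)
Let dPhi i x : U x -> cpd i Phi x = Phi x *m
  (- calN L i x + comb L a b (calN L) i x + comb L (c - 1) s q i x).
Proof.
move=> Ux; apply: eq_mulmx_col => w.
have sw : csmooth U (fun _ : P => w) by exact: csmooth_cst.
have [_ _ /(_ _ sw i x Ux) E] := hphi.
have E1 : cpd i (fun y => Phi y *m w) x = cpd i Phi x *m w.
  apply: etrans (cpdM Uo i Phis sw Ux) _.
  by rewrite (cpd_cst i w) mulmx0 addr0.
apply: etrans (esym E1) _; apply: etrans E _.
rewrite dlambda_comb (calD_E Uo Ps (fun y => @PP y) i sw Ux) (cpd_cst i w) sub0r.
rewrite (cos_double (imag_sqr R) mu0) (sin_double 'i%C mu0).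
by rewrite -mulNmx -mulmxDl addrA mulmxA.
Qed.

Let PS' x (Ux : U x) : projS L' x = Phi x *m projS L x *m Psi x :=
  projS_gauge HL qmem phis phi_iso dPhi Ux.
Let JJ' x (Ux : U x) : cstruct L' x = cstruct L x :=
  cstruct_gauge HL qmem phis phi_iso dPhi Ux.

Lemma qmu_comb i x : qmu L q mu i x = comb L c s q i x.
Proof.
rewrite /qmu types_comb (cos_sqr (imag_sqr R) mu0) (sin_sqr 'i%C mu0).
by [].
Qed.

Lemma Ad_comb i x : U x -> q' i x = Phi x *m comb L c s q i x *m Psi x.
Proof. by move=> Ux; rewrite /Ad qmu_comb (invmx_uniq (PsiPhi Ux)). Qed.

Lemma spectral_constrained_willmore : constrained_willmore U L' q'.
Proof.
have Qs i : csmooth U (comb L c s q i) by exact: (csmooth_comb Uo Js).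
split.
- exact (gauge_is_surface HL qmem phis phi_iso dPhi).
- move=> i; apply: (eq_csmooth Uo _ (csmooth_gauge Uo Phis Psis (Qs i))) => y Uy.
  exact/esym/Ad_comb.
- move=> i x Ux; rewrite (Ad_comb i Ux); split.
    rewrite !conj_mxM !conj_cplx (conj_comb _ _ _ _ (fun j => qconj j Ux)) //.
      rewrite -(cos_sqr (imag_sqr R) mu0).
      exact: conjc_cos (conjc_unimodular hmu) mu0.
    rewrite -(sin_sqr 'i%C mu0).
    exact: conjc_sin (conjc_unimodular hmu) mu0.
  have [W lW Wx] := local_lift_on HL Ux.
  have Qm : comb L c s q i x \in wedgev (Lambda0 L x) (Lambda1 L x).
    apply: memvD (memvZ _ (qmem i Ux)) (memvZ _ _).
    exact: (hodge_multiplier_mem (fun j => qmem j Ux)).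
  have [v vL ->] := multiplier_wedge HL lW Wx Qm.
  (* Conjugation by an isometry acts on a wedge through its two factors, which phi maps into the
     bundles of the new surface. *)
  rewrite /Phi /Psi iso_inv_cplx (wedge_conj (cplx_phi_iso phi_iso Ux)).
  apply: memv_wedgev.
    apply: (Lambda0_gauge HL qmem phis phi_iso dPhi Ux).
    by rewrite (Lambda0_lift HL lW Wx) memv_line.
  exact: (Lambda1_gauge HL qmem phis phi_iso dPhi Ux vL).
- move=> x Ux; exact: (dD_multiplier_gauge ab Uo Ps (fun y => @PP y) Js
    (fun y => @Jtr y) (fun y => @Jdet y) Phis Psis (fun y => @PsiPhi y)
    (fun y => @PhiPsi y) qs (fun i y => @qeven i y) (fun y => @qcomm y)
    (fun y => @dDq y) (fun y => @PS' y) dPhi Ad_comb Ux).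
- move=> x Ux; exact: (willmore_gauge ab Uo Ps (fun y => @PP y) Js
    (fun y => @Jtr y) (fun y => @Jdet y) Phis Psis (fun y => @PsiPhi y)
    (fun y => @PhiPsi y) (fun i y => @qeven i y)
    (fun y => @cwq y) (fun y => @PS' y) (fun y => @JJ' y) dPhi Ad_comb Ux).
Qed.

Lemma spectral_dlambda lam i (v : P -> cvec) x : csmooth U v -> lam != 0 -> U x ->
  dlambda L' q' lam i (fun y => cplx (phi y) *m v y) x =
  cplx (phi x) *m dlambda L q (mu * lam) i v x.
Proof.
move=> sv lam0 Ux; rewrite !dlambda_comb.
rewrite -(cos_add (imag_sqr R) mu0 lam0) -(sin_add 'i%C mu0 lam0).
rewrite -(cos_add2 (imag_sqr R) mu0 lam0) -(sin_add2 (imag_sqr R) mu0 lam0).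
exact: (dlambda_gauge Uo Ps (fun y => @PP y)
    (fun y => @Jtr y) (fun y => @Jdet y) Phis Psis (fun y => @PsiPhi y)
    (fun y => @PhiPsi y) (fun i y => @qeven i y)
    (fun y => @PS' y) (fun y => @JJ' y) dPhi Ad_comb).
Qed.

Lemma csc_spectral x (v : cvec) : U x -> v \in csc L x -> cplx (phi x) *m v \in csc L' x.
Proof. move=> Ux; exact: (csc_gauge HL qmem phis phi_iso dPhi Ux). Qed.

Lemma lorthogonal_spectral x (w : cvec) : U x -> lorthogonal (csc L x) w ->
  lorthogonal (csc L' x) (cplx (phi x) *m w).
Proof. move=> Ux; exact: (lorthogonal_gauge HL qmem phis phi_iso dPhi Ux). Qed.

Lemma spectral_neq0 x (v : cvec) : U x -> v != 0 -> cplx (phi x) *m v != 0.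
Proof.
move=> Ux; apply: contraNneq => pv0.
by rewrite -[v]mul1mx -(PsiPhi Ux) -mulmxA pv0 mulmx0.
Qed.

End Spectral.

(** * Transport of the conserved quantity *)

Theorem theorem4p1 (R : realType) (n : nat) (hn : (3 <= n)%N)
  (U : set 'rV[R]_2) (L : 'rV[R]_2 -> {vspace 'cV[R]_n.+2})
  (q : mform R n.+1 n.+1) (d : nat)
  (hspecial : special_constrained_willmore U L q d)
  (mu : R[i]) (hmu : `|mu| = 1)
  (phi : 'rV[R]_2 -> 'M[R]_n.+2)
  (hphi : intertwining_isometry U L q mu phi)
  (p : R[i] -> 'rV[R]_2 -> 'cV[R[i]]_n.+2)
  (hp : conserved_quantity U L q d p)
  (hpmu : nonzero_section U (p mu)) :
  conserved_quantity U (gauge_surface phi L) (Ad phi (qmu L q mu)) d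
    (fun lambda x => cplx (phi x) *m p (mu * lambda) x).
Proof.
have [hcw [c [cs [pE [cconj [ctop [cpar [_ pflat]]]]]]]] := hp.
have Uo : open U by case: hcw => [[]].
have phis : smooth U phi by case: hphi.
have mu0 := unimodular_neq0 hmu.
have Phis := csmooth_cplx Uo phis.
have jk (j : 'I_d.*2.+1) : (`|j%:Z - d%:Z| <= d)%N.
  have : (j < d.*2.+1)%N by []; move: (nat_of_ord j) => k; rewrite ltnS -addnn; lia.
(* p is known on U only through its coefficients; its smoothness is needed to apply the product rule
   to phi p. *)
have ps lam : lam != 0 -> csmooth U (p lam).
  move=> lam0; apply: (eq_csmooth Uo
    (F := fun x => \sum_(j < d.*2.+1) (lam ^ (j%:Z - d%:Z)) *: c (j%:Z - d%:Z) x)).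
    by move=> x Ux; rewrite pE.
  by apply: (csmooth_sum Uo) => j; apply: (csmooth_scale Uo); exact: cs.
split; first exact: spectral_constrained_willmore.
(* Replacing lambda by mu lambda multiplies the coefficient of degree k by mu^k. *)
exists (fun k x => cplx (phi x) *m (mu ^ k *: c k x)).
split.
  by move=> k kd; apply: (csmoothM Uo) => //; apply: (csmooth_scale Uo); exact: cs.
split.
  move=> lam x lam0 Ux; rewrite pE ?mulf_neq0 // mulmx_sumr.
  by apply: eq_bigr => j _; rewrite -!scalemxAr scalerA expfzMl mulrC.
split.
  move=> k x kd Ux; rewrite conj_cplx_mulmxZ (cconj k x kd Ux).
  congr (_ *m (_ *: _)).
  (* The reality condition survives because the conjugate of mu^k is mu^(-k) on the unit circle. *)
  have hX : conjc (mu ^ k) = (conjc mu) ^ k by exact: (rmorphXz (@conjc R)).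
  by rewrite hX (conjc_unimodular hmu) exprz_inv.
split.
  move=> x Ux; apply: (lorthogonal_spectral hcw hmu hphi Ux).
  by apply: lorthogonalZ; exact: ctop.
split.
  move=> k x kd Ux; have := cpar k x kd Ux.
  case: (odd _ == odd _) => h.
    exact (lorthogonal_spectral hcw hmu hphi Ux (lorthogonalZ (mu ^ k) h)).
  exact (csc_spectral hcw hmu hphi Ux (memvZ (mu ^ k) h)).
split.
  (* The new quantity at lambda = 1 is phi p(mu), nonzero where p(mu) is. *)
  have [x Ux px] := hpmu; exists x => //.
  by rewrite mulr1; exact: (spectral_neq0 hphi Ux px).
move=> lam i x lam0 Ux.
have ml0 : mu * lam != 0 by rewrite mulf_neq0.
rewrite (spectral_dlambda hcw hmu hphi i (ps _ ml0) lam0 Ux) pflat //.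
exact: mulmx0.
Qed.
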